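(* Let $G=(V,E)$ be an input graph with arboricity $a$ and diameter $D$ in the Node-Capacitated Clique model, and let $s\in V$. There is an algorithm that computes a BFS tree rooted at $s$ in $O((a+D+\log n)\log n)$ rounds, w.h.p.; i.e., at termination every node $u$ knows $\delta(u)$, the length of a shortest (unweighted) path from $s$ to $u$ in $G$, and $\pi(u)$, the predecessor of $u$ on a shortest path from $s$ to $u$, ties broken in favor of the smallest identifier.
   Context: Node-Capacitated Clique model: a set $V$ of $n$ nodes with unique identifiers from $\{0,\dots,n-1\}$, all known to every node; synchronous rounds; per round each node may perform arbitrary local computation and send distinct messages of $O(\log n)$ bits to up to $O(\log n)$ other nodes, and receives at most $O(\log n)$ messages (excess dropped arbitrarily). Initially each node knows only the identifiers of its neighbors in $G$. Shared (pseudo-)random hash functions behave as perfectly random functions. Arboricity: minimum number of forests partitioning the edge set. Diameter: maximum length of a shortest path between two nodes. ''W.h.p.'' means with probability at least $1-1/n^c$ for any fixed constant $c>0$. *)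

(* Defs.v *)
From mathcomp Require Import all_boot.
Set Implicit Arguments.
Unset Strict Implicit.
Unset Printing Implicit Defensive.

(* "log n", made >= 1 so that O(log n) capacities are nonzero for n = 1. *)
Definition logc (n : nat) : nat := (trunc_log 2 n).+1.

Fixpoint walkb (n : nat) (G : rel 'I_n) (k : nat) (u v : 'I_n) : bool :=
  match k with
  | 0 => u == v
  | k'.+1 => [exists w, G u w && walkb G k' w v]
  end.

Definition is_distb (n : nat) (G : rel 'I_n) (u v : 'I_n) (d : nat) : bool :=
  walkb G d u v && [forall k : 'I_d, ~~ walkb G k u v].

(* D is the diameter: max over all pairs of the shortest-path distance
   (in particular the graph is connected). *)
Definition is_diameter (n : nat) (G : rel 'I_n) (D : nat) : Prop :=
  (forall u v, exists2 d, d <= D & is_distb G u v d) /\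
  (exists u v, is_distb G u v D).

Definition forest (n : nat) (F : rel 'I_n) : Prop :=
  forall cyc : seq 'I_n, uniq cyc -> 2 < size cyc -> ~~ cycle F cyc.

Definition forest_partition (n : nat) (G : rel 'I_n) (k : nat) : Prop :=
  exists col : 'I_n -> 'I_n -> nat,
    (forall u v, G u v -> col u v = col v u /\ col u v < k) /\
    (forall i, forest [rel u v | G u v && (col u v == i)]).

Definition is_arboricity (n : nat) (G : rel 'I_n) (a : nat) : Prop :=
  forest_partition G a /\ (forall k, forest_partition G k -> a <= k).

Definition neighbors (n : nat) (G : rel 'I_n) (v : 'I_n) : {set 'I_n} :=
  [set u | G v u].

(* A (randomized) NCC algorithm, given for every network size n.
   Rnd n : the finite space of shared random seeds (uniformly distributed);
   init : own id, "am I the source s", ids of neighbours, shared seed;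
   send : per round, at most one message (a bit string) per destination;
   recv : new state from the delivered (sender, message) list;
   output : Some (delta, pi) once the node terminates. *)
Record NCCAlg := {
  St : nat -> Type;
  Rnd : nat -> finType;
  init : forall n, 'I_n -> bool -> {set 'I_n} -> Rnd n -> St n;
  send : forall n, St n -> 'I_n -> option (seq bool);
  recv : forall n, St n -> seq ('I_n * seq bool) -> St n;
  output : forall n, St n -> option (nat * option 'I_n)
}.

(* capacity enforcement: at most cap destinations (the first ones by id),
   each message truncated to cap bits *)
Definition dests (A : NCCAlg) (n cap : nat) (st : St A n) : seq 'I_n :=
  take cap [seq d <- enum 'I_n | isSome (@send A n st d)].

Definition msg_to (A : NCCAlg) (n cap : nat) (st : St A n) (w : 'I_n)
  : option (seq bool) :=
  if w \in @dests A n cap st then omap (take cap) (@send A n st w) else None.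

Definition incoming (A : NCCAlg) (n cap : nat) (st : 'I_n -> St A n) (w : 'I_n)
  : seq ('I_n * seq bool) :=
  pmap (fun v => omap (fun m => (v, m)) (@msg_to A n cap (st v) w)) (enum 'I_n).

(* adversary choosing which messages are delivered (fully adaptive: it knows
   the seed, the round, the receiver and the incoming messages) *)
Definition Adv (A : NCCAlg) (n : nat) :=
  Rnd A n -> nat -> 'I_n -> seq ('I_n * seq bool) -> seq ('I_n * seq bool).

(* receive capacity cap: if more than cap messages arrive, an arbitrary
   subset of exactly cap of them is delivered; otherwise all are. *)
Definition valid_adv (A : NCCAlg) (n cap : nat) (adv : Adv A n) : Prop :=
  forall r t w l, subseq (adv r t w l) l /\ size (adv r t w l) = minn (size l) cap.

Fixpoint exec (A : NCCAlg) (n : nat) (G : rel 'I_n) (s : 'I_n) (cap : nat)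
  (adv : Adv A n) (r : Rnd A n) (t : nat) : 'I_n -> St A n :=
  match t with
  | 0 => fun v => @init A n v (v == s) (neighbors G v) r
  | t'.+1 =>
      let st := @exec A n G s cap adv r t' in
      fun w => @recv A n (st w) (adv r t' w (@incoming A n cap st w))
  end.

(* the (irrevocable) output of v within the first T rounds: the first output *)
Fixpoint decided (A : NCCAlg) (n : nat) (G : rel 'I_n) (s : 'I_n) (cap : nat)
  (adv : Adv A n) (r : Rnd A n) (T : nat) (v : 'I_n) : option (nat * option 'I_n) :=
  match T with
  | 0 => @output A n (@exec A n G s cap adv r 0 v)
  | T'.+1 => if @decided A n G s cap adv r T' v is Some x then Some x
             else @output A n (@exec A n G s cap adv r T v)
  end.

Definition correct_output (n : nat) (G : rel 'I_n) (s v : 'I_n)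
  (o : option (nat * option 'I_n)) : bool :=
  match o with
  | Some (d, p) =>
      is_distb G s v d &&
      (if v == s then p == None else
       match p with
       | Some u => [&& G u v, is_distb G s u d.-1 &
                    [forall w, (G w v && is_distb G s w d.-1) ==> (u <= w)]]
       | None => false
       end)
  | None => false
  end.

Definition bfs_success (A : NCCAlg) (n : nat) (G : rel 'I_n) (s : 'I_n)
  (cap : nat) (adv : Adv A n) (r : Rnd A n) (T : nat) : bool :=
  [forall v, correct_output G s v (@decided A n G s cap adv r T v)].

(* Main.v *)
Require Import Defs.
From HB Require Import structures.
From mathcomp Require Import all_boot.
From mathcomp Require Import zify.
Set Implicit Arguments.
Unset Strict Implicit.
Unset Printing Implicit Defensive.

(** Every node [v] owns a binary trie on the identifiers: the leaf [(v, 0, u)]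
    stands for the edge [{v, u}], the parent of a trie node halves its key, and
    the root is [(v, L, 0)] with [L = logc n]. Trie nodes are hosted at
    uniformly random nodes, and every message of a step that lasts [R] rounds is
    sent in a uniformly random round. What is computed does not depend on this
    randomness, so the messages of every step are fixed by the graph, and a
    binomial tail bound with a union bound over the steps shows that w.h.p. no
    node ever exceeds its capacity; then the adversary has no choice and the
    real execution follows the ideal one.

    The ideal computation proceeds in phases. A phase begins with an all-reduce
    that tells everybody how many edges still have to be inserted into the tries
    and how many edges the current BFS layer has; this fixes the step length
    [R]. While edges are missing, every node with at most about twice the average
    number of missing edges finds them by comparing the counters of its trie,
    top-down, with its own adjacency list, and inserts them into both tries;
    this halves the number of nodes with missing edges, and the arboricity
    bounds the average. Once all edges are inserted, a phase advances the BFS by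
    one layer: the layer wakes up its tries from the roots down, every leaf
    signals its mirror leaf, and the minimal identifiers are collected upwards.
    A phase costs [O(L)] rounds plus a load term, and the load terms sum up to
    [O(a * L)]. *)

(** * Binomial tails and independent events *)

Lemma leq_card_bigcup (I T : finType) (P : pred I) (F : I -> {set T}) :
  #|\bigcup_(i | P i) F i| <= \sum_(i | P i) #|F i|.
Proof.
elim/big_ind2: _ => [|A m B k leA leB|//]; first by rewrite cards0.
by apply: leq_trans (leq_card_setU _ _) _; rewrite leq_add.
Qed.

Lemma leq_card_inj (S T : finType) (f : S -> T) (A : {pred S}) (B : {pred T}) :
    {in A &, injective f} -> {in A, forall x, f x \in B} ->
  #|A| <= #|B|.
Proof.
move=> inj_f fAB; rewrite -(card_in_image inj_f); apply: subset_leq_card.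
by apply/subsetP => _ /imageP [x xA ->]; apply: fAB.
Qed.

Lemma card_modn_eq (m B c : nat) : 0 < m -> m %| B ->
  #|[pred b : 'I_B | b %% m == c]| * m <= B.
Proof.
move=> m_gt0 dvd_mB.
have lt_div (b : 'I_B) : b %/ m < B %/ m by rewrite ltn_divLR // divnK.
pose quotient (b : 'I_B) : 'I_(B %/ m) := Ordinal (lt_div b).
rewrite -leq_divRL // -[B %/ m]card_ord; apply: (leq_card_inj (f := quotient)) => //.
move=> b b'; rewrite !inE => /eqP eq_b /eqP eq_b' /(congr1 val) /= eq_div.
by apply: val_inj; rewrite /= (divn_eq b m) (divn_eq b' m) eq_div eq_b eq_b'.
Qed.

Lemma expn_leq_ffact (m q : nat) : q ^ m <= (q + m) ^_ m.
Proof.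
elim: m => // m IHm.
by rewrite addnS ffactnS /= expnS leq_mul // -addnS leq_addr.
Qed.

Lemma ffact_leq_expn (m q : nat) : m ^_ q <= m ^ q.
Proof.
elim: q m => // q IHq m; rewrite ffactnS expnS leq_mul2l; apply/orP; right.
apply: leq_trans (IHq _) _; case: q {IHq} => // q.
by rewrite leq_exp2r // leq_pred.
Qed.

Lemma bin_leq_exp2 (m q : nat) : 'C(m, q) <= 2 ^ m.
Proof.
have [lt_mq|le_qm] := ltnP m q; first by rewrite bin_small.
rewrite -[2]/(1 + 1) expnDn (bigD1 (Ordinal (le_qm : q < m.+1))) //=.
by rewrite !exp1n !muln1 leq_addr.
Qed.

Lemma expnn_leq_fact (q : nat) : q ^ q <= 4 ^ q * q`!.
Proof.
apply: leq_trans (expn_leq_ffact q q) _; rewrite -bin_ffact leq_mul2r.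
by apply/orP; right; rewrite -[4]/(2 ^ 2) -expnM mul2n -addnn bin_leq_exp2.
Qed.

Lemma bin_leq_expn (m q : nat) : 'C(m, q) * q ^ q <= (4 * m) ^ q.
Proof.
apply: (@leq_trans ('C(m, q) * (4 ^ q * q`!))).
  by rewrite leq_mul2l expnn_leq_fact orbT.
by rewrite mulnCA expnMn leq_mul2l bin_ffact ffact_leq_expn orbT.
Qed.

Lemma bin_tail (m P q y : nat) :
  y * (4 * m) ^ q <= (q * P) ^ q -> 'C(m, q) * y <= P ^ q.
Proof.
have [->|q_gt0] := posnP q; first by rewrite bin0 muln1 mul1n.
move=> le_y; rewrite -(@leq_pmul2l (q ^ q)) ?expn_gt0 ?q_gt0 // -expnMn.
apply: leq_trans le_y; rewrite mulnA [q ^ q * _]mulnC [_ * y]mulnC leq_mul2l.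
by rewrite bin_leq_expn orbT.
Qed.

Section IndependentEvents.

Variables (Z I : finType) (B : nat) (A : {set I}).
Variables (support : I -> {set Z}) (modulus : Z -> nat) (target : I -> Z -> nat).
Hypothesis support_disjoint :
  {in A &, forall i j, i != j -> [disjoint support i & support j]}.
Hypothesis modulus_gt0 : forall z, 0 < modulus z.
Hypothesis modulus_dvd : forall z, modulus z %| B.

Definition event (i : I) (f : {ffun Z -> 'I_B}) : bool :=
  [forall z in support i, f z %% modulus z == target i z].

Lemma card_event_coordinate (Q : {set I}) (z : Z) : Q \subset A ->
  #|[pred b : 'I_B |
      [forall i in Q, (z \in support i) ==> (b %% modulus z == target i z)]]|
    * \prod_(i in Q | z \in support i) modulus z <= B.
Proof.
move=> sQA; case: (pickP [pred i in Q | z \in support i]) => [i /= /andP [iQ zi]|none].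
  rewrite (bigD1 i) /=; last by rewrite iQ zi.
  rewrite big1 ?muln1; last first.
    move=> j /andP [/andP [jQ zj] neq_ji].
    have /pred0P /(_ z) := support_disjoint (subsetP sQA _ jQ) (subsetP sQA _ iQ) neq_ji.
    by rewrite /= zj zi.
  apply: leq_trans (card_modn_eq (target i z) (modulus_gt0 z) (modulus_dvd z)).
  rewrite leq_mul2r; apply/orP; right; apply: subset_leq_card.
  by apply/subsetP => b; rewrite !inE => /forall_inP /(_ i iQ); rewrite zi.
by rewrite big_pred0 // muln1 -[X in _ <= X]card_ord max_card.
Qed.

Lemma card_all_events (Q : {set I}) : Q \subset A ->
  #|[set f | [forall i in Q, event i f]]| * (\prod_(i in Q) \prod_(z in support i) modulus z)
    <= #|{ffun Z -> 'I_B}|.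
Proof.
move=> sQA; pose F (z : Z) : pred 'I_B :=
  [pred b : 'I_B |
    [forall i in Q, (z \in support i) ==> (b %% modulus z == target i z)]].
have -> : [set f | [forall i in Q, event i f]] = [set f : {ffun Z -> 'I_B} | f \in family F].
  apply/setP => f; rewrite !inE; apply/forall_inP/familyP => [evQ z|evF i iQ].
    rewrite inE; apply/forall_inP => i iQ; apply/implyP => zi.
    exact: (forall_inP (evQ i iQ)).
  apply/forall_inP => z zi; have := evF z; rewrite inE.
  by move/forall_inP/(_ i iQ)/implyP/(_ zi).
rewrite cardsE card_family card_ffun card_ord (exchange_big_dep xpredT) //=.
have -> : foldr muln 1 [seq #|F x| | x : Z] = \prod_(z : Z) #|F z|.
  by rewrite -big_enum foldrE big_map.
rewrite -big_split /= -prod_nat_const.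
by apply: leq_prod => z _; apply: card_event_coordinate.
Qed.

Lemma card_many_events (P q : nat) :
    {in A, forall i, \prod_(z in support i) modulus z = P} ->
  #|[set f | q <= #|[set i in A | event i f]|]| * P ^ q
    <= 'C(#|A|, q) * #|{ffun Z -> 'I_B}|.
Proof.
move=> prodP; pose draws := [set Q : {set I} | Q \subset A & #|Q| == q].
apply: (@leq_trans (\sum_(Q in draws) #|[set f | [forall i in Q, event i f]]| * P ^ q)).
  rewrite -big_distrl /= leq_mul2r; apply/orP; right.
  apply: leq_trans (leq_card_bigcup _ _); apply: subset_leq_card.
  apply/subsetP => f; rewrite inE => le_q.
  have : 0 < #|[set Q : {set I} | Q \subset [set i in A | event i f] & #|Q| == q]|.
    by rewrite cards_draws bin_gt0.
  case/card_gt0P => Q; rewrite inE => /andP [sQ cardQ].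
  apply/bigcupP; exists Q; rewrite ?inE.
    by rewrite cardQ andbT; apply/subsetP => i /(subsetP sQ); rewrite inE => /andP [].
  by apply/forall_inP => i /(subsetP sQ); rewrite inE => /andP [].
rewrite -cards_draws -/draws -sum_nat_const.
apply: leq_sum => Q; rewrite inE => /andP [sQA /eqP <-].
apply: leq_trans (card_all_events sQA); rewrite -prod_nat_const leq_mul2l.
apply/orP; right; apply: leq_prod => i iQ.
by rewrite (prodP i) // (subsetP sQA).
Qed.

End IndependentEvents.

(** * Congestion under random hosting *)

Section Hosting.

Variables (n N : nat) (V : finType).

Definition vnode : finType := ('I_n + V)%type.
Definition link : finType := (vnode * vnode)%type.

(* All moduli used below are at most [N], hence divide [N`!], so reducing a
   coordinate of the seed modulo any of them is exactly uniform. *)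
Definition seed : finType := {ffun V + link -> 'I_N`!}.

Definition hosted (f : seed) (x : vnode) (w : 'I_n) : bool :=
  match x with inl u => u == w | inr y => f (inl y) %% n == w :> nat end.

Definition slot (f : seed) (R : nat) (p : link) : nat := f (inr p) %% R.

Definition is_real (x : vnode) : bool := if x is inl _ then true else false.

Definition virtual_ends (p : link) : {set V} :=
  [set y | (p.1 == inr y) || (p.2 == inr y)].

(* [fs] and [fd] tell whether the host of the source and of the destination are
   prescribed: send load, receive load and load of a pair of nodes are the cases
   (true, false), (false, true) and (true, true). *)
Definition in_load (fs fd : bool) (v w : 'I_n) (R rho : nat) (f : seed) (p : link) : bool :=
  [&& slot f R p == rho, fs ==> hosted f p.1 v & fd ==> hosted f p.2 w].

Definition load (fs fd : bool) (v w : 'I_n) (R rho : nat) (f : seed) (M : {set link}) : nat :=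
  #|[set p in M | in_load fs fd v w R rho f p]|.

Definition uncongested (c1 c2 R : nat) (M : {set link}) (f : seed) : bool :=
  [forall rho : 'I_R, forall v : 'I_n, forall w : 'I_n,
    [&& load true false v w R rho f M <= c1, load false true v w R rho f M <= c1
      & load true true v w R rho f M <= c2]].

Lemma uncongested_leq (c1 c1' c2 R : nat) (M : {set link}) (f : seed) : c1 <= c1' ->
  uncongested c1 c2 R M f -> uncongested c1' c2 R M f.
Proof.
move=> le_c /forallP ok; apply/forallP => rho; apply/forallP => v; apply/forallP => w.
have /forallP /(_ v) /forallP /(_ w) /and3P [out_le in_le ->] := ok rho.
by rewrite (leq_trans out_le) // (leq_trans in_le).
Qed.

Lemma load_sub (fs fd : bool) (v w : 'I_n) (R rho : nat) (f : seed) (M M' : {set link}) :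
    {in M, forall p, in_load fs fd v w R rho f p -> p \in M'} ->
  load fs fd v w R rho f M <= load fs fd v w R rho f M'.
Proof.
move=> sub; apply: subset_leq_card; apply/subsetP => p; rewrite !inE.
by case/andP => pM link_p; rewrite sub.
Qed.

Lemma load_partition (K : finType) (cls : link -> K) (fs fd : bool) (v w : 'I_n)
    (R rho : nat) (f : seed) (M : {set link}) :
  load fs fd v w R rho f M = \sum_k load fs fd v w R rho f [set p in M | cls p == k].
Proof.
rewrite /load -sum1_card (partition_big cls xpredT) //=; apply: eq_bigr => k _.
by rewrite -sum1_card; apply: eq_bigl => p; rewrite !inE andbAC.
Qed.

Definition host_coords (b : bool) (x : vnode) : {set V + link} :=
  if x is inr y then if b then [set inl y] else set0 else set0.

Definition load_coords (fs fd : bool) (p : link) : {set V + link} :=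
  inr p |: (host_coords fs p.1 :|: host_coords fd p.2).

Definition load_target (fs : bool) (v w : 'I_n) (rho : nat) (p : link) (z : V + link) : nat :=
  if z is inl y then if fs && (p.1 == inr y) then v else w else rho.

Definition coord_modulus (R : nat) (z : V + link) : nat := if z is inl _ then n else R.

Definition host_modulus (b : bool) (x : vnode) : nat := if b && ~~ is_real x then n else 1.

Lemma in_host_coords b x z :
  (z \in host_coords b x) = if z is inl y then b && (x == inr y) else false.
Proof.
case: x => [u|y] /=; case: z => [y'|p] //=; rewrite ?inE ?andbF //.
- by case: b; rewrite ?inE // eq_sym.
- by case: b; rewrite inE.
Qed.

Lemma in_load_coords fs fd p z : (z \in load_coords fs fd p) =
  match z with
  | inl y => fs && (p.1 == inr y) || fd && (p.2 == inr y)
  | inr p' => p == p'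
  end.
Proof.
by rewrite in_setU1 in_setU !in_host_coords; case: z => //= p'; rewrite orbF eq_sym.
Qed.

Lemma load_coords_disjoint fs fd p p' :
    p != p' -> [disjoint virtual_ends p & virtual_ends p'] ->
  [disjoint load_coords fs fd p & load_coords fs fd p'].
Proof.
move=> neq_p /pred0P dis; apply/pred0P => -[y|p0] /=; rewrite !in_load_coords /=.
  have := dis y; rewrite /= !inE; case: (p.1 == _); case: (p.2 == _) => //=;
    case: (p'.1 == _); case: (p'.2 == _) => //=; by rewrite !andbF.
by apply/andP => -[/eqP eq_p /eqP eq_p']; rewrite eq_p eq_p' eqxx in neq_p.
Qed.

Lemma prod_load_coords fs fd R p : p.1 != p.2 ->
  \prod_(z in load_coords fs fd p) coord_modulus R z =
    R * host_modulus fs p.1 * host_modulus fd p.2.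
Proof.
move=> neq; rewrite big_setU1 /=; last by rewrite in_setU !in_host_coords.
have prod_host b x : \prod_(z in host_coords b x) coord_modulus R z = host_modulus b x.
  by case: x => [u|y]; case: b; rewrite /= ?big_set0 ?big_set1.
rewrite -mulnA -!prod_host -bigU /=.
  by congr (_ * _); apply: eq_bigl => z; rewrite !inE.
apply/pred0P => z /=; rewrite !in_host_coords; case: z => // y.
apply/negP => /andP [/andP [_ /eqP eq_src] /andP [_ /eqP eq_dst]].
by rewrite eq_src eq_dst eqxx in neq.
Qed.

Lemma in_load_event fs fd v w R rho f p : in_load fs fd v w R rho f p ->
  event (load_coords fs fd) (coord_modulus R) (load_target fs v w rho) p f.
Proof.
case/and3P => at_rho src dst; apply/forall_inP => -[y|p0]; rewrite in_load_coords /=.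
  have [/andP [fs_true /eqP eq_src] _|_ /=] := boolP (fs && (p.1 == inr y)).
    by move: src; rewrite fs_true eq_src.
  by case/andP => fd_true /eqP eq_dst; move: dst; rewrite fd_true eq_dst.
by move/eqP <-.
Qed.

Lemma card_load (A : {set link}) (fs fd : bool) (v w : 'I_n) (R rho P q : nat) :
    0 < n <= N -> 0 < R <= N ->
    {in A &, forall p p', p != p' -> [disjoint virtual_ends p & virtual_ends p']} ->
    {in A, forall p, p.1 != p.2} ->
    {in A, forall p, R * host_modulus fs p.1 * host_modulus fd p.2 = P} ->
  #|[set f | q <= load fs fd v w R rho f A]| * P ^ q <= 'C(#|A|, q) * #|seed|.
Proof.
move=> nN RN disA neqA prodA.
have mod_gt0 z : 0 < coord_modulus R z.
  by case: z => ? /=; [case/andP: nN|case/andP: RN].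
have mod_dvd z : coord_modulus R z %| N`! by case: z => ? /=; apply: dvdn_fact.
have disj : {in A &, forall p p', p != p' ->
    [disjoint load_coords fs fd p & load_coords fs fd p']}.
  by move=> p p' pA p'A neq; apply: load_coords_disjoint => //; apply: disA.
have prodP : {in A, forall p, \prod_(z in load_coords fs fd p) coord_modulus R z = P}.
  by move=> p pA; rewrite prod_load_coords ?neqA ?prodA.
apply: leq_trans (card_many_events (load_target fs v w rho) disj mod_gt0 mod_dvd q prodP).
rewrite leq_mul2r; apply/orP; right; apply: subset_leq_card.
apply/subsetP => f; rewrite !inE => le_q; apply: leq_trans le_q _.
apply: subset_leq_card; apply/subsetP => p; rewrite !inE.
by case/andP => -> /in_load_event.
Qed.

End Hosting.

Section Congestion.

Variables (n N : nat) (V K : finType).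
Variables (allowed : pred (link n V)) (colour : link n V -> K).
Hypothesis n_bound : 0 < n <= N.

Definition link_class (p : link n V) : K * bool * bool :=
  (colour p, is_real p.1, is_real p.2).

Hypothesis class_disjoint : forall p p', allowed p -> allowed p' ->
  link_class p = link_class p' -> p != p' -> [disjoint virtual_ends p & virtual_ends p'].
Hypothesis allowed_neq : forall p, allowed p -> p.1 != p.2.

Record light (l R : nat) (M : {set link n V}) : Prop := Light {
  light_allowed : {in M, forall p, allowed p};
  light_real_out : forall v, #|[set w | (inl v, inl w) \in M]| <= 1;
  light_real_in : forall w, #|[set v | (inl v, inl w) \in M]| <= 1;
  light_virtual_out : forall v, #|[set y | (inl v, inr y) \in M]| <= l * R;
  light_virtual_in : forall w, #|[set y | (inr y, inl w) \in M]| <= l * R;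
  light_virtual : #|[set yz : V * V | (inr yz.1, inr yz.2) \in M]| <= l * (n * R)
}.

(* The links of class [c] that can contribute to a load of [v] and [w]. *)
Definition class_links (M : {set link n V}) (c : K * bool * bool) (fs fd : bool)
    (v w : 'I_n) : {set link n V} :=
  [set p in M | [&& link_class p == c, (fs && is_real p.1) ==> (p.1 == inl v)
                  & (fd && is_real p.2) ==> (p.2 == inl w)]].

Definition class_modulus (c : K * bool * bool) (fs fd : bool) (R : nat) : nat :=
  R * (if fs && ~~ c.1.2 then n else 1) * (if fd && ~~ c.2 then n else 1).

Section ClassBounds.

Variables (l R : nat) (M : {set link n V}).
Hypothesis lightM : light l R M.
Variables (k : K) (fs fd : bool) (v w : 'I_n).

Notation links b1 b2 := (class_links M (k, b1, b2) fs fd v w).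

Lemma class_links_ends b1 b2 p : p \in links b1 b2 ->
  [/\ p \in M, is_real p.1 = b1, is_real p.2 = b2,
      fs -> b1 -> p.1 = inl v & fd -> b2 -> p.2 = inl w].
Proof.
rewrite inE => /and4P [pM /eqP [_ <- <-] /implyP src /implyP dst].
by split=> // prescribed real; apply/eqP; [apply: src|apply: dst]; apply/andP.
Qed.

Lemma leq_links b1 b2 (T : finType) (S : {set T}) (h : T -> link n V) m :
    #|S| <= m -> (forall p, p \in links b1 b2 -> exists2 x, x \in S & p = h x) ->
  #|links b1 b2| <= m.
Proof.
move=> le_S linkP; apply: leq_trans le_S; apply: leq_trans (leq_imset_card h S).
apply: subset_leq_card; apply/subsetP => p /linkP [x xS ->].
exact: imset_f.
Qed.

Lemma leq_links_sum b1 b2 (S : 'I_n -> {set V}) (h : 'I_n -> V -> link n V) m :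
    (forall u, #|S u| <= m) ->
    (forall p, p \in links b1 b2 -> exists u, exists2 y, y \in S u & p = h u y) ->
  #|links b1 b2| <= n * m.
Proof.
move=> le_S linkP.
apply: (leq_links (S := \bigcup_u [set (u, y) | y in S u]) (h := fun uy => h uy.1 uy.2)).
  apply: leq_trans (leq_card_bigcup _ _) _.
  rewrite -[n in n * _]card_ord -sum_nat_const; apply: leq_sum => u _.
  exact: leq_trans (leq_imset_card _ _) (le_S u).
move=> p /linkP [u [y yS ->]]; exists (u, y) => //.
by apply/bigcupP; exists u => //; apply: imset_f.
Qed.

Lemma card_real_links : fs || fd -> #|links true true| <= 1.
Proof.
case/orP => prescribed.
  apply: (leq_links (h := fun u => (inl v, inl u)) (light_real_out lightM v)).
  move=> [[x|x] [y|y]] /class_links_ends [pM //= _ _ src _]; exists y; last by rewrite src.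
  by rewrite inE -src.
apply: (leq_links (h := fun u => (inl u, inl w)) (light_real_in lightM w)).
move=> [[x|x] [y|y]] /class_links_ends [pM //= _ _ _ dst]; exists x; last by rewrite dst.
by rewrite inE -dst.
Qed.

Lemma card_out_links : #|links true false| <= n * (l * R).
Proof.
apply: (leq_links_sum (h := fun u y => (inl u, inr y)) (light_virtual_out lightM)).
by move=> [[u|x] [w'|y]] /class_links_ends [pM //= _ _ _ _]; exists u, y; rewrite ?inE.
Qed.

Lemma card_in_links : #|links false true| <= n * (l * R).
Proof.
apply: (leq_links_sum (h := fun u y => (inr y, inl u)) (light_virtual_in lightM)).
by move=> [[v'|y] [u|x]] /class_links_ends [pM //= _ _ _ _]; exists u, y; rewrite ?inE.
Qed.

Lemma card_out_links_prescribed : fs -> #|links true false| <= l * R.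
Proof.
move=> prescribed.
apply: (leq_links (h := fun y : V => (inl v, inr y)) (light_virtual_out lightM v)).
move=> [[x|x] [y|y]] /class_links_ends [pM //= _ _ src _]; exists y; last by rewrite src.
by rewrite inE -src.
Qed.

Lemma card_in_links_prescribed : fd -> #|links false true| <= l * R.
Proof.
move=> prescribed.
apply: (leq_links (h := fun y : V => (inr y, inl w)) (light_virtual_in lightM w)).
move=> [[x|x] [y|y]] /class_links_ends [pM //= _ _ _ dst]; exists x; last by rewrite dst.
by rewrite inE -dst.
Qed.

Lemma card_virtual_links : #|links false false| <= l * (n * R).
Proof.
apply: (leq_links (h := fun yz => (inr yz.1, inr yz.2)) (light_virtual lightM)).
by move=> [[x|x] [y|y]] /class_links_ends [pM //= _ _ _ _]; exists (x, y); rewrite ?inE.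
Qed.

Lemma card_class_links b1 b2 : 0 < l -> 0 < R -> fs || fd ->
  #|links b1 b2| <= l * class_modulus (k, b1, b2) fs fd R.
Proof.
move=> l_gt0 R_gt0; have lR_gt0 : 0 < l * R by rewrite muln_gt0 l_gt0.
move: card_real_links card_out_links card_in_links card_out_links_prescribed
  card_in_links_prescribed card_virtual_links.
rewrite /class_modulus /=.
case: b1; case: b2; case: fs; case: fd => //= real out inn out1 in1 virt _;
  try have := real isT; try have := out1 isT; try have := in1 isT; nia.
Qed.

Lemma card_class_links_pair b1 b2 : fs && fd -> ~~ (b1 && b2) ->
  #|links b1 b2| * n <= l * class_modulus (k, b1, b2) fs fd R.
Proof.
move: card_out_links_prescribed card_in_links_prescribed card_virtual_links.
rewrite /class_modulus /=.
case: b1; case: b2; case: fs; case: fd => //= out inn virt _ _;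
  try have := out isT; try have := inn isT; nia.
Qed.

End ClassBounds.

Section Tail.

Variables (l R q e : nat) (M : {set link n V}).
Hypotheses (l_gt0 : 0 < l) (R_bound : 0 < R <= N) (lightM : light l R M).
Hypotheses (e_gt0 : 0 < e) (q_ge : 8 * l <= q) (q_exp : n ^ e <= 2 ^ q)
  (e_ge : 4 * l ^ 2 <= e ^ 2 * n).

Definition overload (fs fd : bool) : nat := if fs && fd then 2 * e else q.

Lemma bin_class_links c fs fd v w : fs || fd ->
  'C(#|class_links M c fs fd v w|, overload fs fd) * n ^ e
    <= class_modulus c fs fd R ^ overload fs fd.
Proof.
case: c => -[k b1] b2 fsd; have [/andP [R_gt0 _] /andP [n_gt0 _]] := (R_bound, n_bound).
rewrite /overload; have [both|_] := boolP (fs && fd).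
  have [real|virt] := boolP (b1 && b2).
    case/andP: real => -> ->; rewrite bin_small //.
    by apply: leq_ltn_trans (card_real_links lightM _ _ _ fsd) _; lia.
  have := card_class_links_pair lightM k v w both virt.
  move: #|_| (class_modulus _ _ _ _) => m P le_m; apply: bin_tail.
  rewrite !expnM -expnMn leq_exp2r //.
  suff : n * (n * (4 * m) ^ 2) <= n * (2 * e * P) ^ 2 by rewrite leq_pmul2l.
  by nia.
apply: (@leq_trans ('C(#|class_links M (k, b1, b2) fs fd v w|, q) * 2 ^ q)).
  by rewrite leq_mul2l q_exp orbT.
apply: bin_tail; rewrite -expnMn; have := card_class_links lightM k v w b1 b2 l_gt0 R_gt0 fsd.
move: #|_| (class_modulus _ _ _ _) => m P le_m.
by have [->//|q_gt0] := posnP q; rewrite leq_exp2r //; nia.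
Qed.

Lemma card_overloaded_class c fs fd v w (rho : nat) : fs || fd ->
  #|[set f : seed n N V | overload fs fd
       <= load fs fd v w R rho f [set p in M | link_class p == c]]| * n ^ e
    <= #|seed n N V|.
Proof.
move=> fsd; set A := class_links M c fs fd v w; set m := overload fs fd.
have classA p : p \in A -> link_class p = c by rewrite inE => /and4P [_ /eqP].
have allowedA p : p \in A -> allowed p by rewrite inE => /andP [/(light_allowed lightM)].
have P_gt0 : 0 < class_modulus c fs fd R ^ m.
  case/andP: n_bound R_bound => n_gt0 _ /andP [R_gt0 _].
  by rewrite expn_gt0 /class_modulus !muln_gt0 R_gt0; do 2 case: ifP => _ //; rewrite n_gt0.
have tail : #|[set f : seed n N V | m <= load fs fd v w R rho f A]|
    * class_modulus c fs fd R ^ m <= 'C(#|A|, m) * #|seed n N V|.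
  apply: (card_load v w rho m n_bound R_bound).
  - move=> p p' pA p'A; apply: class_disjoint; rewrite ?allowedA //.
    by rewrite !classA.
  - by move=> p /allowedA; apply: allowed_neq.
  - by move=> p /classA <-.
rewrite -(leq_pmul2r P_gt0) mulnAC.
apply: (@leq_trans ('C(#|A|, m) * #|seed n N V| * n ^ e)).
  rewrite leq_mul2r; apply/orP; right; apply: leq_trans tail.
  rewrite leq_mul2r; apply/orP; right; apply: subset_leq_card; apply/subsetP => f.
  rewrite !inE => le_m; apply: leq_trans le_m _; apply: load_sub => p.
  rewrite !inE => /andP [-> /eqP ->] /and3P [_ src dst]; rewrite eqxx /=.
  by case: p src dst => [[x|x] [y|y]] /=; rewrite ?andbF ?andbT //= => -> ->.
by rewrite mulnAC [X in _ <= X]mulnC leq_mul2r bin_class_links ?orbT.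
Qed.

Lemma card_congested :
  #|[set f : seed n N V | ~~ uncongested (4 * #|K| * q) (4 * #|K| * (2 * e)) R M f]| * n ^ e
    <= 16 * #|K| * n ^ 2 * R * #|seed n N V|.
Proof.
pose index : finType :=
  ((K * bool * bool) * (bool * bool) * ('I_n * 'I_n) * 'I_R)%type.
pose bad (i : index) : {set seed n N V} := let: (c, (fs, fd), (v, w), rho) := i in
  if fs || fd then [set f : seed n N V | overload fs fd <=
      load fs fd v w R rho f [set p in M | link_class p == c]]
  else set0.
have card_index : #|{: index}| = 16 * #|K| * n ^ 2 * R.
  by rewrite !card_prod !card_bool !card_ord; lia.
have overloaded fs fd v w (rho : 'I_R) f : fs || fd ->
    ~~ (load fs fd v w R rho f M <= 4 * #|K| * overload fs fd) -> f \in \bigcup_i bad i.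
  move=> fsd; rewrite (load_partition link_class) => big_load.
  suff [c le_c] : exists c, overload fs fd <=
      load fs fd v w R rho f [set p in M | link_class p == c].
    by apply/bigcupP; exists (c, (fs, fd), (v, w), rho); rewrite // /bad fsd inE.
  apply/existsP; apply: contraR big_load => /existsPn small.
  have -> : 4 * #|K| * overload fs fd = \sum_(c : K * bool * bool) overload fs fd.
    by rewrite sum_nat_const !card_prod card_bool; lia.
  by apply: leq_sum => c _; have := small c; rewrite -ltnNge; apply: ltnW.
apply: (@leq_trans (\sum_(i : index) #|bad i| * n ^ e)).
  rewrite -big_distrl leq_mul2r; apply/orP; right.
  apply: leq_trans (leq_card_bigcup _ _); apply: subset_leq_card.
  apply/subsetP => f; rewrite inE => /forallPn [rho] /forallPn [v] /forallPn [w].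
  by rewrite !negb_and => /or3P [] big_load; apply: overloaded big_load.
rewrite -card_index -sum_nat_const; apply: leq_sum => -[[[c [fs fd]] [v w]] rho] _.
by rewrite /bad; case: ifP => fsd; [apply: card_overloaded_class|rewrite cards0].
Qed.

End Tail.

Lemma card_congested_steps (l q e k : nat) (R : nat -> nat) (M : nat -> {set link n V}) :
    0 < l -> 0 < e -> 8 * l <= q -> n ^ e <= 2 ^ q -> 4 * l ^ 2 <= e ^ 2 * n ->
    (forall tau, tau < k -> 0 < R tau <= N /\ light l (R tau) (M tau)) ->
  #|[set f : seed n N V | ~~ [forall tau : 'I_k,
      uncongested (4 * #|K| * q) (4 * #|K| * (2 * e)) (R tau) (M tau) f]]| * n ^ e
    <= k * (16 * #|K| * n ^ 2 * N) * #|seed n N V|.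
Proof.
move=> l_gt0 e_gt0 q_ge q_exp e_ge steps.
pose congested (tau : 'I_k) := [set f : seed n N V |
  ~~ uncongested (4 * #|K| * q) (4 * #|K| * (2 * e)) (R tau) (M tau) f].
apply: (@leq_trans (\sum_(tau < k) #|congested tau| * n ^ e)).
  rewrite -big_distrl leq_mul2r; apply/orP; right.
  apply: leq_trans (leq_card_bigcup _ _); apply: subset_leq_card; apply/subsetP => f.
  by rewrite inE => /forallPn [tau bad]; apply/bigcupP; exists tau; rewrite ?inE.
rewrite -mulnA -[k in k * _]card_ord -sum_nat_const; apply: leq_sum => tau _.
have [R_bound lightM] := steps tau (ltn_ord tau).
apply: leq_trans (card_congested l_gt0 R_bound lightM e_gt0 q_ge q_exp e_ge) _.
by rewrite leq_mul2r leq_mul2l; case/andP: R_bound => _ ->; rewrite !orbT.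
Qed.

End Congestion.

(** * Encoding packets as bit strings *)

Definition bits_of_nat (m k : nat) : seq bool := mkseq (fun i => odd (k %/ 2 ^ i)) m.

Definition nat_of_bits (s : seq bool) : nat :=
  foldr (fun (b : bool) k => b + k.*2) 0 s.

Lemma bits_of_natK m k : k < 2 ^ m -> nat_of_bits (bits_of_nat m k) = k.
Proof.
elim: m k => [|m IHm] k; first by case: k.
rewrite /bits_of_nat /mkseq /= -[1]/(1 + 0) iotaDl -map_comp => lt_k.
have -> : [seq odd (k %/ 2 ^ (1 + i)) | i <- iota 0 m] = bits_of_nat m k./2.
  by apply: eq_map => i; rewrite /= expnD expn1 divnMA divn2.
have lt_half : k./2 < 2 ^ m by rewrite -divn2 ltn_divLR // -expnSr.
by rewrite /= IHm // divn1 odd_double_half.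
Qed.

Section Packing.

Variables (T : finType) (Q : nat).

Definition pack_width : nat := (trunc_log 2 #|{: Q.-tuple (option T)}|).+1.

Definition pad (l : seq T) : Q.-tuple (option T) :=
  [tuple nth None (map Some l) i | i < Q].

Definition pack (l : seq T) : seq bool :=
  bits_of_nat pack_width (enum_rank (pad l)).

Definition unpack (s : seq bool) : seq T :=
  if insub (nat_of_bits s) is Some i then
    pmap id (enum_val (i : 'I_#|{: Q.-tuple (option T)}|)) else [::].

Lemma size_pack l : size (pack l) = pack_width.
Proof. by rewrite size_mkseq. Qed.

Lemma pad_cat l : size l <= Q -> pad l = map Some l ++ nseq (Q - size l) None :> seq _.
Proof.
move=> le_l; apply: (@eq_from_nth _ None).
  by rewrite size_tuple size_cat size_map size_nseq subnKC.
move=> i; rewrite size_tuple => lt_i.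
rewrite -[i]/(val (Ordinal lt_i)) -tnth_nth tnth_mktuple /= nth_cat size_map.
by case: ltnP => // le_i; rewrite nth_default ?size_map // nth_nseq if_same.
Qed.

Lemma packK l : size l <= Q -> unpack (pack l) = l.
Proof.
move=> le_l; rewrite /unpack /pack bits_of_natK; last first.
  by apply: ltn_trans (ltn_ord _) _; apply: trunc_log_ltn.
rewrite valK enum_rankK pad_cat // pmap_cat.
have -> : pmap id (nseq (Q - size l) (@None T)) = [::] by elim: (Q - size l).
by rewrite cats0; elim: l {le_l} => //= x l ->.
Qed.

Lemma pack_width_leq w : #|{: option T}| <= 2 ^ w -> pack_width <= (w * Q).+1.
Proof.
move=> le_T; rewrite /pack_width card_tuple ltnS.
rewrite -[X in _ <= X](trunc_expnK _ (ltnSn 1)); apply: leq_trunc_log.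
by rewrite expnM; case: (Q) => // m; rewrite leq_exp2r.
Qed.

End Packing.

Lemma size_pmap_enum (T : finType) (rT : Type) (g : T -> option rT) :
  size (pmap g (enum T)) = #|[set x | isSome (g x)]|.
Proof.
rewrite size_pmap -size_filter cardE; congr size.
rewrite /enum_mem -filter_predI; apply: eq_filter => x /=.
by rewrite !inE andbT.
Qed.

(** * Simulating a protocol with virtual nodes *)

(* A step of the protocol takes one round more than [extra_rounds]. *)
Record protocol (n : nat) := Protocol {
  virtual : finType;
  message : Type;
  code : finType;
  encode : message -> code;
  decode : code -> message;
  vstate : vnode n virtual -> Type;
  init_real : forall w, bool -> {set 'I_n} -> vstate (inl w);
  init_virtual : forall y, vstate (inr y);
  vsend : forall x, vstate x -> vnode n virtual -> option message;
  vrecv : forall x, vstate x -> {ffun vnode n virtual -> option message} -> vstate x;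
  extra_rounds : forall w, vstate (inl w) -> nat;
  voutput : forall w, vstate (inl w) -> option (nat * option 'I_n)
}.

Section Configurations.

Variables (n : nat) (P : protocol n).
Notation X := (vnode n (virtual P)).

Definition config : Type := forall x : X, vstate x.

Definition vmsg (Y : config) (p : link n (virtual P)) : option (message P) :=
  vsend (Y p.1) p.2.

Definition sent (Y : config) : {set link n (virtual P)} := [set p | isSome (vmsg Y p)].

Definition inbox (Y : config) (x : X) : {ffun X -> option (message P)} :=
  [ffun x' => vmsg Y (x', x)].

Lemma inboxE Y x x' : inbox Y x x' = vmsg Y (x', x).
Proof. by rewrite ffunE. Qed.

Definition vstep (Y : config) : config := fun x => vrecv (Y x) (inbox Y x).

Definition init_config (G : rel 'I_n) (s : 'I_n) : config := fun x =>
  match x with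
  | inl w => init_real P w (w == s) (neighbors G w)
  | inr y => init_virtual y
  end.

Definition synchronous (Y : config) (R : nat) : Prop :=
  forall w, (extra_rounds (Y (inl w))).+1 = R.

Definition codable (Y : config) : Prop :=
  forall p m, vmsg Y p = Some m -> decode (encode m) = m.

Definition packet : finType := (link n (virtual P) * code P)%type.

End Configurations.

Section Node.

Variables (n N : nat) (P : protocol n) (Q : nat).
Notation X := (vnode n (virtual P)).

(* [node_states] is meaningful only at the virtual nodes hosted by [node_id];
   [node_inbox] holds the messages received so far in the current step. *)
Record node := Node {
  node_id : 'I_n;
  node_seed : seed n N (virtual P);
  node_states : config P;
  node_round : nat;
  node_inbox : {ffun link n (virtual P) -> option (message P)}
}.

Definition step_length (st : node) : nat :=
  (extra_rounds (node_states st (inl (node_id st)))).+1.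

Definition node_init (w : 'I_n) (is_source : bool) (nbrs : {set 'I_n})
    (f : seed n N (virtual P)) : node :=
  Node w f (fun x => match x with
                     | inl u => init_real P u is_source nbrs
                     | inr y => init_virtual y
                     end) 0 [ffun=> None].

Definition outgoing (st : node) (d : 'I_n) : seq (packet P) :=
  pmap (fun p =>
    if in_load true true (node_id st) d (step_length st) (node_round st) (node_seed st) p
    then omap (fun m => (p, encode m)) (vmsg (node_states st) p) else None)
    (enum {: link n (virtual P)}).

Definition node_send (st : node) (d : 'I_n) : option (seq bool) :=
  let l := outgoing st d in if nilp l then None else Some (pack Q l).

Definition unpack_all (l : seq ('I_n * seq bool)) : seq (packet P) :=
  flatten [seq unpack (packet P) Q m.2 | m <- l].

Definition merge_inbox (st : node) (l : seq ('I_n * seq bool)) :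
    {ffun link n (virtual P) -> option (message P)} :=
  [ffun p => if [seq k <- unpack_all l | k.1 == p] is k :: _ then Some (decode k.2)
             else node_inbox st p].

Definition node_recv (st : node) (l : seq ('I_n * seq bool)) : node :=
  let inbox := merge_inbox st l in
  if (node_round st).+1 == step_length st then
    Node (node_id st) (node_seed st)
      (fun x => vrecv (node_states st x) [ffun x' => inbox (x', x)]) 0 [ffun=> None]
  else Node (node_id st) (node_seed st) (node_states st) (node_round st).+1 inbox.

End Node.

Definition simulate (P : forall n, protocol n) (N : nat -> nat) (Q : nat) : NCCAlg := {|
  St := fun n => node (N n) (P n);
  Rnd := fun n => seed n (N n) (virtual (P n));
  init := fun n => @node_init n (N n) (P n);
  send := fun n => @node_send n (N n) (P n) Q;
  recv := fun n => @node_recv n (N n) (P n) Q;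
  output := fun n st => voutput (node_states st (inl (node_id st)))
|}.

Lemma decided_first (A : NCCAlg) (n : nat) (G : rel 'I_n) (s : 'I_n) (cap : nat)
    (adv : Adv A n) (r : Rnd A n) (v : 'I_n) (T0 T : nat) (x : nat * option 'I_n) :
    T0 <= T ->
    (forall t, t <= T0 -> output (exec G s cap adv r t v) = None \/
                          output (exec G s cap adv r t v) = Some x) ->
    output (exec G s cap adv r T0 v) = Some x ->
  decided G s cap adv r T v = Some x.
Proof.
move=> le_T consistent final.
have decidedS t : decided G s cap adv r t.+1 v =
    if decided G s cap adv r t v is Some y then Some y
    else output (exec G s cap adv r t.+1 v) by [].
have decided_consistent t : t <= T0 ->
    decided G s cap adv r t v = None \/ decided G s cap adv r t v = Some x.
  elim: t => [|t IH] le_t; first exact: consistent.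
  by rewrite decidedS; case: (IH (ltnW le_t)) => ->; [apply: consistent|right].
have decided_T0 : decided G s cap adv r T0 v = Some x.
  case: (T0) final decided_consistent => [//|t] final dec; rewrite decidedS.
  by case: (dec t (leqnSn t)) => ->.
rewrite -(subnK le_T); elim: (T - T0) => [//|j IH].
by rewrite addSn decidedS IH.
Qed.

Definition start_time (len : nat -> nat) (tau : nat) : nat := \sum_(sigma < tau) len sigma.

Lemma start_timeS len tau : start_time len tau.+1 = start_time len tau + len tau.
Proof. by rewrite /start_time big_ord_recr. Qed.

Section Simulation.

Variables (P : forall n, protocol n) (N : nat -> nat) (Q n cap : nat).
Notation A := (simulate P N Q).
Notation V := (virtual (P n)).
Notation X := (vnode n V).
Variable f : Rnd A n.
Hypothesis n_gt0 : 0 < n.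
Hypothesis width_cap : pack_width (packet (P n)) Q <= cap.

Definition at_round (Y : config (P n)) (R rho : nat) (st : 'I_n -> St A n) : Prop :=
  forall w, [/\ node_id (st w) = w, node_seed (st w) = f, node_round (st w) = rho,
    forall x, hosted f x w -> node_states (st w) x = Y x
  & forall x' x, hosted f x w -> node_inbox (st w) (x', x) =
      if slot f R (x', x) < rho then vmsg Y (x', x) else None].

Definition host (x : X) : 'I_n :=
  match x with
  | inl u => u
  | inr y => Ordinal (ltn_pmod (f (inl y)) n_gt0)
  end.

Lemma hostedE x w : hosted f x w = (host x == w).
Proof. by case: x. Qed.

Section Round.

Variables (Y : config (P n)) (R rho : nat) (st : 'I_n -> St A n).
Hypothesis sync : synchronous Y R.
Hypothesis codableY : codable Y.
Hypothesis uncongestedY : uncongested cap Q R (sent Y) f.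
Hypothesis lt_rho : rho < R.
Hypothesis at_rho : at_round Y R rho st.

Lemma step_length_at w : step_length (st w) = R.
Proof.
have [idE _ _ statesE _] := at_rho w.
by rewrite /step_length idE statesE ?sync //= eqxx.
Qed.

Definition ideal_outgoing (v w : 'I_n) : seq (packet (P n)) :=
  pmap (fun p => if in_load true true v w R rho f p
    then omap (fun m => (p, encode m)) (vmsg Y p) else None) (enum {: link n V}).

Lemma outgoingE v w : outgoing (st v) w = ideal_outgoing v w.
Proof.
have [idE seedE roundE statesE _] := at_rho v.
apply: eq_pmap => p; rewrite step_length_at idE seedE roundE.
by case: ifP => // /and3P [_ /= src _]; rewrite /vmsg statesE.
Qed.

Lemma ideal_outgoingP v w k : reflect
  (exists2 m, vmsg Y k.1 = Some m & in_load true true v w R rho f k.1 /\ k.2 = encode m)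
  (k \in ideal_outgoing v w).
Proof.
rewrite mem_pmap; apply: (iffP mapP) => [[p _]|[m msg_k [link_p eq_key]]].
  by case: ifP => // link_p; case msg_p: vmsg => [m|] //= [->]; exists m.
exists k.1; first by rewrite mem_enum.
by rewrite link_p msg_k /= -eq_key; case: (k).
Qed.

Lemma load_leq v w : [/\ load true false v w R rho f (sent Y) <= cap,
    load false true v w R rho f (sent Y) <= cap
  & load true true v w R rho f (sent Y) <= Q].
Proof.
by move/forallP/(_ (Ordinal lt_rho))/forallP/(_ v)/forallP/(_ w)/and3P: uncongestedY.
Qed.

Lemma size_ideal_outgoing v w : size (ideal_outgoing v w) <= Q.
Proof.
have [_ _] := load_leq v w; apply: leq_trans.
rewrite size_pmap_enum; apply: subset_leq_card; apply/subsetP => p.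
by rewrite !inE; case: ifP => // link_p; case: vmsg.
Qed.

Lemma node_sendE v w : send (st v) w =
  if nilp (ideal_outgoing v w) then None else Some (pack Q (ideal_outgoing v w)).
Proof. by rewrite /= /node_send outgoingE. Qed.

Lemma ideal_outgoing_neq0 v w : ~~ nilp (ideal_outgoing v w) ->
  exists2 p, p \in sent Y & in_load true true v w R rho f p.
Proof.
case out_vw: ideal_outgoing => [|k l] // _.
have /ideal_outgoingP [m msg_k [link_p _]] : k \in ideal_outgoing v w by rewrite out_vw mem_head.
by exists k.1 => //; rewrite inE msg_k.
Qed.

Lemma destsE v w : (w \in dests cap (st v)) = ~~ nilp (ideal_outgoing v w).
Proof.
rewrite /dests take_oversize; first by rewrite mem_filter mem_enum andbT node_sendE; case: nilp.
have [le_cap _ _] := load_leq v v; apply: leq_trans le_cap; rewrite /load.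
apply: leq_trans (leq_imset_card (fun p => host p.2) _).
rewrite -(card_uniqP (filter_uniq _ (enum_uniq 'I_n))).
apply: subset_leq_card; apply/subsetP => d; rewrite mem_filter node_sendE.
case: ifP => // /negbT /ideal_outgoing_neq0 [p pM /and3P [at_slot src dst]] _.
apply/imsetP; exists p; first by rewrite inE pM /in_load at_slot src.
by move: dst; rewrite hostedE => /eqP.
Qed.

Lemma incomingE w : incoming cap st w =
  pmap (fun v => if nilp (ideal_outgoing v w) then None
                 else Some (v, pack Q (ideal_outgoing v w))) (enum 'I_n).
Proof.
apply: eq_pmap => v; rewrite /msg_to destsE node_sendE; case: nilp => //=.
by rewrite take_oversize // size_pack.
Qed.

Lemma size_incoming w : size (incoming cap st w) <= cap.
Proof.
have [_ le_cap _] := load_leq w w; apply: leq_trans le_cap.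
rewrite incomingE size_pmap_enum /load.
apply: leq_trans (leq_imset_card (fun p => host p.1) _).
apply: subset_leq_card; apply/subsetP => v; rewrite inE.
case: ifP => // /negbT /ideal_outgoing_neq0 [p pM /and3P [at_slot src dst]] _.
apply/imsetP; exists p; first by rewrite inE pM /in_load at_slot dst.
by move: src; rewrite hostedE => /eqP.
Qed.

Lemma mem_unpack_all w k :
  (k \in unpack_all (P n) Q (incoming cap st w)) = [exists v, k \in ideal_outgoing v w].
Proof.
rewrite incomingE; apply/flattenP/existsP => [[s /mapP [[v b] vb /= ->]]|[v kv]].
  move: vb; rewrite mem_pmap => /mapP [v' _].
  case: ifP => // _ [_ ->]; rewrite packK ?size_ideal_outgoing // => kv.
  by exists v'.
exists (ideal_outgoing v w) => //; apply/mapP; exists (v, pack Q (ideal_outgoing v w)).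
  rewrite mem_pmap; apply/mapP; exists v; first by rewrite mem_enum.
  by case out_vw: (ideal_outgoing v w) kv.
by rewrite packK ?size_ideal_outgoing.
Qed.

Lemma merge_inboxE w x' x : hosted f x w ->
  merge_inbox Q (st w) (incoming cap st w) (x', x) =
    if slot f R (x', x) < rho.+1 then vmsg Y (x', x) else None.
Proof.
move=> host_x; have [_ _ _ _ inboxE] := at_rho w; rewrite ffunE inboxE //.
have receivedP k : k \in [seq k <- unpack_all (P n) Q (incoming cap st w) | k.1 == (x', x)] ->
    slot f R (x', x) = rho /\ exists2 m, vmsg Y (x', x) = Some m & k.2 = encode m.
  rewrite mem_filter mem_unpack_all => /andP [/eqP <-] /existsP [v].
  by case/ideal_outgoingP => m msg_k [/and3P [/eqP at_slot _ _] ek]; split=> //; exists m.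
case received: [seq k <- _ | _] => [|k l]; last first.
  have [|at_slot [m msg_x ek]] := receivedP k; first by rewrite received mem_head.
  by rewrite at_slot ltnSn msg_x ek (codableY msg_x).
case: (ltngtP (slot f R (x', x)) rho) => [lt|gt|at_slot]; [by rewrite ltnW| |].
  by rewrite ltnNge (leq_trans _ gt).
rewrite at_slot ltnSn.
case msg_x: vmsg => [m|] //=.
suff : ((x', x), encode m) \in [::] by [].
rewrite -received mem_filter eqxx mem_unpack_all; apply/existsP; exists (host x').
apply/ideal_outgoingP; exists m => //=; split=> //.
by apply/and3P; split; rewrite /= ?at_slot ?eqxx ?hostedE //= -hostedE.
Qed.

Variable st' : 'I_n -> St A n.
Hypothesis st'E : forall w, exists l,
  [/\ subseq l (incoming cap st w), size l = minn (size (incoming cap st w)) cap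
    & st' w = recv (st w) l].

Lemma all_delivered w : st' w = recv (st w) (incoming cap st w).
Proof.
have [l [sub_l size_l ->]] := st'E w; congr node_recv.
apply/eqP; rewrite -(size_subseq_leqif sub_l) size_l.
by rewrite (minn_idPl (size_incoming w)).
Qed.

Lemma at_round_next : rho.+1 != R -> at_round Y R rho.+1 st'.
Proof.
move=> neq_R w; have [idE seedE roundE statesE _] := at_rho w.
rewrite all_delivered /= /node_recv step_length_at roundE (negbTE neq_R) /=.
by split=> // x' x; apply: merge_inboxE.
Qed.

Lemma at_round_vstep R' : rho.+1 = R -> at_round (vstep Y) R' 0 st'.
Proof.
move=> eq_R w; have [idE seedE roundE statesE _] := at_rho w.
rewrite all_delivered /= /node_recv step_length_at roundE eq_R eqxx /=.
split=> // [x host_x|x' x _]; last by rewrite ffunE.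
rewrite /vstep statesE //; congr vrecv; apply/ffunP => x'.
by rewrite inboxE ffunE merge_inboxE // eq_R ltn_pmod // -eq_R.
Qed.

End Round.

Section Execution.

Variables (G : rel 'I_n) (s : 'I_n) (adv : Adv A n) (k : nat) (len : nat -> nat).
Hypothesis valid : valid_adv cap adv.
Notation Y tau := (iter tau (@vstep n (P n)) (@init_config n (P n) G s)).
Notation ex t := (exec G s cap adv f t).
Hypothesis sync : forall tau, tau < k -> synchronous (Y tau) (len tau).
Hypothesis codableY : forall tau, tau < k -> codable (Y tau).
Hypothesis uncongestedY :
  forall tau, tau < k -> uncongested cap Q (len tau) (sent (Y tau)) f.

Lemma exec_recv t w : exists l,
  [/\ subseq l (incoming cap (ex t) w), size l = minn (size (incoming cap (ex t) w)) cap
    & ex t.+1 w = recv (ex t w) l].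
Proof.
have [sub size_l] := valid f t w (incoming cap (ex t) w).
by exists (adv f t w (incoming cap (ex t) w)).
Qed.

Lemma at_round_init R : at_round (Y 0) R 0 (ex 0).
Proof.
move=> w; split=> //; last by move=> x' x _; rewrite ffunE.
by case=> [u|y] //= /eqP ->.
Qed.

Lemma at_round_later tau rho : tau < k -> rho < len tau ->
    at_round (Y tau) (len tau) 0 (ex (start_time len tau)) ->
  at_round (Y tau) (len tau) rho (ex (start_time len tau + rho)).
Proof.
move=> lt_tau; elim: rho => [|rho IH] lt_rho at0; first by rewrite addn0.
rewrite addnS; apply: (at_round_next (sync lt_tau) (codableY lt_tau) (uncongestedY lt_tau)
  (ltnW lt_rho) (IH (ltnW lt_rho) at0) (exec_recv _)).
by rewrite ltn_eqF.
Qed.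

Lemma at_round_start tau R : tau <= k -> at_round (Y tau) R 0 (ex (start_time len tau)).
Proof.
elim: tau R => [|tau IH] R lt_tau; first by rewrite /start_time big_ord0; apply: at_round_init.
have len_gt0 : 0 < len tau by rewrite -(sync lt_tau (Ordinal n_gt0)).
have lt_len : (len tau).-1 < len tau by rewrite prednK.
have at_last := at_round_later lt_tau lt_len (IH _ (ltnW lt_tau)).
rewrite start_timeS -(prednK len_gt0) addnS.
apply: (at_round_vstep (sync lt_tau) (codableY lt_tau) (uncongestedY lt_tau)
  lt_len at_last (exec_recv _)).
exact: prednK.
Qed.

Lemma output_start_time tau v : tau <= k ->
  output (ex (start_time len tau) v) = voutput (Y tau (inl v)).
Proof.
move=> le_tau; have [idE _ _ statesE _] := at_round_start 0 le_tau v.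
by rewrite /= idE statesE //= eqxx.
Qed.

Lemma output_before t v : t <= start_time len k ->
  exists2 tau, tau <= k & output (ex t v) = voutput (Y tau (inl v)).
Proof.
suff H tau : tau <= k -> t <= start_time len tau ->
    exists2 tau, tau <= k & output (ex t v) = voutput (Y tau (inl v)) by exact: H.
elim: tau => [_|tau IH lt_tau].
  by rewrite {1}/start_time big_ord0 leqn0 => /eqP ->; exists 0.
have [le_t _|lt_t] := leqP t (start_time len tau); first exact: IH (ltnW lt_tau) le_t.
rewrite leq_eqVlt => /orP [/eqP ->|]; first by exists tau.+1 => //; rewrite output_start_time.
rewrite start_timeS => lt_next; exists tau; first exact: ltnW.
have lt_rho : t - start_time len tau < len tau by rewrite ltn_subLR // ltnW.
have := at_round_later lt_tau lt_rho (at_round_start _ (ltnW lt_tau)).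
rewrite subnKC ?(ltnW lt_t) // => /(_ v) [idE _ _ statesE _].
by rewrite /= idE statesE //= eqxx.
Qed.

Lemma simulate_decided T v x : start_time len k <= T ->
    (forall tau, tau <= k ->
       voutput (Y tau (inl v)) = None \/ voutput (Y tau (inl v)) = Some x) ->
    voutput (Y k (inl v)) = Some x ->
  decided G s cap adv f T v = Some x.
Proof.
move=> le_T consistent final; apply: (decided_first le_T); last by rewrite output_start_time.
by move=> t /(output_before v) [tau le_tau ->]; apply: consistent.
Qed.

End Execution.
End Simulation.

Record feasible (n : nat) (P : protocol n) (allowed : pred (link n (virtual P)))
    (N l : nat) (Y : config P) (R : nat) : Prop := Feasible {
  feasible_sync : synchronous Y R;
  feasible_codable : codable Y;
  feasible_length : 0 < R <= N;
  feasible_light : light allowed l R (sent Y)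
}.

Section Runs.

Variables (n : nat) (P : protocol n) (allowed : pred (link n (virtual P))) (N l : nat).
Variable answer : 'I_n -> nat * option 'I_n.
Notation step := (@vstep n P).

Definition consistent (Y : config P) : Prop :=
  forall v, voutput (Y (inl v)) = None \/ voutput (Y (inl v)) = Some (answer v).

Definition run (k T : nat) (Y : config P) : Prop :=
  exists2 len, start_time len k <= T &
    forall tau, tau < k ->
      consistent (iter tau step Y) /\ feasible allowed N l (iter tau step Y) (len tau).

Definition reaches (k T : nat) (C C' : config P -> Prop) : Prop :=
  forall Y, C Y -> C' (iter k step Y) /\ run k T Y.

Lemma run_cat k T k' T' Y : run k T Y -> run k' T' (iter k step Y) -> run (k + k') (T + T') Y.
Proof.
move=> [len time ok] [len' time' ok'].
exists (fun tau => if tau < k then len tau else len' (tau - k)).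
  rewrite /start_time big_split_ord /=; apply: leq_add.
    by apply: leq_trans time; apply: leq_sum => i _; rewrite ltn_ord.
  apply: leq_trans time'; apply: leq_sum => i _.
  by rewrite ltnNge leq_addr /= addKn.
move=> tau lt_tau; case: ltnP => [|le_k]; first exact: ok.
by rewrite -(subnK le_k) iterD addnK; apply: ok'; lia.
Qed.

Lemma reaches_refl (C : config P -> Prop) : reaches 0 0 C C.
Proof.
by move=> Y CY; split=> //; exists (fun=> 0); rewrite /start_time ?big_ord0.
Qed.

Lemma reaches1 (R : nat) (C C' : config P -> Prop) :
    (forall Y, C Y -> [/\ C' (vstep Y), consistent Y & feasible allowed N l Y R]) ->
  reaches 1 R C C'.
Proof.
move=> step_ok Y /step_ok [C'Y consistentY feasibleY]; split=> //.
exists (fun=> R); first by rewrite /start_time big_ord1.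
by move=> tau; rewrite ltnS leqn0 => /eqP ->.
Qed.

Lemma reaches_trans C' k T k' T' (C C'' : config P -> Prop) :
  reaches k T C C' -> reaches k' T' C' C'' -> reaches (k + k') (T + T') C C''.
Proof.
move=> C_C' C'_C'' Y /C_C' [/C'_C'' [C''Y run'] run1]; split; last exact: run_cat run1 run'.
by rewrite addnC iterD.
Qed.

Lemma reaches_chain (d : nat) (T : nat -> nat) (k : nat) (C : nat -> config P -> Prop) :
    (forall j, j < k -> reaches d (T j) (C j) (C j.+1)) ->
  reaches (k * d) (\sum_(j < k) T j) (C 0) (C k).
Proof.
elim: k => [|k IH] steps; first by rewrite big_ord0; apply: reaches_refl.
rewrite mulSnr big_ord_recr /=; apply: reaches_trans (steps k (ltnSn k)).
by apply: IH => j lt_j; apply: steps; apply: ltnW.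
Qed.

Lemma reaches_iter (d T k : nat) (C : nat -> config P -> Prop) :
    (forall j, j < k -> reaches d T (C j) (C j.+1)) ->
  reaches (k * d) (k * T) (C 0) (C k).
Proof. by move/reaches_chain; rewrite sum_nat_const card_ord. Qed.

Lemma reaches_weaken (T T' k : nat) (C C' D D' : config P -> Prop) :
    T <= T' -> (forall Y, D Y -> C Y) -> (forall Y, C' Y -> D' Y) ->
  reaches k T C C' -> reaches k T' D D'.
Proof.
move=> le_T DC C'D' C_C' Y /DC /C_C' [/C'D' D'Y [len time ok]]; split=> //.
by exists len => //; apply: leq_trans le_T.
Qed.

End Runs.

Section WithHighProbability.

Variables (P : forall n, protocol n) (N : nat -> nat) (n : nat) (K : finType).
Notation V := (virtual (P n)).
Variables (allowed : pred (link n V)) (colour : link n V -> K).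
Hypothesis n_bound : 0 < n <= N n.
Hypothesis class_disjoint : forall p p', allowed p -> allowed p' ->
  link_class colour p = link_class colour p' -> p != p' ->
  [disjoint virtual_ends p & virtual_ends p'].
Hypothesis allowed_neq : forall p, allowed p -> p.1 != p.2.

Variables (l q e cap : nat).
Notation Q := (4 * #|K| * (2 * e)).
Notation A := (simulate P N Q).
Hypotheses (l_gt0 : 0 < l) (e_gt0 : 0 < e) (q_ge : 8 * l <= q) (q_exp : n ^ e <= 2 ^ q)
  (e_ge : 4 * l ^ 2 <= e ^ 2 * n).
Hypotheses (cap_ge : 4 * #|K| * q <= cap) (width_cap : pack_width (packet (P n)) Q <= cap).

Variables (G : rel 'I_n) (s : 'I_n) (k T : nat) (answer : 'I_n -> nat * option 'I_n).
Notation Y tau := (iter tau (@vstep n (P n)) (@init_config n (P n) G s)).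
Hypothesis final : forall v, voutput (Y k (inl v)) = Some (answer v).
Hypothesis correct : forall v, correct_output G s v (Some (answer v)).

Lemma simulate_success (adv : Adv A n) (f : Rnd A n) (len : nat -> nat) :
    valid_adv cap adv -> start_time len k <= T ->
    (forall tau, tau < k -> [/\ consistent answer (Y tau),
       feasible allowed (N n) l (Y tau) (len tau)
     & uncongested cap Q (len tau) (sent (Y tau)) f]) ->
  bfs_success G s cap adv f T.
Proof.
move=> valid time steps; have n_gt0 : 0 < n by case/andP: n_bound.
apply/forallP => v; rewrite (@simulate_decided P N Q n cap f n_gt0 width_cap G s adv k len
  valid _ _ _ T v (answer v)) //.
- by move=> tau /steps [_ []].
- by move=> tau /steps [_ []].
- by move=> tau /steps [].
- move=> tau; rewrite leq_eqVlt => /orP [/eqP ->|/steps [consistentY _ _]].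
    by right; apply: final.
  exact: consistentY.
Qed.

Lemma card_simulate_failure (adv : Adv A n) :
    valid_adv cap adv -> run allowed (N n) l answer k T (@init_config n (P n) G s) ->
  #|[set f : Rnd A n | ~~ bfs_success G s cap adv f T]| * n ^ e
    <= k * (16 * #|K| * n ^ 2 * N n) * #|Rnd A n|.
Proof.
move=> valid [len time steps]; have light_steps tau : tau < k ->
    0 < len tau <= N n /\ light allowed l (len tau) (sent (Y tau)).
  by case/steps => _ [].
apply: leq_trans (card_congested_steps n_bound class_disjoint allowed_neq l_gt0 e_gt0
  q_ge q_exp e_ge light_steps).
rewrite leq_mul2r; apply/orP; right; apply: subset_leq_card; apply/subsetP => f.
rewrite !inE; apply: contra => /forallP no_congestion.
apply: simulate_success valid time _ => tau lt_tau.
have [consistentY feasibleY] := steps tau lt_tau; split=> //.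
exact: uncongested_leq cap_ge (no_congestion (Ordinal lt_tau)).
Qed.

End WithHighProbability.

(** * The trie protocol *)

Lemma logc_gt0 n : 0 < logc n.
Proof. by []. Qed.

Lemma ltn_exp_logc n : n < 2 ^ logc n.
Proof. exact: trunc_log_ltn. Qed.

Inductive msg :=
  | Sums of nat * nat * nat
  | Query
  | Reply of nat
  | Insert
  | CountUp of nat
  | WakeUp
  | Cross
  | MinUp of nat.

Definition kind (m : msg) : nat :=
  match m with
  | Sums _ => 0 | Query => 1 | Reply _ => 2 | Insert => 3
  | CountUp _ => 4 | WakeUp => 5 | Cross => 6 | MinUp _ => 7
  end.

Definition payload (m : msg) : nat * nat * nat :=
  match m with
  | Sums t => t
  | Reply a | CountUp a | MinUp a => (a, 0, 0)
  | _ => (0, 0, 0)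
  end.

Definition msg_code (n : nat) : finType :=
  ('I_8 * ('I_(n * n).+1 * 'I_(n * n).+1 * 'I_(n * n).+1))%type.

Definition encode_msg (n : nat) (m : msg) : msg_code n :=
  (inord (kind m),
   (inord (payload m).1.1, inord (payload m).1.2, inord (payload m).2)).

Definition decode_msg (n : nat) (k : msg_code n) : msg :=
  let: (t, (a, b, c)) := k in
  match val t with
  | 0 => Sums (val a, val b, val c) | 1 => Query | 2 => Reply a | 3 => Insert
  | 4 => CountUp a | 5 => WakeUp | 6 => Cross | _ => MinUp a
  end.

Definition small_msg (n : nat) (m : msg) : bool :=
  [&& (payload m).1.1 <= n * n, (payload m).1.2 <= n * n & (payload m).2 <= n * n].

Lemma encode_msgK n m : small_msg n m -> decode_msg (encode_msg n m) = m.
Proof.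
by case/and3P; case: m => [[[a b] c]|||||||] /= *; rewrite /decode_msg /encode_msg /= !inordK.
Qed.

(* The node of height [h] and key [k] in the trie of [w] stands for the
   identifiers [u] with [u %/ 2 ^ h = k]. *)
Definition tnode (n : nat) : finType := ('I_n * 'I_(logc n).+1 * 'I_n)%type.

Section Protocol.

Variable n : nat.
Notation L := (logc n).
Notation X := (vnode n (tnode n)).

Definition own (y : tnode n) : 'I_n := y.1.1.
Definition ht (y : tnode n) : nat := y.1.2.
Definition key (y : tnode n) : 'I_n := y.2.

Definition child_of (y z : tnode n) : bool :=
  [&& own z == own y, ht z == (ht y).+1 & key z == (key y)./2 :> nat].

Definition mirror (y z : tnode n) : bool :=
  [&& ht y == 0, ht z == 0, own z == key y, key z == own y & own y != key y].

(* [rs_missing] counts the incident edges not yet inserted, [rs_keys] is the set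
   of keys reached by the top-down search, [rs_sums] holds the all-reduce sums
   (live nodes, missing edges, degrees of the BFS layer), [rs_clock] is the step
   within the phase and [rs_layer] the number of completed BFS layers. *)
Record rstate := RState {
  rs_nbrs : {set 'I_n};
  rs_missing : nat;
  rs_keys : {set 'I_n};
  rs_sums : nat * nat * nat;
  rs_clock : nat;
  rs_layer : nat;
  rs_label : option (nat * option 'I_n)
}.

(* The number of inserted edges below the trie node, and the pending message. *)
Definition tstate : Type := nat * option msg.

Definition in_layer (d : nat) (lab : option (nat * option 'I_n)) : bool :=
  if lab is Some (k, _) then k == d else false.

Definition own_sums (nbrs : {set 'I_n}) (missing d : nat)
    (lab : option (nat * option 'I_n)) : nat * nat * nat :=
  (nat_of_bool (0 < missing), missing, if in_layer d lab then #|nbrs| else 0).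

Definition phase_start (nbrs : {set 'I_n}) (missing d : nat)
    (lab : option (nat * option 'I_n)) : rstate :=
  RState nbrs missing set0 (own_sums nbrs missing d lab) 0 d lab.

Definition inserting (t : nat * nat * nat) : bool := 0 < t.1.1.

(* Fewer than half of the live nodes have more than [threshold t] missing edges. *)
Definition threshold (t : nat * nat * nat) : nat := 2 * (t.1.2 %/ t.1.1) + 2.

Definition poor (t : nat * nat * nat) (missing : nat) : bool := 0 < missing <= threshold t.

Definition body_extra (t : nat * nat * nat) : nat :=
  if inserting t then threshold t %/ L else t.2 %/ (n * L).

Definition real_extra (st : rstate) : nat :=
  if rs_clock st < 2 * L then 0 else body_extra (rs_sums st).

(* A phase starts with [2 * L] all-reduce steps: window sums of doubling length
   are gathered towards node [0], then the total spreads from node [0]. *)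
Definition reduce_send (w : 'I_n) (st : rstate) (x : X) : option msg :=
  let: c := rs_clock st in
  if x is inl w' then
    if (if c < L then w == w' + 2 ^ c :> nat
        else (w < 2 ^ (c - L)) && (w' == w + 2 ^ (c - L) :> nat))
    then Some (Sums (rs_sums st)) else None
  else None.

(* Step [2 * j] of an insertion body queries the trie counters at height
   [L - j.+1], step [2 * j + 1] answers, step [2 * L] inserts leaves, and the
   next [L + 1] steps carry the new counts upwards. *)
Definition insert_send (w : 'I_n) (st : rstate) (x : X) : option msg :=
  let: c := rs_clock st - 2 * L in
  if x is inr y then
    if c < 2 * L then
      if [&& ~~ odd c, own y == w, ht y == L - (c./2).+1
           & [exists k in rs_keys st, k == (key y)./2 :> nat]]
      then Some Query else None
    else if [&& c == 2 * L, ht y == 0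
              & (own y == w) && (key y \in rs_keys st)
                || (key y == w) && (own y \in rs_keys st)]
      then Some Insert else None
  else None.

Definition bfs_send (w : 'I_n) (st : rstate) (x : X) : option msg :=
  if x is inr y then
    if [&& rs_clock st == 2 * L, in_layer (rs_layer st) (rs_label st), own y == w,
           ht y == L & key y == 0 :> nat]
    then Some WakeUp else None
  else None.

Definition real_send (w : 'I_n) (st : rstate) : X -> option msg :=
  if rs_clock st < 2 * L then reduce_send w st
  else if inserting (rs_sums st) then insert_send w st else bfs_send w st.

Definition payload_of (o : option msg) : nat * nat * nat :=
  if o is Some m then payload m else (0, 0, 0).

Definition count_of (o : option msg) : nat := (payload_of o).1.1.

Definition least (P : pred nat) : nat := find P (iota 0 n).

Definition min_received (inb : {ffun X -> option msg}) : nat :=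
  least (fun k => [exists x, if inb x is Some (MinUp j) then j == k else false]).

Definition count_nbrs (nbrs : {set 'I_n}) (h k : nat) : nat :=
  #|[set u in nbrs | u %/ 2 ^ h == k]|.

Definition root_keys (t : nat * nat * nat) (missing : nat) : {set 'I_n} :=
  [set k : 'I_n | (k == 0 :> nat) && poor t missing].

Definition add_sums (s t : nat * nat * nat) : nat * nat * nat :=
  (s.1.1 + t.1.1, s.1.2 + t.1.2, s.2 + t.2).

Definition reduce_recv (w : 'I_n) (st : rstate) (inb : {ffun X -> option msg}) : rstate :=
  let: RState nbrs missing keys t c d lab := st in
  if c < L then
    RState nbrs missing keys
      (add_sums t (\big[add_sums/(0, 0, 0)]_x payload_of (inb x))) c.+1 d lab
  else
    let: t' := if [pick x | isSome (inb x)] is Some x then payload_of (inb x) else t in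
    RState nbrs missing (if c.+1 == 2 * L then root_keys t' missing else keys)
      t' c.+1 d lab.

Definition insert_recv (w : 'I_n) (st : rstate) (inb : {ffun X -> option msg}) : rstate :=
  let: RState nbrs missing keys t c d lab := st in
  let: o := c - 2 * L in
  if o == 3 * L + 1 then phase_start nbrs (missing - \sum_x count_of (inb x)) d lab
  else if (o < 2 * L) && odd o then
    let: h := L - (o./2).+1 in
    RState nbrs missing
      [set k : 'I_n | if inb (inr (w, inord h, k)) is Some (Reply r)
                      then r < count_nbrs nbrs h k else false] t c.+1 d lab
  else RState nbrs missing keys t c.+1 d lab.

Definition bfs_recv (w : 'I_n) (st : rstate) (inb : {ffun X -> option msg}) : rstate :=
  let: RState nbrs missing keys t c d lab := st in
  if c == 4 * L + 2 then
    phase_start nbrs missing d.+1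
      (if lab is Some _ then lab else
       if [exists x, isSome (inb x)] then Some (d.+1, insub (min_received inb)) else None)
  else RState nbrs missing keys t c.+1 d lab.

Definition real_recv (w : 'I_n) (st : rstate) : {ffun X -> option msg} -> rstate :=
  if rs_clock st < 2 * L then reduce_recv w st
  else if inserting (rs_sums st) then insert_recv w st else bfs_recv w st.

Definition up_target (y : tnode n) (x : X) : bool :=
  match x with
  | inl w => (w == own y) && (ht y == L)
  | inr z => child_of y z
  end.

Definition tree_send (y : tnode n) (st : tstate) (x : X) : option msg :=
  match st.2 with
  | Some (Reply _) => if x == inl (own y) then st.2 else None
  | Some (CountUp _) | Some (MinUp _) => if up_target y x then st.2 else None
  | Some WakeUp =>
      if x is inr z then
        if child_of z y then Some WakeUp else if mirror y z then Some Cross else None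
      else None
  | _ => None
  end.

Definition react (m : msg) (y : tnode n) (count : nat) (inb : {ffun X -> option msg}) :
    tstate :=
  match m with
  | Query => (count, Some (Reply count))
  | Insert => (count.+1, Some (CountUp 1))
  | CountUp _ => let: s := \sum_x count_of (inb x) in (count + s, Some (CountUp s))
  | WakeUp => (count, if 0 < count then Some WakeUp else None)
  | Cross => (count, Some (MinUp (key y)))
  | MinUp _ => (count, Some (MinUp (min_received inb)))
  | _ => (count, None)
  end.

Definition tree_recv (y : tnode n) (st : tstate) (inb : {ffun X -> option msg}) : tstate :=
  if [pick x | isSome (inb x)] is Some x then
    if inb x is Some m then react m y st.1 inb else (st.1, None)
  else (st.1, None).

Definition trie_state (x : X) : Type := match x with inl _ => rstate | inr _ => tstate end.

Definition trie_protocol : protocol n := {|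
  virtual := tnode n;
  message := msg;
  code := msg_code n;
  encode := @encode_msg n;
  decode := @decode_msg n;
  vstate := trie_state;
  init_real := fun w is_source nbrs =>
    phase_start nbrs #|nbrs| 0 (if is_source then Some (0, None) else None);
  init_virtual := fun y => (0, None);
  vsend := fun x => match x return trie_state x -> X -> option msg with
                    | inl w => real_send w | inr y => tree_send y end;
  vrecv := fun x => match x return trie_state x -> {ffun X -> option msg} -> trie_state x with
                    | inl w => real_recv w | inr y => tree_recv y end;
  extra_rounds := fun w => real_extra;
  voutput := fun w => rs_label
|}.

End Protocol.

(** * Links of the trie protocol *)

Section Links.

Variable n : nat.
Notation L := (logc n).
Notation X := (vnode n (tnode n)).
Implicit Types y z : tnode n.

Lemma tnode_eq y z : own y = own z -> ht y = ht z -> key y = key z -> y = z.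
Proof.
case: y => [[a b] c]; case: z => [[a' b'] c']; rewrite /own /ht /key /=.
by move=> -> /val_inj -> ->.
Qed.

Lemma ht_leq y : ht y <= L.
Proof. by rewrite -ltnS /ht. Qed.

Lemma child_ofP y z : reflect
  [/\ own z = own y, ht z = (ht y).+1 & val (key z) = (val (key y))./2] (child_of y z).
Proof. by apply: (iffP and3P) => -[/eqP ? /eqP ? /eqP ?]. Qed.

Lemma mirrorP y z : reflect
  [/\ ht y = 0, ht z = 0, own z = key y, key z = own y & own y <> key y] (mirror y z).
Proof.
by apply: (iffP and5P) => -[/eqP ? /eqP ? /eqP ? /eqP ? /eqP ?]; split=> //; apply/eqP.
Qed.

Lemma child_of_ht y z : child_of y z -> ht z = (ht y).+1.
Proof. by case/child_ofP. Qed.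

Lemma parent_unique y z z' : child_of y z -> child_of y z' -> z = z'.
Proof.
move=> /child_ofP [o1 h1 k1] /child_ofP [o2 h2 k2].
by apply: tnode_eq; rewrite ?o1 ?h1 //; apply: val_inj; rewrite k1.
Qed.

Lemma child_unique y y' z :
  child_of y z -> child_of y' z -> odd (key y) = odd (key y') -> y = y'.
Proof.
move=> /child_ofP [o1 h1 k1] /child_ofP [o2 h2 k2] eq_odd; apply: tnode_eq.
- by rewrite -o1 -o2.
- by apply: succn_inj; rewrite -h1 -h2.
- apply: val_inj; rewrite -(odd_double_half (val (key y))).
  by rewrite -(odd_double_half (val (key y'))) -k1 -k2 eq_odd.
Qed.

Lemma mirror_unique y z z' : mirror y z -> mirror y z' -> z = z'.
Proof.
by move=> /mirrorP [? ? ? ? ?] /mirrorP [? ? ? ? ?]; apply: tnode_eq; congruence.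
Qed.

Lemma mirror_sym y z : mirror y z = mirror z y.
Proof.
apply/mirrorP/mirrorP => -[? ? key_yz key_zy ?]; split=> //; rewrite ?key_yz ?key_zy //;
  exact: nesym.
Qed.

Definition tree_link y z : bool := [|| child_of y z, child_of z y | mirror y z].

Definition allowed_link (p : link n (tnode n)) : bool :=
  match p with
  | (inl w, inl w') => w != w'
  | (inl w, inr y) => (own y == w) || (ht y == 0) && (key y == w)
  | (inr y, inl w) => own y == w
  | (inr y, inr z) => tree_link y z
  end.

Definition colour : finType := (bool * bool * bool * bool * bool)%type.

Lemma card_colour : #|colour| = 32.
Proof. by rewrite !card_prod card_bool. Qed.

(* Within a colour class the hosts of all sources and destinations are distinct
   coordinates of the seed: parities of heights and keys separate siblings and
   consecutive levels, and comparing owners separates the two directions between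
   mirror leaves. *)
Definition link_colour (p : link n (tnode n)) : colour :=
  match p with
  | (inl w, inr y) => (own y == w, false, false, false, false)
  | (inr y, inr z) =>
      (ht y < ht z, ht z < ht y, odd (ht y),
       odd (if ht y < ht z then key y else key z), own y < own z)
  | _ => (false, false, false, false, false)
  end.

Lemma allowed_link_neq p : allowed_link p -> p.1 != p.2.
Proof.
case: p => [[w|y] [w'|z]] //= al; apply/eqP => -[eq_yz]; subst z.
by case/or3P: al => [/child_of_ht|/child_of_ht|/mirrorP []] //; lia.
Qed.

Definition common_end y z y' z' : bool := [|| y == y', z == z', y == z' | z == y'].

Lemma child_link_eq y z y' z' : child_of y z -> child_of y' z' ->
    odd (ht y) = odd (ht y') -> odd (key y) = odd (key y') -> common_end y z y' z' ->
  y = y' /\ z = z'.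
Proof.
move=> yz y'z' odd_ht odd_key; have [ht_z ht_z'] := (child_of_ht yz, child_of_ht y'z').
case/or4P => /eqP e; subst.
- by split=> //; apply: parent_unique yz y'z'.
- by split=> //; apply: child_unique yz y'z' odd_key.
- by move: odd_ht; rewrite ht_z' /=; case: odd.
- by move: odd_ht; rewrite ht_z /=; case: odd.
Qed.

Lemma mirror_link_eq y z y' z' : mirror y z -> mirror y' z' ->
    (own y < own z) = (own y' < own z') -> common_end y z y' z' ->
  y = y' /\ z = z'.
Proof.
move=> yz y'z' eq_lt.
have uncrossed (a b : tnode n) : mirror a b -> (own a < own b) <> (own b < own a).
  move=> /mirrorP [_ _ own_b _ neq]; have {}neq : own a != own b by rewrite own_b; apply/eqP.
  by case: (ltngtP (own a) (own b)) => // /val_inj e; rewrite e eqxx in neq.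
have zy := yz; have z'y' := y'z'; rewrite mirror_sym in zy; rewrite mirror_sym in z'y'.
case/or4P => /eqP e; subst.
- by split=> //; apply: mirror_unique yz y'z'.
- by split=> //; apply: mirror_unique zy z'y'.
- by have e := mirror_unique yz z'y'; subst; case: (uncrossed _ _ yz eq_lt).
- by have e := mirror_unique zy y'z'; subst; case: (uncrossed _ _ yz eq_lt).
Qed.

Lemma tree_link_eq y z y' z' : tree_link y z -> tree_link y' z' ->
    link_colour (inr y, inr z) = link_colour (inr y', inr z') ->
    common_end y z y' z' ->
  y = y' /\ z = z'.
Proof.
move=> yz y'z' [lt_yz lt_zy odd_ht odd_key lt_own] common.
have common_sym : common_end z y z' y'.
  by move: common; rewrite /common_end orbCA; do !case: (_ == _).
have kindP (a b : tnode n) : tree_link a b ->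
  [\/ [/\ child_of a b, ht a < ht b & (ht b < ht a) = false],
      [/\ child_of b a, (ht a < ht b) = false & ht b < ht a]
    | [/\ mirror a b, (ht a < ht b) = false & (ht b < ht a) = false]].
  case/or3P => ab; [constructor 1|constructor 2|constructor 3]; split=> //;
    by [have := child_of_ht ab; lia | case/mirrorP: ab => -> ->].
case: (kindP _ _ yz) (kindP _ _ y'z') => -[up lt1 lt2] [] [up' lt1' lt2'];
  rewrite lt1 lt2 lt1' lt2' // in lt_yz lt_zy odd_key.
- exact: child_link_eq up up' odd_ht odd_key common.
- have odd_ht' : odd (ht z) = odd (ht z').
    by move: odd_ht; rewrite (child_of_ht up) (child_of_ht up') /=; do 2 case: odd.
  by have [] := child_link_eq up up' odd_ht' odd_key common_sym.
- exact: mirror_link_eq up up' lt_own common.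
Qed.

Lemma link_class_disjoint p p' : allowed_link p -> allowed_link p' ->
    link_class link_colour p = link_class link_colour p' -> p != p' ->
  [disjoint virtual_ends p & virtual_ends p'].
Proof.
move=> al al' eq_class; apply: contraR => /pred0Pn [u /andP []]; rewrite !inE.
case: p p' al al' eq_class => [[w|y] [z|z]] [[w'|y'] [z'|z']] //=; rewrite ?orbF //.
- move=> al al' [eq_own] /eqP [z_u] /eqP [z'_u]; subst u; subst z'.
  case: (eqVneq (own z) w) al al' eq_own => [<-|_] /=; first by move=> _ _ /esym/eqP ->.
  by move=> /andP [_ /eqP <-] + /esym own_neq; rewrite own_neq => /andP [_ /eqP <-].
- by move=> /eqP <- /eqP <- _ /eqP [->] /eqP [->].
- move=> yz y'z' [lt1 lt2 odd_ht odd_key lt_own] u_in u_in'.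
  have [-> ->//] : y = y' /\ z = z'.
  apply: tree_link_eq => //; first by rewrite /= odd_key lt1 lt2 odd_ht lt_own.
  move: u_in u_in'; rewrite /common_end.
  by case/orP => /eqP [->] /orP [] /eqP [->]; rewrite eqxx ?orbT.
Qed.

End Links.

Arguments allowed_link {n}.

(** * Messages and feasibility of a step *)

Section Messages.

Variable n : nat.
Notation L := (logc n).
Notation X := (vnode n (tnode n)).
Notation config := (config (trie_protocol n)).
Implicit Types y z : tnode n.

Definition no_msg : tnode n -> option msg := fun=> None.

Lemma real_send_real w (st : rstate n) w' : isSome (real_send w st (inl w')) ->
  if rs_clock st < L then nat_of_ord w = w' + 2 ^ rs_clock st
  else nat_of_ord w' = w + 2 ^ (rs_clock st - L).
Proof.
rewrite /real_send; case: ifP => _; last by case: ifP.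
by rewrite /reduce_send; case: ifP => //; case: ifP => [_ /eqP|_ /andP [_ /eqP]].
Qed.

Lemma real_send_tree w (st : rstate n) y : isSome (real_send w st (inr y)) ->
  (own y == w) || (ht y == 0) && (key y == w).
Proof.
rewrite /real_send; case: ifP => // _; case: ifP => _; rewrite /insert_send /bfs_send.
  case: ifP => _; first by case: ifP => // /and4P [_ -> _ _].
  by case: ifP => // /and3P [_ -> /orP [/andP [-> _]|/andP [-> _]]] _; rewrite ?orbT.
by case: ifP => // /and5P [_ _ -> _ _].
Qed.

Lemma tree_send_real y (st : tstate) w : isSome (tree_send y st (inl w)) -> own y = w.
Proof.
case: st => c [m|]; rewrite /tree_send //=.
by case: m => //= a; case: ifP => // own_y _;
  first [by case/andP: own_y => /eqP | by case/eqP: own_y].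
Qed.

Lemma tree_send_tree y (st : tstate) z : isSome (tree_send y st (inr z)) ->
  isSome st.2 /\ if st.2 is Some WakeUp then child_of z y || mirror y z else child_of y z.
Proof.
case: st => c [m|]; rewrite /tree_send //=.
by case: m => //= [a|| a]; case: ifP => //; case: ifP => // ->.
Qed.

Lemma tree_send_link y (st : tstate) z : isSome (tree_send y st (inr z)) -> tree_link y z.
Proof.
rewrite /tree_link; case/tree_send_tree; case: st => c [m|] //= _.
by case: m => [t||a||a|||a] => [->|->|->|->|->|/orP [->|->]|->|->] //; rewrite ?orbT.
Qed.

Lemma tree_targets_parity y (st : tstate) z z' :
    isSome (tree_send y st (inr z)) -> isSome (tree_send y st (inr z')) ->
  odd (key z) = odd (key z') -> z = z'.
Proof.
move=> /tree_send_tree [_ z_y] /tree_send_tree [_ z'_y] eq_odd.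
case: st z_y z'_y => c o /=; case: o => [[t||a||a|||a]|] /=;
  try by move=> z_y z'_y; apply: parent_unique z_y z'_y.
case/orP => z_y /orP [] z'_y.
- exact: child_unique z_y z'_y eq_odd.
- by case/mirrorP: z'_y => ht_y _ _ _ _; have := child_of_ht z_y; rewrite ht_y.
- by case/mirrorP: z_y => ht_y _ _ _ _; have := child_of_ht z'_y; rewrite ht_y.
- exact: mirror_unique z_y z'_y.
Qed.

Lemma card_tree_targets y (st : tstate) :
  #|[set z | isSome (tree_send y st (inr z))]| <= if isSome st.2 then 2 else 0.
Proof.
case: ifP => [_|none]; last first.
  by rewrite leqn0 cards_eq0; apply/eqP/setP => z; rewrite !inE;
    apply/negbTE/negP => /tree_send_tree []; rewrite none.
rewrite -card_bool; apply: (leq_card_inj (f := fun z => odd (key z))) => // z z'.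
by rewrite !inE; apply: tree_targets_parity.
Qed.

Lemma tree_send_msg y (st : tstate) x m : tree_send y st x = Some m ->
  st.2 = Some m \/ payload m = (0, 0, 0).
Proof.
case: st => c [m0|]; rewrite /tree_send //=.
case: m0 => //= [a|a||a]; first [case: ifP => // _ [<-]; by left|idtac].
by case: x => // z; do 2 (case: ifP => [_ [<-]|_] //; first by right).
Qed.

Lemma light_sent (Y : config) (c l R : nat) :
    (forall w, rs_clock (Y (inl w)) = c) ->
    (forall w, #|[set y | isSome (real_send w (Y (inl w)) (inr y))]| <= l * R) ->
    (forall w, #|[set y | isSome (tree_send y (Y (inr y)) (inl w))]| <= l * R) ->
    2 * #|[set y | isSome (Y (inr y)).2]| <= l * (n * R) ->
  light allowed_link l R (sent Y).
Proof.
move=> clockE out_le in_le tree_le; split.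
- case=> [[w|y] [w'|z]]; rewrite inE /vmsg /=.
  + move/real_send_real; rewrite clockE => eq_w; apply/eqP => eq_ww'; move: eq_w.
    have := expn_gt0 2 c; have := expn_gt0 2 (c - L).
    by rewrite -eq_ww'; case: ifP => _; lia.
  + exact: real_send_tree.
  + by move/tree_send_real => ->.
  + exact: tree_send_link.
- move=> w; apply/card_le1_eqP => u u'; rewrite !inE => /real_send_real + /real_send_real.
  by rewrite clockE => + +; case: ifP => _ eq_ht eq_key; apply: val_inj => /=; lia.
- move=> w; apply/card_le1_eqP => u u'; rewrite !inE => /real_send_real + /real_send_real.
  by rewrite !clockE; case: ifP => _ eq_ht eq_key; apply: val_inj => /=; lia.
- move=> w; apply: leq_trans (out_le w); apply: subset_leq_card.
  by apply/subsetP => y; rewrite !inE.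
- move=> w; apply: leq_trans (in_le w); apply: subset_leq_card.
  by apply/subsetP => y; rewrite !inE.
apply: leq_trans tree_le.
pose targets y := [set z | isSome (tree_send y (Y (inr y)) (inr z))].
apply: (@leq_trans #|\bigcup_y [set (y, z) | z in targets y]|).
  apply: subset_leq_card; apply/subsetP => -[y z]; rewrite !inE => sent_yz.
  by apply/bigcupP; exists y => //; apply: imset_f; rewrite inE.
apply: leq_trans (leq_card_bigcup _ _) _; rewrite mulnC -sum_nat_const [X in _ <= X]big_mkcond.
apply: leq_sum => y _; rewrite inE; apply: leq_trans (card_tree_targets y (Y (inr y))).
exact: leq_imset_card.
Qed.

End Messages.

Arguments no_msg {n}.

Section Tables.

Variables (n N l : nat) (answer : 'I_n -> nat * option 'I_n).
Notation L := (logc n).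
Notation X := (vnode n (tnode n)).
Notation config := (config (trie_protocol n)).
Implicit Types (r : 'I_n -> rstate n) (cnt : tnode n -> nat) (act : tnode n -> option msg).

Definition conf r cnt act (Y : config) : Prop :=
  (forall w, Y (inl w) = r w) /\ (forall y, Y (inr y) = (cnt y, act y)).

Lemma conf_eq r r' cnt cnt' act act' : r =1 r' -> cnt =1 cnt' -> act =1 act' ->
  forall Y : config, conf r cnt act Y -> conf r' cnt' act' Y.
Proof.
move=> eq_r eq_cnt eq_act Y [realE treeE]; split=> [w|y]; first by rewrite realE eq_r.
by rewrite treeE eq_cnt eq_act.
Qed.

Definition delivery r cnt act (x : X) : {ffun X -> option msg} :=
  [ffun x' => match x' with
              | inl w => real_send w (r w) x
              | inr y => tree_send y (cnt y, act y) x
              end].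

Lemma delivery_real r cnt act x w : delivery r cnt act x (inl w) = real_send w (r w) x.
Proof. by rewrite ffunE. Qed.

Lemma delivery_tree r cnt act x y :
  delivery r cnt act x (inr y) = tree_send y (cnt y, act y) x.
Proof. by rewrite ffunE. Qed.

Lemma inbox_delivery r cnt act Y x : conf r cnt act Y -> inbox Y x = delivery r cnt act x.
Proof.
by move=> [realE treeE]; apply/ffunP => -[w|y]; rewrite !ffunE /vmsg /= ?realE ?treeE.
Qed.

Record conf_feasible (c R : nat) r cnt act : Prop := ConfFeasible {
  conf_clock : forall w, rs_clock (r w) = c;
  conf_sync : forall w, (real_extra (r w)).+1 = R;
  conf_length : 0 < R <= N;
  conf_small_sums : forall w, small_msg n (Sums (rs_sums (r w)));
  conf_small_msg : forall y m, act y = Some m -> small_msg n m;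
  conf_out : forall w, #|[set y | isSome (real_send w (r w) (inr y))]| <= l * R;
  conf_in : forall w, #|[set y | isSome (tree_send y (cnt y, act y) (inl w))]| <= l * R;
  conf_tree : 2 * #|[set y | isSome (act y)]| <= l * (n * R)
}.

Lemma real_send_msg w (st : rstate n) x m : real_send w st x = Some m ->
  m = Sums (rs_sums st) \/ payload m = (0, 0, 0).
Proof.
rewrite /real_send /reduce_send /insert_send /bfs_send; case: ifP => _.
  by case: x => // w'; case: ifP => // _ [<-]; left.
case: x => [?|y]; case: ifP => _ //; last by case: ifP => // _ [<-]; right.
by case: ifP => _; case: ifP => // _ [<-]; right.
Qed.

Lemma conf_feasibleP c R r cnt act Y : conf_feasible c R r cnt act -> conf r cnt act Y ->
  feasible (P := trie_protocol n) allowed_link N l Y R.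
Proof.
have null_small m : payload m = (0, 0, 0) -> small_msg n m by rewrite /small_msg => ->.
case=> clockE syncE bound small_sums small_act out_le in_le tree_le [realE treeE]; split=> //.
- by move=> w /=; rewrite realE syncE.
- move=> [[w|y] x] m; rewrite /vmsg /= ?realE ?treeE => sent_m; apply: encode_msgK.
    by case: (real_send_msg sent_m) => [->|/null_small].
  by case: (tree_send_msg sent_m) => [/small_act|/null_small].
apply: (@light_sent _ _ c) => [w|w|w|].
- by rewrite realE.
- by rewrite realE.
- apply: leq_trans (in_le w); apply: subset_leq_card; apply/subsetP => y.
  by rewrite !inE treeE.
- apply: leq_trans tree_le; rewrite leq_mul2l; apply: subset_leq_card; apply/subsetP => y.
  by rewrite !inE treeE.
Qed.

Definition consistent_label (w : 'I_n) (lab : option (nat * option 'I_n)) : Prop :=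
  lab = None \/ lab = Some (answer w).

Lemma reaches_vstep c R r cnt act r' cnt' act' :
    (forall w, consistent_label w (rs_label (r w))) ->
    conf_feasible c R r cnt act ->
    (forall w, real_recv w (r w) (delivery r cnt act (inl w)) = r' w) ->
    (forall y, tree_recv y (cnt y, act y) (delivery r cnt act (inr y)) = (cnt' y, act' y)) ->
  reaches (P := trie_protocol n) allowed_link N l answer 1 R
    (conf r cnt act) (conf r' cnt' act').
Proof.
move=> consistent_r feasible_r realE' treeE'; apply: reaches1 => Y confY.
have [realE treeE] := confY; split; last exact: conf_feasibleP feasible_r confY.
  by split=> [w|y]; rewrite /vstep /= (inbox_delivery _ confY) ?realE ?treeE.
by move=> w; rewrite /= realE; apply: consistent_r.
Qed.

Lemma react_kind m m' (y : tnode n) count inb :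
  kind m = kind m' -> react m y count inb = react m' y count inb.
Proof. by case: m; case: m'. Qed.

Lemma tree_recv_kind m (y : tnode n) st (inb : {ffun X -> option msg}) :
    (forall x m', inb x = Some m' -> kind m' = kind m) ->
  tree_recv y st inb = if [exists x, isSome (inb x)] then react m y st.1 inb else (st.1, None).
Proof.
move=> kindE; rewrite /tree_recv; case: pickP => [x some_x|none].
  have -> : [exists x, isSome (inb x)] by apply/existsP; exists x.
  by case msg_x: (inb x) some_x => [m'|] // _; apply: react_kind (kindE x m' msg_x).
by case: ifP => // /existsP [x]; rewrite none.
Qed.

Lemma tree_recv_none (y : tnode n) st (inb : {ffun X -> option msg}) :
  (forall x, inb x = None) -> tree_recv y st inb = (st.1, None).
Proof.
move=> none; rewrite (tree_recv_kind (m := Query)) => [|x m]; last by rewrite none.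
by case: ifP => // /existsP [x]; rewrite none.
Qed.

Lemma exists_real_sender (inb : {ffun X -> option msg}) (P : pred 'I_n) :
    (forall x, isSome (inb x) = if x is inl w then P w else false) ->
  [exists x, isSome (inb x)] = [exists w, P w].
Proof.
move=> inbE; apply/existsP/existsP => [[x]|[w Pw]]; last by exists (inl w); rewrite inbE.
by rewrite inbE; case: x => // w Pw; exists w.
Qed.

Lemma exists_tree_sender (inb : {ffun X -> option msg}) (P : pred (tnode n)) :
    (forall x, isSome (inb x) = if x is inr y then P y else false) ->
  [exists x, isSome (inb x)] = [exists y, P y].
Proof.
move=> inbE; apply/existsP/existsP => [[x]|[y Py]]; last by exists (inr y); rewrite inbE.
by rewrite inbE; case: x => // y Py; exists y.
Qed.

End Tables.

(** * Counting in tries *)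

Section Least.

Variable n : nat.

Lemma leastP (P : pred nat) k : k < n -> P k ->
  P (least n P) /\ forall j, P j -> least n P <= j.
Proof.
move=> lt_k Pk; have hasP : has P (iota 0 n) by apply/hasP; exists k; rewrite ?mem_iota.
have lt_n : least n P < n by rewrite /least -[X in _ < X](size_iota 0) -has_find.
split; first by have := nth_find 0 hasP; rewrite -/(least n P) nth_iota.
move=> j Pj; rewrite leqNgt; apply/negP => lt_j; have := before_find 0 lt_j.
by rewrite nth_iota ?(ltn_trans lt_j) // add0n Pj.
Qed.

Lemma least_eq (P : pred nat) m : m < n -> P m -> (forall j, P j -> m <= j) -> least n P = m.
Proof.
move=> lt_m Pm min_m; have [P_least min_least] := leastP lt_m Pm.
by apply/eqP; rewrite eqn_leq min_least // min_m.
Qed.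

Definition lowest (A : {set 'I_n}) : nat := least n (fun k => [exists u in A, u == k :> nat]).

Lemma lowestP (A : {set 'I_n}) u0 : u0 \in A ->
  exists2 u, u \in A & lowest A = u /\ forall v, v \in A -> u <= v.
Proof.
move=> u0A; pose in_set k := [exists u in A, nat_of_ord u == k].
have [|in_A min_A] := leastP (P := in_set) (ltn_ord u0); first by apply/exists_inP; exists u0.
case/exists_inP: in_A => u uA /eqP eq_u; exists u => //; split=> // v vA.
by rewrite eq_u; apply: min_A; apply/exists_inP; exists v.
Qed.

Lemma lowest_leq (A : {set 'I_n}) : lowest A <= n.
Proof. by rewrite -[X in _ <= X](size_iota 0 n) find_size. Qed.

End Least.

Section Counting.

Variable n : nat.
Notation L := (logc n).
Implicit Types (A B : 'I_n -> {set 'I_n}) (y z : tnode n).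

Definition below A y : {set 'I_n} := [set u in A (own y) | u %/ 2 ^ ht y == key y].

Definition trie_count A y : nat := #|below A y|.

Lemma div_ord_lt (u : 'I_n) h : u %/ 2 ^ h < n.
Proof. exact: leq_ltn_trans (leq_div _ _) (ltn_ord u). Qed.

Definition ancestor (w : 'I_n) (h : nat) (u : 'I_n) : tnode n :=
  (w, inord h, Ordinal (div_ord_lt u h)).

Lemma ht_tnode (w : 'I_n) h (k : 'I_n) : h <= L -> @ht n (w, inord h, k) = h.
Proof. by move=> le_h; rewrite /ht /= inordK. Qed.

Lemma divn_expS u h : u %/ 2 ^ h.+1 = (u %/ 2 ^ h)./2.
Proof. by rewrite expnSr divnMA divn2. Qed.

Lemma ord_div_exp (u : 'I_n) : u %/ 2 ^ L = 0.
Proof. by rewrite divn_small // (ltn_trans (ltn_ord u)) // ltn_exp_logc. Qed.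

Lemma ancestorE w h u y : h <= L ->
  (ancestor w h u == y) = [&& own y == w, ht y == h & u %/ 2 ^ h == key y].
Proof.
move=> le_h; apply/eqP/and3P => [<-|[/eqP own_y /eqP ht_y /eqP key_y]].
  by rewrite ht_tnode // /own /key !eqxx.
by apply: tnode_eq; rewrite ?ht_tnode //; apply: val_inj.
Qed.

Lemma trie_count_gt0 A y : (0 < trie_count A y) = [exists u, u \in below A y].
Proof. by apply/card_gt0P/existsP. Qed.

Lemma trie_count_leq A y : trie_count A y <= n.
Proof. by rewrite -[X in _ <= X]card_ord max_card. Qed.

Lemma trie_count_leaf A y : ht y = 0 -> trie_count A y = (key y \in A (own y)).
Proof.
move=> ht_y; rewrite /trie_count -sum1_card big_mkcond (bigD1 (key y)) //= big1 ?addn0.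
  by rewrite inE ht_y divn1 eqxx andbT; case: (_ \in _).
move=> u neq_u; rewrite inE ht_y divn1 (inj_eq val_inj) (negbTE neq_u).
by rewrite andbF.
Qed.

Lemma root_key A y : ht y = L -> 0 < trie_count A y -> key y = 0 :> nat.
Proof.
move=> ht_y; rewrite trie_count_gt0 => /existsP [u].
by rewrite inE ht_y ord_div_exp => /andP [_ /eqP].
Qed.

Lemma below_root A y : ht y = L -> key y = 0 :> nat ->
  below A y = A (own y).
Proof.
by move=> ht_y key_y; apply/setP => u; rewrite inE ht_y key_y ord_div_exp eqxx andbT.
Qed.

Lemma trie_countU A B y : (forall w, [disjoint A w & B w]) ->
  trie_count (fun w => A w :|: B w) y = trie_count A y + trie_count B y.
Proof.
move=> disAB; rewrite /trie_count -cardsUI [X in _ = _ + X]eq_card0 ?addn0.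
  by apply: eq_card => u; rewrite !inE andb_orl.
move=> u; rewrite !inE; have /pred0P/(_ u) := disAB (own y).
by rewrite /=; case: (u \in A _) => //= ->; rewrite ?andbF.
Qed.

Lemma eq_trie_count A B y : A =1 B -> trie_count A y = trie_count B y.
Proof. by move=> eqAB; apply: eq_card => u; rewrite !inE eqAB. Qed.

Lemma below_child A y u : u \in below A y -> 0 < ht y ->
  child_of (ancestor (own y) (ht y).-1 u) y /\ u \in below A (ancestor (own y) (ht y).-1 u).
Proof.
rewrite inE => /andP [uA /eqP key_y]; case ht_y: (ht y) => [//|h] _ /=.
have le_h : h <= L by have := ht_leq y; lia.
split; last by rewrite inE uA ht_tnode //= eqxx.
by apply/child_ofP; split; rewrite ?ht_tnode // -[LHS]key_y ht_y divn_expS.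
Qed.

Lemma below_parent A y z : child_of z y -> below A z \subset below A y.
Proof.
move=> /child_ofP [own_y ht_y key_y]; apply/subsetP => u.
rewrite !inE own_y ht_y => /andP [-> /eqP key_z].
by rewrite divn_expS key_z key_y /=.
Qed.

Lemma sum_children A y : 0 < ht y -> \sum_(z | child_of z y) trie_count A z = trie_count A y.
Proof.
move=> ht_y; rewrite /trie_count -[RHS]sum1_card.
rewrite (partition_big (ancestor (own y) (ht y).-1) (fun z => child_of z y)) /=; last first.
  by move=> u /below_child [].
apply: eq_bigr => z zy; have /child_ofP [own_y ht_z _] := zy.
rewrite -sum1_card; apply: eq_bigl => u; rewrite ancestorE; last by rewrite ht_z ht_leq.
rewrite -own_y ht_z !eqxx /= [u \in below A z]inE.
apply/idP/idP => [uz|/andP [uy key_z]]; last by move: uy; rewrite inE own_y key_z => /andP [->].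
rewrite (subsetP (below_parent A zy)) ?inE //=.
by case/andP: uz.
Qed.

Lemma sum_level A w h : h <= L ->
  \sum_(y | (own y == w) && (ht y == h)) trie_count A y = #|A w|.
Proof.
move=> le_h; rewrite -[RHS]sum1_card.
rewrite (partition_big (ancestor w h) (fun y => (own y == w) && (ht y == h))) /=.
  apply: eq_bigr => y /andP [/eqP own_y /eqP ht_y].
  rewrite /trie_count -sum1_card; apply: eq_bigl => u.
  by rewrite !inE ancestorE // own_y ht_y !eqxx.
by move=> u _; rewrite ht_tnode // /own !eqxx.
Qed.

Lemma card_level A h : h <= L ->
  #|[set y | (ht y == h) && (0 < trie_count A y)]| <= \sum_w #|A w|.
Proof.
move=> le_h; rewrite -sum1_card (partition_big (@own n) xpredT) //=.
apply: leq_sum => w _; rewrite -(sum_level A w le_h) big_mkcond [X in _ <= X]big_mkcond /=.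
apply: leq_sum => y _; rewrite inE [(own y == w) && _]andbC.
by case: (ht y == h) => //=; case: (own y == w); rewrite ?andbF ?andbT //; case: ifP.
Qed.

Lemma card_owners (P : pred (tnode n)) m :
  (forall w, #|[set y | (own y == w) && P y]| <= m) -> #|[set y | P y]| <= n * m.
Proof.
move=> le_m; rewrite -[n in n * _]card_ord -sum_nat_const -sum1_card.
rewrite (partition_big (@own n) xpredT) //=; apply: leq_sum => w _.
rewrite sum1_card; apply: leq_trans (le_m w); apply: eq_leq; apply: eq_card => y.
by rewrite unfold_in /= !inE andbC.
Qed.

End Counting.

Section LevelMessages.

Variable n : nat.
Notation L := (logc n).
Notation X := (vnode n (tnode n)).
Implicit Types (A : 'I_n -> {set 'I_n}) (y z : tnode n) (m : tnode n -> msg).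

Definition level_msg (h : nat) A m y : option msg :=
  if (ht y == h) && (0 < trie_count A y) then Some (m y) else None.

Definition upward (a : msg) : bool :=
  match a with CountUp _ | MinUp _ => true | _ => false end.

Lemma level_msg_isSome h A m y :
  isSome (level_msg h A m y) = (ht y == h) && (0 < trie_count A y).
Proof. by rewrite /level_msg; case: ifP. Qed.

Lemma card_level_msg h A m : h <= L ->
  #|[set y | isSome (level_msg h A m y)]| <= \sum_w #|A w|.
Proof.
move=> le_h; apply: leq_trans (card_level A le_h); apply: subset_leq_card.
by apply/subsetP => y; rewrite !inE level_msg_isSome.
Qed.

Section Upward.

Variables (h : nat) (A : 'I_n -> {set 'I_n}) (m : tnode n -> msg).
Hypothesis upward_m : forall y, upward (m y).
Variables (r : 'I_n -> rstate n) (cnt : tnode n -> nat).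
Notation act := (level_msg h A m).

Lemma tree_send_level y c x : tree_send y (c, act y) x = if up_target y x then act y else None.
Proof.
rewrite /level_msg; case: ifP => _; last by rewrite if_same.
by have := upward_m y; rewrite /tree_send /=; case: (m y) => // a _; case: x.
Qed.

Lemma card_level_roots w : #|[set y | isSome (tree_send y (cnt y, act y) (inl w))]| <= 1.
Proof.
apply/card_le1_eqP => y z; rewrite !inE !tree_send_level /=.
case: ifP => // /andP [/eqP own_y /eqP ht_y]; rewrite level_msg_isSome => /andP [_ cnt_y].
case: ifP => // /andP [/eqP own_z /eqP ht_z]; rewrite level_msg_isSome => /andP [_ cnt_z].
apply: tnode_eq; rewrite -?own_y ?ht_y //; apply: val_inj.
by rewrite /= (root_key ht_y cnt_y) (root_key ht_z cnt_z).
Qed.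

Lemma delivery_root w y : h = L -> delivery r cnt act (inl w) (inr y) =
  if [&& own y == w, ht y == L & 0 < trie_count A y] then Some (m y) else None.
Proof.
move=> h_L; rewrite delivery_tree tree_send_level /= /level_msg h_L eq_sym.
by case: (own y == w); case: (ht y == L).
Qed.

Hypothesis silent : forall w y, real_send w (r w) (inr y) = None.

Lemma delivery_level y x : delivery r cnt act (inr y) x =
  if x is inr z then if child_of z y then act z else None else None.
Proof.
by case: x => [w|z]; rewrite ?delivery_real ?silent // delivery_tree tree_send_level.
Qed.

Lemma delivery_level_Some y x a : delivery r cnt act (inr y) x = Some a ->
  exists z, [/\ x = inr z, child_of z y, 0 < trie_count A z & a = m z].
Proof.
rewrite delivery_level; case: x => // z; case: ifP => // zy.
rewrite /level_msg; case: ifP => // /andP [_ cnt_z] [<-].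
by exists z.
Qed.

Lemma delivery_child y u : ht y = h.+1 -> u \in below A y ->
  exists2 z, child_of z y /\ u \in below A z & delivery r cnt act (inr y) (inr z) = Some (m z).
Proof.
move=> ht_y u_y; have [|zy u_z] := below_child u_y; first by rewrite ht_y.
exists (ancestor (own y) (ht y).-1 u); rewrite // delivery_level zy /level_msg.
have -> : ht (ancestor (own y) (ht y).-1 u) = h.
  by apply: succn_inj; rewrite -(child_of_ht zy).
rewrite eqxx ifT // trie_count_gt0; apply/existsP.
by exists u.
Qed.

Lemma exists_delivery_level y : [exists x, isSome (delivery r cnt act (inr y) x)] =
  (ht y == h.+1) && (0 < trie_count A y).
Proof.
apply/existsP/andP => [[x]|[/eqP ht_y]].
  rewrite delivery_level; case: x => // z; case: ifP => // zy.
  rewrite level_msg_isSome (child_of_ht zy) => /andP [/eqP ->]; rewrite eqxx !trie_count_gt0.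
  case/existsP => u u_z; split=> //; apply/existsP.
  by exists u; apply: (subsetP (below_parent A zy)).
rewrite trie_count_gt0 => /existsP [u /(delivery_child ht_y) [z _ sent_z]].
by exists (inr z); rewrite sent_z.
Qed.

Lemma delivery_above_root y x : h = L -> delivery r cnt act (inr y) x = None.
Proof.
move=> h_L; case sent_x: (delivery _ _ _ _ x) => [a|//].
have : [exists x, isSome (delivery r cnt act (inr y) x)].
  by apply/existsP; exists x; rewrite sent_x.
rewrite exists_delivery_level h_L => /andP [/eqP ht_y _].
by have := ht_leq y; rewrite ht_y ltnn.
Qed.

End Upward.

Lemma sum_delivery_counts h A r cnt y :
    (forall w y, real_send w (r w) (inr y) = None) ->
  \sum_x count_of (delivery r cnt (level_msg h A (fun z => CountUp (trie_count A z))) (inr y) x)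
    = if ht y == h.+1 then trie_count A y else 0.
Proof.
move=> silent; set act := level_msg _ _ _.
have actE z : count_of (act z) = if ht z == h then trie_count A z else 0.
  rewrite /act /level_msg; case: (ht z == h) => //=; case: ifP => //=.
  by move/negbT; rewrite -eqn0Ngt => /eqP ->.
rewrite big_sumType /= [X in X + _]big1 ?add0n; last by move=> w _; rewrite delivery_level.
case: (eqVneq (ht y) h.+1) => [ht_y|neq_ht].
  rewrite -(@sum_children _ A) ?ht_y // [RHS]big_mkcond; apply: eq_bigr => z _.
  rewrite delivery_level //; case: ifP => // /child_of_ht; rewrite ht_y actE => -[->].
  by rewrite eqxx.
rewrite big1 // => z _; rewrite delivery_level //; case: ifP => // /child_of_ht ht_y.
by rewrite actE; case: eqP => // ht_z; rewrite ht_y ht_z eqxx in neq_ht.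
Qed.

Lemma min_delivery h A r cnt y :
    (forall w y, real_send w (r w) (inr y) = None) ->
    ht y = h.+1 -> 0 < trie_count A y ->
  min_received (delivery r cnt (level_msg h A (fun z => MinUp (lowest (below A z)))) (inr y))
    = lowest (below A y).
Proof.
move=> silent ht_y; rewrite trie_count_gt0 => /existsP [u0 /lowestP [u u_y [-> min_u]]].
have upward_min z : upward (MinUp (lowest (below A z))) by [].
apply: least_eq => // [|j /existsP [x]].
  have [z [zy u_z] sent_z] := delivery_child upward_min cnt silent ht_y u_y.
  apply/existsP; exists (inr z); rewrite sent_z.
  have [v v_z [-> min_v]] := lowestP u_z; rewrite eqn_leq min_v //=.
  by apply: min_u; apply: (subsetP (below_parent A zy)).
case sent_x: (delivery _ _ _ _ x) => [a|] //.
have [z [_ zy + ->]] := delivery_level_Some upward_min silent sent_x.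
rewrite trie_count_gt0 => /existsP [v0 /lowestP [v v_z [-> _]]] /eqP <-.
by apply: min_u; apply: (subsetP (below_parent A zy)).
Qed.

End LevelMessages.

(** * All-reduce *)

Section Windows.

Variables (R : Type) (idx : R) (op : Monoid.com_law idx) (n : nat) (g : 'I_n -> R).

Definition extend (i : nat) : R := if insub i is Some w then g w else idx.

Definition window (k i : nat) : R := \big[op/idx]_(i <= j < i + 2 ^ k) extend j.

Lemma extend_ord (w : 'I_n) : extend w = g w.
Proof. by rewrite /extend valK. Qed.

Lemma extend_out i : n <= i -> extend i = idx.
Proof. by move=> le_n; rewrite /extend insubN // -leqNgt. Qed.

Lemma big_extend m : n <= m -> \big[op/idx]_(0 <= j < m) extend j = \big[op/idx]_w g w.
Proof.
move=> le_n; rewrite (big_cat_nat (leq0n n) le_n) /= [X in op _ X]big_nat_cond.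
rewrite [X in op _ X]big1 ?Monoid.mulm1; last first.
  by move=> i /andP [/andP [le_i _] _]; apply: extend_out.
by rewrite big_mkord; apply: eq_bigr => w _; rewrite extend_ord.
Qed.

Lemma window0 (w : 'I_n) : window 0 w = g w.
Proof. by rewrite /window addn1 big_nat1 extend_ord. Qed.

Lemma windowS k i : window k.+1 i = op (window k i) (window k (i + 2 ^ k)).
Proof. by rewrite /window expnS mul2n -addnn addnA -big_cat_nat //= leq_addr. Qed.

Lemma window_out k i : n <= i -> window k i = idx.
Proof.
move=> le_n; rewrite /window big_nat_cond big1 // => j /andP [/andP [le_j _] _].
by apply: extend_out; apply: leq_trans le_j.
Qed.

Lemma window_all k : n <= 2 ^ k -> window k 0 = \big[op/idx]_w g w.
Proof. by move=> le_n; rewrite /window add0n big_extend. Qed.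

Lemma window_split k i : exists a b, \big[op/idx]_w g w = op (op a (window k i)) b.
Proof.
exists (\big[op/idx]_(0 <= j < i) extend j).
exists (\big[op/idx]_(i + 2 ^ k <= j < maxn n (i + 2 ^ k)) extend j).
rewrite -(@big_extend (maxn n (i + 2 ^ k))) ?leq_maxl //.
by rewrite /window -!big_cat_nat ?leq_addr ?leq_maxr.
Qed.

Lemma big_window_shift k (w : 'I_n) :
  \big[op/idx]_(w' : 'I_n) (if w' == w + 2 ^ k :> nat then window k w' else idx)
    = window k (w + 2 ^ k).
Proof.
rewrite -big_mkcond /=; case: (ltnP (w + 2 ^ k) n) => [lt_n|le_n].
  by rewrite (big_pred1 (Ordinal lt_n)).
rewrite window_out // big_pred0 // => w'.
by apply/negP => /eqP eq_w'; have := ltn_ord w'; lia.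
Qed.

End Windows.

Lemma add_sumsA : associative add_sums.
Proof. by move=> [[a b] c] [[a' b'] c'] [[a'' b''] c'']; rewrite /add_sums /= !addnA. Qed.

Lemma add_sumsC : commutative add_sums.
Proof.
by move=> [[a b] c] [[a' b'] c']; rewrite /add_sums /= [a + _]addnC [b + _]addnC [c + _]addnC.
Qed.

Lemma add0_sums : left_id (0, 0, 0) add_sums.
Proof. by case=> [[a b] c]. Qed.

HB.instance Definition _ := Monoid.isComLaw.Build _ _ add_sums add_sumsA add_sumsC add0_sums.

Lemma big_add_sums (I : finType) (g : I -> nat * nat * nat) :
  \big[add_sums/(0, 0, 0)]_i g i = (\sum_i (g i).1.1, \sum_i (g i).1.2, \sum_i (g i).2).
Proof.
have proj (pr : nat * nat * nat -> nat) :
    pr (0, 0, 0) = 0 -> {morph pr : s t / add_sums s t >-> s + t} ->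
  pr (\big[add_sums/(0, 0, 0)]_i g i) = \sum_i pr (g i).
  by move=> pr0 prD; apply: big_morph.
rewrite -(proj (fun t => t.1.1)) // -(proj (fun t => t.1.2)) // -(proj snd) //.
by case: (\big[_/_]_i g i) => -[].
Qed.

Section AllReduce.

Variables (n N l : nat) (answer : 'I_n -> nat * option 'I_n).
Notation L := (logc n).
Variables (nbrs : 'I_n -> {set 'I_n}) (missing : 'I_n -> nat) (d : nat)
  (label : 'I_n -> option (nat * option 'I_n)).
Variables (g : 'I_n -> nat * nat * nat) (cnt : tnode n -> nat).
Notation reaches := (reaches (P := trie_protocol n) allowed_link N l answer).

Definition grand_total : nat * nat * nat := \big[add_sums/(0, 0, 0)]_w g w.

Hypothesis N_gt0 : 0 < N.
Hypothesis label_consistent : forall w, consistent_label answer w (label w).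
Hypothesis small_grand_total : small_msg n (Sums grand_total).

Notation window := (window add_sums g).

Definition gathered (k : nat) (w : 'I_n) : rstate n :=
  RState (nbrs w) (missing w) set0 (window k w) k d (label w).

Definition spread_sums (k : nat) (w : 'I_n) : nat * nat * nat :=
  if w < 2 ^ k then grand_total else window L w.

Definition spread (k : nat) (w : 'I_n) : rstate n :=
  RState (nbrs w) (missing w)
    (if L + k == 2 * L then root_keys n (spread_sums k w) (missing w) else set0)
    (spread_sums k w) (L + k) d (label w).

Lemma small_window k i : small_msg n (Sums (window k i)).
Proof.
have [a [b eq_sum]] := window_split add_sums g k i.
by have := small_grand_total; rewrite /small_msg /grand_total eq_sum /=; lia.
Qed.

Lemma reduce_feasible c (r : 'I_n -> rstate n) : c < 2 * L ->
    (forall w, rs_clock (r w) = c) -> (forall w, small_msg n (Sums (rs_sums (r w)))) ->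
  conf_feasible N l c 1 r cnt no_msg.
Proof.
move=> lt_c clockE small_r; split=> //.
- by move=> w; rewrite /real_extra clockE lt_c.
- by move=> w; rewrite eq_card0 // => y; rewrite !inE /real_send clockE lt_c.
- by move=> w; rewrite eq_card0 // => y; rewrite !inE.
- by rewrite eq_card0 // => y; rewrite !inE.
Qed.

Lemma reduce_tree c (r : 'I_n -> rstate n) y : c < 2 * L ->
    (forall w, rs_clock (r w) = c) ->
  tree_recv y (cnt y, None) (delivery r cnt no_msg (inr y)) = (cnt y, None).
Proof.
move=> lt_c clockE; apply: tree_recv_none => -[w|z]; rewrite ?delivery_tree //.
by rewrite delivery_real /real_send clockE lt_c.
Qed.

Lemma gather_step k : k < L ->
  reaches 1 1 (conf (gathered k) cnt no_msg) (conf (gathered k.+1) cnt no_msg).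
Proof.
move=> lt_k; have lt_2L : k < 2 * L by lia.
apply: (reaches_vstep (c := k)) => //.
- by apply: reduce_feasible => // w; apply: small_window.
- move=> w; rewrite /real_recv /= lt_2L /reduce_recv /= lt_k; congr RState.
  rewrite windowS; congr add_sums; rewrite big_sumType /= [X in add_sums _ X]big1 => [|y _].
    rewrite -big_window_shift Monoid.mulm1; apply: eq_bigr => w' _.
    by rewrite delivery_real /real_send /= lt_2L /reduce_send /= lt_k; case: ifP.
  by rewrite delivery_tree.
- by move=> y; apply: reduce_tree lt_2L _.
Qed.

Lemma delivery_spread k w x : k < L ->
  delivery (spread k) cnt no_msg (inl w) x =
    if x is inl w' then
      if (w' < 2 ^ k) && (w == w' + 2 ^ k :> nat) then Some (Sums grand_total) else None
    else None.
Proof.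
move=> lt_k; case: x => [w'|y]; last by rewrite delivery_tree.
have [lt_2L ge_L] : L + k < 2 * L /\ (L + k < L) = false by lia.
rewrite delivery_real /real_send /= lt_2L /reduce_send /= ge_L addKn /spread_sums.
by case: (w' < 2 ^ k).
Qed.

Lemma spread_received k w : k < L ->
  (if [pick x | isSome (delivery (spread k) cnt no_msg (inl w) x)] is Some x
   then payload_of (delivery (spread k) cnt no_msg (inl w) x)
   else spread_sums k w) = spread_sums k.+1 w.
Proof.
move=> lt_k; case: pickP => [x|none].
  rewrite delivery_spread //; case: x => // w'; case: ifP => // /andP [lt_w' /eqP eq_w] _.
  by rewrite /spread_sums eq_w expnS mul2n -addnn ltn_add2r lt_w'.
rewrite /spread_sums; case: ifP => [lt_w|le_w]; first by rewrite (leq_trans lt_w) // leq_exp2l.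
case: ifP => // lt_w; exfalso.
have lt_n : w - 2 ^ k < n by apply: leq_ltn_trans (ltn_ord w); rewrite leq_subr.
have := none (inl (Ordinal lt_n)).
rewrite delivery_spread //= subnK; last by rewrite leqNgt le_w.
have -> : w - 2 ^ k < 2 ^ k by move: lt_w; rewrite expnS; lia.
by rewrite eqxx.
Qed.

Lemma spread_step k : k < L ->
  reaches 1 1 (conf (spread k) cnt no_msg) (conf (spread k.+1) cnt no_msg).
Proof.
move=> lt_k; have lt_2L : L + k < 2 * L by lia.
apply: (reaches_vstep (c := L + k)) => //.
- apply: reduce_feasible => // w; rewrite /= /spread_sums; case: ifP => // _.
  exact: small_window.
- move=> w; rewrite /real_recv /= lt_2L /reduce_recv /= spread_received //.
  have [ge_L neq_2L] : (L + k < L) = false /\ (L + k == 2 * L) = false by lia.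
  by rewrite ge_L neq_2L -addnS.
- by move=> y; apply: reduce_tree lt_2L _.
Qed.

Lemma all_reduce :
  reaches (2 * L) (2 * L)
    (conf (fun w => RState (nbrs w) (missing w) set0 (g w) 0 d (label w)) cnt no_msg)
    (conf (fun w => RState (nbrs w) (missing w) (root_keys n grand_total (missing w))
                      grand_total (2 * L) d (label w)) cnt no_msg).
Proof.
have gather := reaches_iter gather_step; have scatter := reaches_iter spread_step.
rewrite !muln1 in gather scatter; have := ltn_exp_logc n => /ltnW lt_n.
have {}scatter : reaches L L (conf (gathered L) cnt no_msg) (conf (spread L) cnt no_msg).
  apply: reaches_weaken scatter => // Y; apply: conf_eq => // w.
  rewrite /gathered /spread /spread_sums ltnS leqn0 addn0.
  have -> : (L == 2 * L) = false by have := logc_gt0 n; lia.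
  by case: eqP => // ->; rewrite window_all.
rewrite mul2n -addnn; apply: reaches_weaken (reaches_trans gather scatter) => // Y;
  apply: conf_eq => // w; first by rewrite /gathered window0.
by rewrite /spread addnn -mul2n eqxx /spread_sums (leq_trans (ltn_ord w)).
Qed.

End AllReduce.

(** * Insertion of edges *)

Section Insertion.

Variables (n N l : nat) (answer : 'I_n -> nat * option 'I_n).
Notation L := (logc n).
Implicit Types y z : tnode n.
Variables (nbrs U : 'I_n -> {set 'I_n}) (d : nat)
  (label : 'I_n -> option (nat * option 'I_n)) (t : nat * nat * nat).
Hypothesis l_ge : 4 * L <= l.
Hypothesis U_sub : forall v, U v \subset nbrs v.
Hypothesis U_sym : forall u v, (u \in U v) = (v \in U u).
Hypothesis t_inserting : inserting t.
Hypothesis t_small : small_msg n (Sums t).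
Hypothesis label_consistent : forall w, consistent_label answer w (label w).

Definition insert_length : nat := (threshold t %/ L).+1.

Hypothesis length_leq : insert_length <= N.

Definition poor_node (v : 'I_n) : bool := poor t #|U v|.
Definition inserted (v : 'I_n) : {set 'I_n} := nbrs v :\: U v.
Definition fresh (v : 'I_n) : {set 'I_n} := [set u in U v | poor_node v || poor_node u].
Definition remaining (v : 'I_n) : {set 'I_n} := U v :\: fresh v.

Definition reached (h : nat) (w : 'I_n) : {set 'I_n} :=
  [set k : 'I_n | poor_node w && [exists u in U w, u %/ 2 ^ h == k]].

Definition asked (h : nat) y : bool :=
  (ht y == h) && [exists k in reached h.+1 (own y), k == (key y)./2 :> nat].

Definition reply_msg (h : nat) y : option msg :=
  if asked h y then Some (Reply (trie_count inserted y)) else None.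

Definition fresh_msg (h : nat) : tnode n -> option msg :=
  level_msg h fresh (fun y => CountUp (trie_count fresh y)).

Definition count_upto (h : nat) y : nat :=
  trie_count inserted y + if ht y <= h then trie_count fresh y else 0.

Definition insert_state (keys : 'I_n -> {set 'I_n}) (c : nat) (w : 'I_n) : rstate n :=
  RState (nbrs w) #|U w| (keys w) t c d (label w).

Notation iconf keys c cnt act := (conf (insert_state keys c) cnt act).
Notation reaches := (reaches (P := trie_protocol n) allowed_link N l answer).

Lemma poor_node_leq w : poor_node w -> #|U w| <= threshold t.
Proof. by case/andP. Qed.

Lemma card_reached h w : #|reached h w| <= threshold t.
Proof.
case poor_w: (poor_node w); last by rewrite eq_card0 // => k; rewrite !inE poor_w.
apply: leq_trans (poor_node_leq poor_w).
apply: leq_trans (leq_imset_card (fun u => Ordinal (div_ord_lt u h)) _).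
apply: subset_leq_card; apply/subsetP => k.
rewrite inE => /andP [_ /exists_inP [u uU /eqP eq_k]].
by apply/imsetP; exists u => //; apply: val_inj.
Qed.

Lemma card_asked h w : #|[set y | (own y == w) && asked h y]| <= 2 * threshold t.
Proof.
apply: (@leq_trans #|setX [set: bool] (reached h.+1 w)|); last first.
  by rewrite cardsX cardsT card_bool leq_mul2l card_reached.
have lt_half y : (key y)./2 < n by have := ltn_ord (key y); lia.
apply: (leq_card_inj (f := fun y => (odd (key y), Ordinal (lt_half y)))) => [y z|y];
  rewrite !inE.
  case/and3P => /eqP own_y /eqP ht_y _ /and3P [/eqP own_z /eqP ht_z _] [eq_odd eq_half].
  apply: tnode_eq; rewrite ?own_y ?ht_y //; apply: val_inj => /=.
  by rewrite -(odd_double_half (key y)) -(odd_double_half (key z)) eq_odd eq_half.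
case/and3P => /eqP own_y _ /exists_inP [k k_reached /eqP eq_k].
by move: k_reached; rewrite inE own_y eq_k.
Qed.

Lemma sum_fresh : \sum_w #|fresh w| <= 2 * (n * threshold t).
Proof.
pose edge w u : nat := (u \in U w) && poor_node w.
have sum_edge : \sum_w \sum_u edge w u <= n * threshold t.
  rewrite -[n in n * _]card_ord -sum_nat_const; apply: leq_sum => w _; rewrite /edge.
  case poor_w: (poor_node w); last by rewrite big1 // => u _; rewrite andbF.
  apply: leq_trans (poor_node_leq poor_w); rewrite -sum1_card [X in _ <= X]big_mkcond.
  by apply: leq_sum => u _; rewrite andbT; case: (u \in U w).
apply: (@leq_trans (\sum_w \sum_u edge w u + \sum_w \sum_u edge u w)).
  rewrite -big_split /=; apply: leq_sum => w _; rewrite -big_split /= -sum1_card big_mkcond.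
  apply: leq_sum => u _; rewrite inE /edge (U_sym w u).
  by case: (u \in U w) => //; case: (poor_node w); case: (poor_node u).
by rewrite [X in _ + X]exchange_big /= mul2n -addnn leq_add.
Qed.

Lemma root_keys_reached w : root_keys n t #|U w| = reached L w.
Proof.
apply/setP => k; rewrite !inE andbC -/(poor_node w); case poor_w: (poor_node w) => //=.
have /card_gt0P [u uU] : 0 < #|U w| by case/andP: poor_w.
apply/idP/exists_inP => [/eqP ->|[u' _ /eqP <-]]; last by rewrite ord_div_exp.
by exists u => //; rewrite ord_div_exp.
Qed.

Lemma reached0 w k : (k \in reached 0 w) = poor_node w && (k \in U w).
Proof.
rewrite inE; case: (poor_node w) => //=; apply/exists_inP/idP => [[u uU]|kU].
  by rewrite divn1 => /eqP /val_inj <-.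
by exists k => //; rewrite divn1.
Qed.

Lemma inserted_disjoint v : [disjoint inserted v & U v].
Proof. by apply/pred0P => u; rewrite /= inE; case: (u \in U v); rewrite ?andbF. Qed.

Lemma trie_count_nbrs y : trie_count nbrs y = trie_count inserted y + trie_count U y.
Proof.
rewrite -(trie_countU _ inserted_disjoint); apply: eq_trie_count => v.
by apply/setP => u; rewrite !inE; have := subsetP (U_sub v) u; case: (u \in U v) => [->|_];
  rewrite ?orbF.
Qed.

Lemma fresh_sub v : fresh v \subset U v.
Proof. by apply/subsetP => u; rewrite inE => /andP []. Qed.

Lemma trie_count_not_remaining y :
  trie_count (fun v => nbrs v :\: remaining v) y = trie_count inserted y + trie_count fresh y.
Proof.
rewrite -trie_countU => [|v]; last first.
  exact: disjointWr (fresh_sub v) (inserted_disjoint v).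
apply: eq_trie_count => v; apply/setP => u; rewrite !inE.
have := subsetP (U_sub v) u; case: (u \in U v) => [->|_] //=; last by rewrite ?andbF ?orbF.
by rewrite !andbT negbK.
Qed.

Lemma threshold_ltn : threshold t < L * insert_length.
Proof. by rewrite /insert_length mulnC; apply: ltn_ceil. Qed.

Lemma real_send_insert keys c w : 2 * L <= c ->
  real_send w (insert_state keys c w) = insert_send w (insert_state keys c w).
Proof. by move=> le_c; rewrite /real_send /= ltnNge le_c t_inserting. Qed.

Lemma real_recv_insert keys c w inb : 2 * L <= c ->
  real_recv w (insert_state keys c w) inb = insert_recv w (insert_state keys c w) inb.
Proof. by move=> le_c; rewrite /real_recv /= ltnNge le_c t_inserting. Qed.

Lemma real_recv_tick keys c w inb : 2 * L <= c -> c - 2 * L != 3 * L + 1 ->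
    ~~ ((c - 2 * L < 2 * L) && odd (c - 2 * L)) ->
  real_recv w (insert_state keys c w) inb = insert_state keys c.+1 w.
Proof.
move=> le_c neq_c even_c; rewrite real_recv_insert // /insert_recv /=.
by rewrite (negbTE neq_c) (negbTE even_c).
Qed.

Lemma insert_feasible keys c cnt act :
    2 * L <= c -> (forall y m, act y = Some m -> small_msg n m) ->
    (forall w, #|[set y | isSome (insert_send w (insert_state keys c w) (inr y))]|
       <= 2 * threshold t) ->
    (forall w, #|[set y | isSome (tree_send y (cnt y, act y) (inl w))]| <= 2 * threshold t) ->
    #|[set y | isSome (act y)]| <= 2 * (n * threshold t) ->
  conf_feasible N l c insert_length (insert_state keys c) cnt act.
Proof.
move=> le_c small_act out_le in_le tree_le; have lt_t := threshold_ltn.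
have le_t : 4 * threshold t <= l * insert_length by nia.
split=> //.
- by move=> w; rewrite /real_extra /= ltnNge le_c /body_extra t_inserting.
- by move=> w; rewrite real_send_insert //; apply: leq_trans (out_le w) _; lia.
- by move=> w; apply: leq_trans (in_le w) _; lia.
- apply: leq_trans (_ : n * (4 * threshold t) <= _); first by lia.
  by rewrite [l * _]mulnCA leq_mul2l le_t orbT.
Qed.

Lemma no_msg_feasible keys c cnt : 2 * L <= c ->
    (forall w, #|[set y | isSome (insert_send w (insert_state keys c w) (inr y))]|
       <= 2 * threshold t) ->
  conf_feasible N l c insert_length (insert_state keys c) cnt no_msg.
Proof.
move=> le_c out_le; apply: insert_feasible => //.
  by move=> w; rewrite eq_card0 // => y; rewrite !inE.
by rewrite eq_card0 // => y; rewrite !inE.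
Qed.

Lemma small_count (A : 'I_n -> {set 'I_n}) (mk : nat -> msg) y :
  (forall a, payload (mk a) = (a, 0, 0)) -> small_msg n (mk (trie_count A y)).
Proof. by move=> mkE; rewrite /small_msg mkE /=; have := trie_count_leq A y; nia. Qed.

Section Search.

Variable j : nat.
Hypothesis lt_j : j < L.
Notation h := (L - j.+1).
Notation query_clock := (2 * L + 2 * j).

Lemma query_send w y : insert_send w (insert_state (reached (L - j)) query_clock w) (inr y) =
  if (own y == w) && asked h y then Some Query else None.
Proof.
rewrite /insert_send /= addKn oddM mul2n doubleK /=.
have [-> ->] : (j.*2 < 2 * L) = true /\ L - j = h.+1 by lia.
by rewrite /asked; case: eqP => [->|].
Qed.

Lemma query_step :
  reaches 1 insert_length
    (conf (insert_state (reached (L - j)) query_clock) (trie_count inserted) no_msg)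
    (conf (insert_state (reached (L - j)) query_clock.+1) (trie_count inserted) (reply_msg h)).
Proof.
have le_c : 2 * L <= query_clock by lia.
apply: (reaches_vstep (c := query_clock)) => // [|w|y].
- apply: no_msg_feasible => // w; apply: leq_trans (card_asked h w).
  by apply: subset_leq_card; apply/subsetP => y; rewrite !inE query_send; case: ifP.
- by rewrite real_recv_tick // addKn ?oddM ?andbF //; lia.
have received x : delivery (insert_state (reached (L - j)) query_clock) (trie_count inserted)
    no_msg (inr y) x =
  if x is inl w then if (own y == w) && asked h y then Some Query else None else None.
  by case: x => [w|z]; rewrite ?delivery_tree // delivery_real real_send_insert // query_send.
rewrite (tree_recv_kind (m := Query)) => [|x m]; last first.
  by rewrite received; case: x => // w; case: ifP => // _ [<-].
rewrite (exists_real_sender (P := fun w => (own y == w) && asked h y)) => [|x]; last first.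
  by rewrite received; case: x => // w; case: ifP.
have -> : [exists w, (own y == w) && asked h y] = asked h y.
  apply/existsP/idP => [[w /andP [] //]|asked_y].
  by exists (own y); rewrite eqxx.
by rewrite /reply_msg; case: ifP.
Qed.

Notation reply_delivery :=
  (delivery (insert_state (reached (L - j)) query_clock.+1) (trie_count inserted) (reply_msg h)).

Lemma reply_send w y :
  insert_send w (insert_state (reached (L - j)) query_clock.+1 w) (inr y) = None.
Proof.
rewrite /insert_send /= subSn ?leq_addr // addKn /= oddM /=.
by have -> : (2 * j).+1 < 2 * L by lia.
Qed.

Lemma tree_send_reply y c x : tree_send y (c, reply_msg h y) x =
  if (x == inl (own y)) && asked h y then Some (Reply (trie_count inserted y)) else None.
Proof. by rewrite /tree_send /= /reply_msg; case: asked; rewrite ?andbT ?andbF. Qed.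

Lemma reply_keys w :
  [set k : 'I_n | if reply_delivery (inl w) (inr (w, inord h, k)) is Some (Reply a)
                  then a < count_nbrs (nbrs w) h k else false] = reached h w.
Proof.
have le_h : h <= L by lia.
apply/setP => k; rewrite !inE delivery_tree tree_send_reply eqxx /=.
set y : tnode n := (w, inord h, k); have ht_y : ht y = h by rewrite ht_tnode.
have has_missing : (trie_count inserted y < count_nbrs (nbrs w) h k)
    = [exists u in U w, u %/ 2 ^ h == k].
  rewrite -[count_nbrs _ _ _]/(#|[set u in nbrs (own y) | u %/ 2 ^ h == key y]|) -ht_y.
  rewrite -/(below nbrs y) -/(trie_count nbrs y) trie_count_nbrs -[X in X < _]addn0 ltn_add2l.
  by rewrite trie_count_gt0 ht_y; apply: eq_existsb => u; rewrite inE ht_y.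
case poor_w: (poor_node w) => /=; last first.
  by rewrite ifF // /asked; apply/negbTE/andP => -[_ /exists_inP [k']]; rewrite inE poor_w.
case: ifP => [_|/negbT]; first exact: has_missing.
rewrite /asked ht_y eqxx /= => /exists_inPn not_reached.
apply/esym/negbTE/exists_inPn => u uU; apply/eqP => key_u.
suff /not_reached : Ordinal (div_ord_lt u h.+1) \in reached h.+1 w.
  by rewrite /= divn_expS key_u eqxx.
by rewrite inE poor_w; apply/exists_inP; exists u.
Qed.

Lemma reply_step :
  reaches 1 insert_length
    (conf (insert_state (reached (L - j)) query_clock.+1) (trie_count inserted) (reply_msg h))
    (conf (insert_state (reached h) (2 * L + 2 * j.+1)) (trie_count inserted) no_msg).
Proof.
have le_c : 2 * L <= query_clock.+1 by lia.
apply: (reaches_vstep (c := query_clock.+1)) => // [|w|y].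
- apply: insert_feasible => // [y m|w|w|].
  + by rewrite /reply_msg; case: ifP => // _ [<-]; apply: small_count.
  + by rewrite eq_card0 // => y; rewrite !inE reply_send.
  + apply: leq_trans (card_asked h w); apply: subset_leq_card; apply/subsetP => y.
    by rewrite !inE tree_send_reply; case: ifP => // /andP [/eqP [->] ->]; rewrite eqxx.
  + rewrite mulnCA; apply: card_owners => w; apply: leq_trans (card_asked h w).
    by apply: subset_leq_card; apply/subsetP => y; rewrite !inE /reply_msg; case: asked.
- rewrite real_recv_insert // /insert_recv /=.
  have -> : query_clock.+1 - 2 * L = (2 * j).+1 by lia.
  have [-> ->] : ((2 * j).+1 == 3 * L + 1) = false /\ (2 * j).+1 < 2 * L by lia.
  rewrite /= oddM /= [X in uphalf X]mul2n uphalf_double reply_keys /insert_state.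
  by congr RState; lia.
apply: tree_recv_none => -[w|z]; first by rewrite delivery_real real_send_insert // reply_send.
by rewrite delivery_tree tree_send_reply.
Qed.

End Search.

Lemma search :
  reaches (2 * L) (2 * L * insert_length)
    (conf (insert_state (reached L) (2 * L)) (trie_count inserted) no_msg)
    (conf (insert_state (reached 0) (4 * L)) (trie_count inserted) no_msg).
Proof.
have both j (lt_j : j < L) := reaches_trans (query_step lt_j) (reply_step lt_j).
have steps := reaches_iter (C := fun j =>
  conf (insert_state (reached (L - j)) (2 * L + 2 * j)) (trie_count inserted) no_msg) both.
rewrite /= subn0 subnn muln0 addn0 in steps.
have -> : 4 * L = 2 * L + 2 * L by lia.
have -> : 2 * L * insert_length = L * (insert_length + insert_length) by lia.
by rewrite [X in reaches X]mulnC.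
Qed.

Lemma leaf_send w y : insert_send w (insert_state (reached 0) (4 * L) w) (inr y) =
  if (ht y == 0) && ((own y == w) && (key y \in reached 0 w)
                     || (key y == w) && (own y \in reached 0 w)) then Some Insert else None.
Proof.
have eq_c : 4 * L - 2 * L = 2 * L by lia.
by rewrite /insert_send /= eq_c ltnn eqxx.
Qed.

Lemma card_leaf_sends w :
  #|[set y | isSome (insert_send w (insert_state (reached 0) (4 * L) w) (inr y))]|
    <= 2 * threshold t.
Proof.
pose own_leaves := [set y | [&& ht y == 0, own y == w & key y \in reached 0 w]].
pose mirror_leaves := [set y | [&& ht y == 0, key y == w & own y \in reached 0 w]].
apply: (@leq_trans #|own_leaves :|: mirror_leaves|).
  apply: subset_leq_card; apply/subsetP => y; rewrite !(inE, leaf_send).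
  by case: (ht y == 0) => //=; case: ifP.
apply: leq_trans (leq_card_setU _ _) _; rewrite mul2n -addnn.
apply: leq_add; apply: leq_trans (card_reached 0 w).
  apply: (leq_card_inj (f := @key n)) => [y z|y]; rewrite [in X in X -> _]inE => /and3P [] //.
  move=> /eqP ht_y /eqP own_y _; rewrite inE => /and3P [/eqP ht_z /eqP own_z _].
  by apply: tnode_eq; rewrite ?ht_y ?own_y.
apply: (leq_card_inj (f := @own n)) => [y z|y]; rewrite [in X in X -> _]inE => /and3P [] //.
move=> /eqP ht_y /eqP key_y _; rewrite inE => /and3P [/eqP ht_z /eqP key_z _] eq_own.
by apply: tnode_eq; rewrite ?ht_y ?key_y.
Qed.

Lemma exists_leaf_send y :
  [exists w, isSome (insert_send w (insert_state (reached 0) (4 * L) w) (inr y))]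
    = (ht y == 0) && (key y \in fresh (own y)).
Proof.
rewrite inE; apply/existsP/andP => [[w]|[leaf_y /andP [kU poor_y]]].
  rewrite leaf_send; case: ifP => // /andP [-> /orP [] /andP [/eqP <-]];
    rewrite reached0 => /andP [-> in_U] _; first by rewrite in_U.
  by rewrite U_sym in_U orbT.
case/orP: poor_y => poor_y; [exists (own y)|exists (key y)]; rewrite leaf_send leaf_y eqxx.
  by have -> : key y \in reached 0 (own y) by rewrite reached0 poor_y.
have -> : own y \in reached 0 (key y) by rewrite reached0 poor_y U_sym.
by rewrite orbT.
Qed.

Lemma insert_step :
  reaches 1 insert_length
    (conf (insert_state (reached 0) (4 * L)) (trie_count inserted) no_msg)
    (conf (insert_state (reached 0) (4 * L + 1)) (count_upto 0) (fresh_msg 0)).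
Proof.
have L_gt0 := logc_gt0 n; have le_c : 2 * L <= 4 * L by lia.
have eq_c : 4 * L - 2 * L = 2 * L by lia.
apply: (reaches_vstep (c := 4 * L)) => // [|w|y].
- by apply: no_msg_feasible => //; apply: card_leaf_sends.
- by rewrite addn1 real_recv_tick ?eq_c ?ltnn //; lia.
have received x : delivery (insert_state (reached 0) (4 * L)) (trie_count inserted)
    no_msg (inr y) x =
  if x is inl w then insert_send w (insert_state (reached 0) (4 * L) w) (inr y) else None.
  by case: x => [w|z]; rewrite ?delivery_tree // delivery_real real_send_insert.
rewrite (tree_recv_kind (m := Insert)) => [|x m]; last first.
  by rewrite received; case: x => // w; rewrite leaf_send; case: ifP => // _ [<-].
rewrite (exists_real_sender (P := fun w =>
    isSome (insert_send w (insert_state (reached 0) (4 * L) w) (inr y)))) => [|x]; last first.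
  by rewrite received; case: x.
rewrite exists_leaf_send /fresh_msg /level_msg /count_upto leqn0.
case: (eqVneq (ht y) 0) => [leaf_y|_] /=; last by rewrite addn0.
by rewrite (trie_count_leaf fresh leaf_y); case: (key y \in fresh _); rewrite ?addn1 ?addn0.
Qed.

Lemma late_silent keys c w x : 4 * L < c -> real_send w (insert_state keys c w) x = None.
Proof.
move=> lt_c; rewrite real_send_insert; last by lia.
rewrite /insert_send /=; case: x => // y.
by have [-> ->] : (c - 2 * L < 2 * L) = false /\ (c - 2 * L == 2 * L) = false by lia.
Qed.

Lemma count_feasible c cnt h : 4 * L < c -> h <= L ->
  conf_feasible N l c insert_length (insert_state (reached 0) c) cnt (fresh_msg h).
Proof.
move=> lt_c le_h; apply: insert_feasible => [|y m|w|w|]; first by lia.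
- by rewrite /fresh_msg /level_msg; case: ifP => // _ [<-]; apply: small_count.
- by rewrite eq_card0 // => y; rewrite !inE -real_send_insert ?late_silent //; lia.
- apply: (@leq_trans 1); first exact: card_level_roots.
  by rewrite muln_gt0 /threshold addn_gt0 orbT.
- exact: leq_trans (card_level_msg _ _ le_h) sum_fresh.
Qed.

Lemma count_step h : h < L ->
  reaches 1 insert_length
    (conf (insert_state (reached 0) (4 * L + 1 + h)) (count_upto h) (fresh_msg h))
    (conf (insert_state (reached 0) (4 * L + 1 + h.+1)) (count_upto h.+1) (fresh_msg h.+1)).
Proof.
move=> lt_h; have lt_c : 4 * L < 4 * L + 1 + h by lia.
have silent w y : real_send w (insert_state (reached 0) (4 * L + 1 + h) w) (inr y) = None.
  exact: late_silent.
apply: (reaches_vstep (c := 4 * L + 1 + h)) => // [|w|y].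
- exact: count_feasible lt_c (ltnW lt_h).
- by rewrite [_ + h.+1]addnS real_recv_tick //; lia.
have upward_count z : upward (CountUp (trie_count fresh z)) by [].
rewrite (tree_recv_kind (m := CountUp 0)) => [|x m sent_x]; last first.
  by have [z [_ _ _ ->]] := delivery_level_Some upward_count silent sent_x.
rewrite exists_delivery_level //= sum_delivery_counts //.
rewrite /fresh_msg /level_msg /count_upto [ht y <= h.+1]leq_eqVlt ltnS.
case: (eqVneq (ht y) h.+1) => [-> /=|_ //]; rewrite ltnn addn0.
by case: ifP => //; rewrite lt0n => /negbFE /eqP ->; rewrite addn0.
Qed.

Lemma insert_finish :
  reaches 1 insert_length
    (conf (insert_state (reached 0) (4 * L + 1 + L)) (count_upto L) (fresh_msg L))
    (conf (fun w => phase_start (nbrs w) #|remaining w| d (label w))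
       (trie_count (fun v => nbrs v :\: remaining v)) no_msg).
Proof.
have lt_c : 4 * L < 4 * L + 1 + L by lia.
have silent w y : real_send w (insert_state (reached 0) (4 * L + 1 + L) w) (inr y) = None.
  exact: late_silent.
apply: (reaches_vstep (c := 4 * L + 1 + L)) => // [|w|y]; first exact: count_feasible.
  rewrite real_recv_insert /insert_recv /=; last by lia.
  have -> : 4 * L + 1 + L - 2 * L == 3 * L + 1 by lia.
  congr phase_start; rewrite /remaining cardsD (setIidPr (fresh_sub w)); congr (_ - _).
  rewrite big_sumType /= [X in X + _]big1 ?add0n; last first.
    by move=> w' _; rewrite delivery_real late_silent.
  rewrite -(sum_level fresh w (leqnn L)) [RHS]big_mkcond; apply: eq_bigr => y _.
  rewrite delivery_root //; case: (own y == w); case: (ht y == L) => //=.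
  by case: ifP => //; rewrite lt0n => /negbFE /eqP ->.
rewrite tree_recv_none => [|x]; last exact: delivery_above_root.
by rewrite /= /count_upto ht_leq trie_count_not_remaining.
Qed.

Lemma insertion_body :
  reaches (3 * L + 2) ((3 * L + 2) * insert_length)
    (conf (fun w => RState (nbrs w) #|U w| (root_keys n t #|U w|) t (2 * L) d (label w))
       (trie_count inserted) no_msg)
    (conf (fun w => phase_start (nbrs w) #|remaining w| d (label w))
       (trie_count (fun v => nbrs v :\: remaining v)) no_msg).
Proof.
have count := reaches_iter (C := fun h =>
  conf (insert_state (reached 0) (4 * L + 1 + h)) (count_upto h) (fresh_msg h)) count_step.
rewrite addn0 in count.
have := reaches_trans search (reaches_trans insert_step (reaches_trans count insert_finish)).
have -> : 2 * L + (1 + (L * 1 + 1)) = 3 * L + 2 by lia.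
apply: reaches_weaken => [|Y|//]; first by lia.
by apply: conf_eq => // w; rewrite root_keys_reached.
Qed.

End Insertion.

(** * Advancing the BFS by one layer *)

Section BfsLayer.

Variables (n N l : nat) (answer : 'I_n -> nat * option 'I_n).
Notation L := (logc n).
Implicit Types y z : tnode n.
Variables (nbrs : 'I_n -> {set 'I_n}) (missing : 'I_n -> nat) (keys : 'I_n -> {set 'I_n})
  (d : nat) (label : 'I_n -> option (nat * option 'I_n)) (t : nat * nat * nat).
Hypothesis n_gt0 : 0 < n.
Hypothesis l_ge : 4 * L <= l.
Hypothesis nbrs_sym : forall u v, (u \in nbrs v) = (v \in nbrs u).
Hypothesis nbrs_irr : forall v, v \notin nbrs v.
Hypothesis t_bfs : inserting t = false.
Hypothesis t_small : small_msg n (Sums t).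
Hypothesis label_consistent : forall w, consistent_label answer w (label w).

Definition frontier (v : 'I_n) : bool := in_layer d (label v).
Definition layer_out (v : 'I_n) : {set 'I_n} := [set u in nbrs v | frontier v].
Definition layer_in (v : 'I_n) : {set 'I_n} := [set u in nbrs v | frontier u].

Definition bfs_length : nat := (t.2 %/ (n * L)).+1.

Hypothesis degree_out : t.2 = \sum_w #|layer_out w|.
Hypothesis length_leq : bfs_length <= N.

Definition wake_msg (h : nat) : tnode n -> option msg := level_msg h layer_out (fun=> WakeUp).

Definition min_msg (h : nat) : tnode n -> option msg :=
  level_msg h layer_in (fun y => MinUp (lowest (below layer_in y))).

Definition bfs_state (c : nat) (w : 'I_n) : rstate n :=
  RState (nbrs w) (missing w) (keys w) t c d (label w).

Definition next_label (w : 'I_n) : option (nat * option 'I_n) :=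
  if label w is Some _ then label w
  else if layer_in w == set0 then None else Some (d.+1, insub (lowest (layer_in w))).

Notation bconf c act := (conf (bfs_state c) (trie_count nbrs) act).
Notation reaches := (reaches (P := trie_protocol n) allowed_link N l answer).

Lemma sum_layer_in : \sum_w #|layer_in w| = \sum_w #|layer_out w|.
Proof.
have sum_edges (R : rel 'I_n) : \sum_w #|[set u in nbrs w | R w u]| =
    \sum_w \sum_u ((u \in nbrs w) && R w u : nat).
  apply: eq_bigr => w _; rewrite -sum1_card big_mkcond; apply: eq_bigr => u _.
  by rewrite inE; case: (_ && _).
rewrite (sum_edges (fun _ u => frontier u)) (sum_edges (fun w _ => frontier w)) exchange_big /=.
by apply: eq_bigr => w _; apply: eq_bigr => u _; rewrite nbrs_sym.
Qed.

Lemma trie_count_layer_out y :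
  (0 < trie_count layer_out y) = frontier (own y) && (0 < trie_count nbrs y).
Proof.
rewrite !trie_count_gt0; case front_y: (frontier (own y)) => /=.
  by apply: eq_existsb => u; rewrite !inE front_y andbT.
by apply/existsP => -[u]; rewrite !inE front_y andbF.
Qed.

Lemma real_send_bfs c w x : 2 * L <= c ->
  real_send w (bfs_state c w) x = bfs_send w (bfs_state c w) x.
Proof. by move=> le_c; rewrite /real_send /= ltnNge le_c t_bfs. Qed.

Lemma real_recv_bfs c w inb : 2 * L <= c -> c != 4 * L + 2 ->
  real_recv w (bfs_state c w) inb = bfs_state c.+1 w.
Proof.
by move=> le_c neq_c; rewrite /real_recv /= ltnNge le_c t_bfs /bfs_recv /= (negbTE neq_c).
Qed.

Lemma bfs_silent c w x : 2 * L < c -> real_send w (bfs_state c w) x = None.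
Proof.
move=> lt_c; rewrite real_send_bfs ?(ltnW lt_c) // /bfs_send /= gtn_eqF //.
by case: x.
Qed.

Lemma bfs_feasible c act : 2 * L <= c -> (forall y m, act y = Some m -> small_msg n m) ->
    (forall w, #|[set y | isSome (real_send w (bfs_state c w) (inr y))]| <= 1) ->
    (forall w, #|[set y | isSome (tree_send y (trie_count nbrs y, act y) (inl w))]| <= 1) ->
    #|[set y | isSome (act y)]| <= t.2 ->
  conf_feasible N l c bfs_length (bfs_state c) (trie_count nbrs) act.
Proof.
move=> le_c small_act out_le in_le tree_le; have L_gt0 := logc_gt0 n.
have one_leq : 1 <= l * bfs_length by rewrite muln_gt0 andbT; lia.
split=> //.
- by move=> w; rewrite /real_extra /= ltnNge le_c /body_extra t_bfs.
- by move=> w; apply: leq_trans (out_le w) one_leq.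
- by move=> w; apply: leq_trans (in_le w) one_leq.
have lt_t : t.2 < n * L * bfs_length by rewrite mulnC; apply: ltn_ceil; rewrite muln_gt0 n_gt0.
apply: (@leq_trans (4 * L * (n * bfs_length))); last by rewrite leq_mul2r l_ge orbT.
by lia.
Qed.

Lemma tree_send_wake h y c x : tree_send y (c, wake_msg h y) x =
  if x is inr z then
    if isSome (wake_msg h y) then
      if child_of z y then Some WakeUp else if mirror y z then Some Cross else None
    else None
  else None.
Proof. by rewrite /tree_send /= /wake_msg /level_msg; case: ifP => //= _; case: x. Qed.

Lemma wake_feasible c h : 2 * L < c -> h <= L ->
  conf_feasible N l c bfs_length (bfs_state c) (trie_count nbrs) (wake_msg h).
Proof.
move=> lt_c le_h; apply: bfs_feasible => [|y m|w|w|]; first exact: ltnW.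
- by rewrite /wake_msg /level_msg; case: ifP => // _ [<-].
- by rewrite eq_card0 // => y; rewrite !inE bfs_silent.
- by rewrite eq_card0 // => y; rewrite !inE tree_send_wake.
- by rewrite degree_out; apply: card_level_msg.
Qed.

Lemma min_feasible c h : 2 * L < c -> h <= L ->
  conf_feasible N l c bfs_length (bfs_state c) (trie_count nbrs) (min_msg h).
Proof.
move=> lt_c le_h; apply: bfs_feasible => [|y m|w|w|]; first exact: ltnW.
- rewrite /min_msg /level_msg; case: ifP => // _ [<-]; rewrite /small_msg /= andbT.
  by have := lowest_leq (below layer_in y); nia.
- by rewrite eq_card0 // => y; rewrite !inE bfs_silent.
- exact: card_level_roots.
- by rewrite degree_out -sum_layer_in; apply: card_level_msg.
Qed.

Lemma root_wake_step :
  reaches 1 bfs_length (bconf (2 * L) no_msg) (bconf (2 * L + 1) (wake_msg L)).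
Proof.
have sends w y : real_send w (bfs_state (2 * L) w) (inr y) =
    if [&& frontier w, own y == w, ht y == L & key y == 0 :> nat] then Some WakeUp else None.
  by rewrite real_send_bfs // /bfs_send /= eqxx.
apply: (reaches_vstep (c := 2 * L)) => // [|w|y].
- apply: bfs_feasible => // [w|w|]; last by rewrite eq_card0 // => y; rewrite !inE.
    apply/card_le1_eqP => y z; rewrite !inE !sends.
    case: ifP => // /and4P [_ /eqP own_y /eqP ht_y /eqP key_y] _.
    case: ifP => // /and4P [_ /eqP own_z /eqP ht_z /eqP key_z] _.
    by apply: tnode_eq; rewrite ?own_y ?ht_y //; apply: val_inj; rewrite /= key_y.
  by rewrite eq_card0 // => y; rewrite !inE.
- by rewrite real_recv_bfs ?addn1 //; lia.
have received x : delivery (bfs_state (2 * L)) (trie_count nbrs) no_msg (inr y) x =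
  if x is inl w then
    if [&& frontier w, own y == w, ht y == L & key y == 0 :> nat] then Some WakeUp else None
  else None.
  by case: x => [w|z]; rewrite ?delivery_tree // delivery_real sends.
rewrite (tree_recv_kind (m := WakeUp)) => [|x m]; last first.
  by rewrite received; case: x => // w; case: ifP => // _ [<-].
rewrite (exists_real_sender (P := fun w =>
    [&& frontier w, own y == w, ht y == L & key y == 0 :> nat])) => [|x]; last first.
  by rewrite received; case: x => // w; case: ifP.
have -> : [exists w, [&& frontier w, own y == w, ht y == L & key y == 0 :> nat]] =
    [&& frontier (own y), ht y == L & key y == 0 :> nat].
  apply/existsP/idP => [[w /and4P [front_w /eqP -> -> ->]]|root_y]; first by rewrite front_w.
  by exists (own y); rewrite eqxx.
rewrite /wake_msg /level_msg trie_count_layer_out /=.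
case: (frontier (own y)) => //=; last by rewrite andbF.
case: (eqVneq (ht y) L) => //= ht_y.
case cnt_y: (0 < trie_count nbrs y); last by rewrite if_same.
by rewrite (root_key ht_y cnt_y).
Qed.

Lemma exists_waking_parent h y : 0 < trie_count nbrs y -> h < L ->
  [exists z, isSome (wake_msg h.+1 z) && child_of y z] = (ht y == h) && frontier (own y).
Proof.
move=> cnt_y lt_h; apply/existsP/andP => [[z /andP []]|[/eqP ht_y front_y]].
  rewrite level_msg_isSome trie_count_layer_out => /andP [/eqP ht_z /andP [front_z _]].
  move=> /child_ofP [own_z ht_zy _]; rewrite -own_z front_z; split=> //.
  by rewrite -eqSS -ht_zy ht_z.
have lt_half : (key y)./2 < n by have := ltn_ord (key y); lia.
pose z : tnode n := (own y, inord h.+1, Ordinal lt_half).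
have ht_z : ht z = h.+1 by rewrite ht_tnode.
have yz : child_of y z by apply/child_ofP; rewrite ht_z ht_y.
exists z; rewrite yz andbT level_msg_isSome ht_z eqxx trie_count_layer_out front_y /=.
move: cnt_y; rewrite !trie_count_gt0 => /existsP [u u_y].
by apply/existsP; exists u; apply: (subsetP (below_parent nbrs yz)).
Qed.

Lemma wake_step j : j < L -> reaches 1 bfs_length
  (bconf (2 * L + 1 + j) (wake_msg (L - j))) (bconf (2 * L + 1 + j.+1) (wake_msg (L - j.+1))).
Proof.
move=> lt_j; have lt_c : 2 * L < 2 * L + 1 + j by lia.
have [eq_h lt_h] : L - j = (L - j.+1).+1 /\ L - j.+1 < L by lia.
set h := L - j.+1 in eq_h lt_h *; rewrite eq_h.
apply: (reaches_vstep (c := 2 * L + 1 + j)) => // [|w|y].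
- exact: wake_feasible.
- by rewrite real_recv_bfs ?[_ + j.+1]addnS //; lia.
have received x : delivery (bfs_state (2 * L + 1 + j)) (trie_count nbrs) (wake_msg h.+1)
    (inr y) x =
  if x is inr z then if isSome (wake_msg h.+1 z) && child_of y z then Some WakeUp else None
  else None.
  case: x => [w|z]; first by rewrite delivery_real bfs_silent.
  rewrite delivery_tree tree_send_wake level_msg_isSome; case: eqP => //= ht_z.
  case: ifP => //= _; case: ifP => // _; case: ifP => // /mirrorP [ht_z0 _ _ _ _].
  by rewrite ht_z0 in ht_z.
rewrite (tree_recv_kind (m := WakeUp)) => [|x m]; last first.
  by rewrite received; case: x => // z; case: ifP => // _ [<-].
rewrite (exists_tree_sender (P := fun z => isSome (wake_msg h.+1 z) && child_of y z)) => [|x];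
  last by rewrite received; case: x => // z; case: ifP.
rewrite /= {2}/wake_msg /level_msg trie_count_layer_out.
case: (boolP (0 < trie_count nbrs y)) => cnt_y; last by rewrite !andbF if_same.
by rewrite exists_waking_parent // andbT; case: ifP.
Qed.

Lemma exists_crossing y : [exists z, isSome (wake_msg 0 z) && mirror z y] =
  (ht y == 0) && (0 < trie_count layer_in y).
Proof.
apply/existsP/andP => [[z /andP []]|[/eqP ht_y]].
  rewrite level_msg_isSome => /andP [_ + zy]; case/mirrorP: zy => ht_z ht_y own_y key_y _.
  rewrite ht_y !trie_count_leaf // !inE own_y key_y nbrs_sym.
  by case: (_ && _).
rewrite trie_count_leaf // inE; case: andP => // -[key_nbr front_key] _.
exists (key y, ord0, own y); rewrite level_msg_isSome trie_count_leaf // inE.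
rewrite [key _ \in _]nbrs_sym key_nbr front_key /=; apply/mirrorP; split=> // eq_key.
by have := nbrs_irr (own y); rewrite -[X in X \in _]eq_key key_nbr.
Qed.

Lemma cross_step :
  reaches 1 bfs_length (bconf (2 * L + 1 + L) (wake_msg 0)) (bconf (3 * L + 2) (min_msg 0)).
Proof.
have lt_c : 2 * L < 2 * L + 1 + L by lia.
apply: (reaches_vstep (c := 2 * L + 1 + L)) => // [|w|y].
- exact: wake_feasible.
- by rewrite real_recv_bfs; [congr bfs_state | |]; lia.
have received x : delivery (bfs_state (2 * L + 1 + L)) (trie_count nbrs) (wake_msg 0)
    (inr y) x =
  if x is inr z then if isSome (wake_msg 0 z) && mirror z y then Some Cross else None else None.
  case: x => [w|z]; first by rewrite delivery_real bfs_silent.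
  rewrite delivery_tree tree_send_wake level_msg_isSome; case: eqP => //= ht_z.
  by case: ifP => //= _; case: ifP => // /child_of_ht; rewrite ht_z.
rewrite (tree_recv_kind (m := Cross)) => [|x m]; last first.
  by rewrite received; case: x => // z; case: ifP => // _ [<-].
rewrite (exists_tree_sender (P := fun z => isSome (wake_msg 0 z) && mirror z y)) => [|x];
  last by rewrite received; case: x => // z; case: ifP.
rewrite exists_crossing /min_msg /level_msg; case: (eqVneq (ht y) 0) => //= ht_y.
case: ifP => //; rewrite trie_count_gt0 => /existsP [u /lowestP [v v_y [-> _]]].
by move: v_y; rewrite inE ht_y divn1 => /andP [_ /eqP ->].
Qed.

Lemma min_step h : h < L ->
  reaches 1 bfs_length (bconf (3 * L + 2 + h) (min_msg h))
    (bconf (3 * L + 2 + h.+1) (min_msg h.+1)).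
Proof.
move=> lt_h; have lt_c : 2 * L < 3 * L + 2 + h by lia.
have silent w y : real_send w (bfs_state (3 * L + 2 + h) w) (inr y) = None by exact: bfs_silent.
have upward_min z : upward (MinUp (lowest (below layer_in z))) by [].
apply: (reaches_vstep (c := 3 * L + 2 + h)) => // [|w|y].
- exact: min_feasible lt_c (ltnW lt_h).
- by rewrite real_recv_bfs ?[_ + h.+1]addnS //; lia.
rewrite (tree_recv_kind (m := MinUp 0)) => [|x m sent_x]; last first.
  by have [z [_ _ _ ->]] := delivery_level_Some upward_min silent sent_x.
rewrite exists_delivery_level //= /min_msg [in RHS]/level_msg.
case: ifP => // /andP [/eqP ht_y cnt_y].
by rewrite (min_delivery _ silent ht_y cnt_y).
Qed.

Lemma min_received_eq (inb : {ffun vnode n (tnode n) -> option msg}) x k :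
    k < n -> inb x = Some (MinUp k) -> (forall x' j, inb x' = Some (MinUp j) -> j = k) ->
  min_received inb = k.
Proof.
move=> lt_k recv_k uniq_k; apply: least_eq => // [|j /existsP [x']].
  by apply/existsP; exists x; rewrite recv_k.
case recv_x': (inb x') => [m|] //; case: m recv_x' => // j' recv_x' /eqP <-.
by rewrite (uniq_k _ _ recv_x').
Qed.

Definition trie_root (w : 'I_n) : tnode n := (w, inord L, Ordinal n_gt0).

Lemma delivery_at_root w x :
  delivery (bfs_state (3 * L + 2 + L)) (trie_count nbrs) (min_msg L) (inl w) x =
    if (x == inr (trie_root w)) && (layer_in w != set0) then Some (MinUp (lowest (layer_in w)))
    else None.
Proof.
case: x => [w'|y]; first by rewrite delivery_real bfs_silent //; lia.
have ht_trie_root : ht (trie_root w) = L by rewrite ht_tnode.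
have below_rootE : below layer_in (trie_root w) = layer_in w by rewrite below_root.
rewrite delivery_root //; case: (eqVneq (inr y) _) => [[->]|neq_y] /=.
  by rewrite /own /= eqxx -/(ht _) ht_trie_root eqxx /trie_count below_rootE lt0n cards_eq0.
case: ifP => // /and3P [/eqP own_y /eqP ht_y cnt_y].
case/eqP: neq_y; congr inr; apply: tnode_eq; rewrite ?own_y ?ht_y ?ht_trie_root //.
by apply: val_inj; rewrite /= (root_key ht_y cnt_y).
Qed.

Lemma bfs_finish :
  reaches 1 bfs_length (bconf (3 * L + 2 + L) (min_msg L))
    (conf (fun w => phase_start (nbrs w) (missing w) d.+1 (next_label w))
       (trie_count nbrs) no_msg).
Proof.
have lt_c : 2 * L < 3 * L + 2 + L by lia.
apply: (reaches_vstep (c := 3 * L + 2 + L)) => // [|w|y]; first exact: min_feasible.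
  rewrite /real_recv /= ltnNge t_bfs (_ : 2 * L <= 3 * L + 2 + L) /bfs_recv /=; last by lia.
  have -> : 3 * L + 2 + L == 4 * L + 2 by lia.
  congr phase_start; rewrite /next_label; case: (label w) => //.
  have -> : [exists x, isSome (delivery (bfs_state (3 * L + 2 + L)) (trie_count nbrs)
      (min_msg L) (inl w) x)] = (layer_in w != set0).
    apply/existsP/idP => [[x]|nonempty].
      by rewrite delivery_at_root; case: ifP => // /andP [].
    by exists (inr (trie_root w)); rewrite delivery_at_root eqxx nonempty.
  case: eqP => //= /eqP nonempty; congr (Some (_, insub _)).
  have lowest_lt : lowest (layer_in w) < n.
    by have [u0 /lowestP [u _ [-> _]]] := set0Pn _ nonempty.
  apply: (min_received_eq (x := inr (trie_root w)) lowest_lt).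
    by rewrite delivery_at_root eqxx nonempty.
  by move=> x j; rewrite delivery_at_root; case: ifP => // _ [].
rewrite tree_recv_none // => x; apply: delivery_above_root => // w z.
exact: bfs_silent.
Qed.

Lemma bfs_body :
  reaches (2 * L + 3) ((2 * L + 3) * bfs_length) (bconf (2 * L) no_msg)
    (conf (fun w => phase_start (nbrs w) (missing w) d.+1 (next_label w))
       (trie_count nbrs) no_msg).
Proof.
have wake := reaches_iter (C := fun j => bconf (2 * L + 1 + j) (wake_msg (L - j))) wake_step.
have collect := reaches_iter (C := fun h => bconf (3 * L + 2 + h) (min_msg h)) min_step.
rewrite /= subn0 subnn !addn0 in wake collect.
have := reaches_trans root_wake_step (reaches_trans wake (reaches_trans cross_step
  (reaches_trans collect bfs_finish))).
have -> : 1 + (L * 1 + (1 + (L * 1 + 1))) = 2 * L + 3 by lia.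
by apply: reaches_weaken => //; lia.
Qed.

End BfsLayer.

(** * Forests and arboricity *)

Section Forests.

Variables (n : nat) (F : rel 'I_n).
Hypotheses (F_sym : symmetric F) (F_irr : irreflexive F) (F_forest : forest F).

Definition deg_in (W : {set 'I_n}) (v : 'I_n) : nat := #|[set u in W | F v u]|.

Lemma forest_chordless x y p u :
  uniq (x :: y :: p) -> path F x (y :: p) -> u \in p -> ~~ F x u.
Proof.
move=> uniq_p path_p u_p; apply/negP => F_xu; case/splitPr: u_p uniq_p path_p => p1 p2.
rewrite -cat_rcons => uniq_p /= /andP [F_xy path_p].
have := F_forest (cyc := x :: y :: rcons p1 u).
rewrite /= !size_rcons ltnS => /(_ _ isT)/negP; apply.
  by move: uniq_p; rewrite -!cat_cons cat_uniq => /andP [+ _]; rewrite /= !inE !mem_rcons !inE.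
rewrite F_xy rcons_path; move: path_p; rewrite cat_path => /andP [-> _] /=.
by rewrite last_rcons F_sym.
Qed.

Lemma forest_path_extend (W : {set 'I_n}) x p : 1 < deg_in W x ->
    uniq (x :: p) -> path F x p ->
  exists u, [/\ u \in W, F x u & u \notin x :: p].
Proof.
move=> deg_x uniq_p path_p.
case: (pickP [pred u | [&& u \in W, F x u & u \notin x :: p]]) => [u /and3P|none].
  by exists u.
have on_p u : u \in W -> F x u -> u \in p.
  move=> uW F_xu; have := none u; rewrite /= uW F_xu /= => /negbFE.
  by rewrite inE => /orP [/eqP eq_u|//]; move: F_xu; rewrite eq_u F_irr.
case: p uniq_p path_p none on_p => [|y p] uniq_p path_p _ on_p.
  move: deg_x; rewrite /deg_in eq_card0 // => u; rewrite !inE.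
  by apply/negP => /andP [uW /(on_p _ uW)].
suff : deg_in W x <= 1 by rewrite leqNgt deg_x.
rewrite -(cards1 y); apply: subset_leq_card; apply/subsetP => u.
rewrite !inE => /andP [uW F_xu].
have := on_p u uW F_xu; rewrite inE => /orP [//|u_p].
by have := forest_chordless uniq_p path_p u_p; rewrite F_xu.
Qed.

Lemma forest_long_path (W : {set 'I_n}) x0 : x0 \in W -> {in W, forall v, 1 < deg_in W v} ->
  forall k, exists x p, [/\ size p = k, uniq (x :: p), path F x p & all (mem W) (x :: p)].
Proof.
move=> x0W deg2; elim=> [|k [x [p [size_p uniq_p path_p sub_W]]]].
  by exists x0, [::]; rewrite /= x0W.
have xW : x \in W by case/andP: sub_W.
have [u [uW F_xu new_u]] := forest_path_extend (deg2 x xW) uniq_p path_p.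
exists u, (x :: p); split; first by rewrite /= size_p.
- by rewrite cons_uniq new_u.
- by rewrite /= F_sym F_xu.
- by apply/andP.
Qed.

Lemma forest_leaf (W : {set 'I_n}) : W != set0 -> exists2 v, v \in W & deg_in W v <= 1.
Proof.
case/set0Pn => x0 x0W.
case: (pickP [pred v | (v \in W) && (deg_in W v <= 1)]) => [v /andP [vW deg_v]|none].
  by exists v.
have deg2 : {in W, forall v, 1 < deg_in W v}.
  by move=> v vW; have := none v; rewrite /= vW /= leqNgt => /negbFE.
have [x [p [size_p uniq_p _ _]]] := forest_long_path x0W deg2 n.
have := max_card (mem (x :: p)); rewrite (card_uniqP uniq_p) card_ord /= size_p.
by rewrite ltnn.
Qed.

Lemma sum_deg_in_leq (W : {set 'I_n}) : \sum_(v in W) deg_in W v <= 2 * #|W|.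
Proof.
have [m] := ubnP #|W|; elim: m W => // m IH W lt_m.
have [->|ne] := eqVneq W set0; first by rewrite big_set0.
have [v vW deg_v] := forest_leaf ne.
have cardW : #|W| = #|W :\ v|.+1 by rewrite (cardsD1 v W) vW.
have {}IH : \sum_(u in W :\ v) deg_in (W :\ v) u <= 2 * #|W :\ v| by apply: IH; lia.
have degE u : deg_in W u = F u v + deg_in (W :\ v) u.
  rewrite /deg_in (cardsD1 v) inE vW /=; congr (_ + _).
  by apply: eq_card => z; rewrite !inE andbA.
rewrite (big_setD1 v) //= (eq_bigr _ (fun u _ => degE u)).
have sum_nbr : \sum_(u in W :\ v) F u v = deg_in (W :\ v) v.
  rewrite /deg_in -sum1_card big_mkcond [RHS]big_mkcond; apply: eq_bigr => u _.
  by rewrite !inE F_sym; case: (u != v) => //=; case: (u \in W) => //=; case: F.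
rewrite big_split /= sum_nbr cardW; move: deg_v; rewrite degE F_irr add0n addnA mulnS => deg_v.
by apply: leq_add IH; rewrite -[2]/(1 + 1) leq_add.
Qed.

End Forests.

Lemma sub_forest n (F F' : rel 'I_n) : subrel F' F -> forest F -> forest F'.
Proof.
move=> sub_F forest_F cyc uniq_cyc size_cyc; apply: contra (forest_F cyc uniq_cyc size_cyc).
by case: cyc {uniq_cyc size_cyc} => //= x p; apply: sub_path.
Qed.

Lemma card_by_colour (T : finType) (S : {set T}) (col : T -> nat) k :
  {in S, forall x, col x < k} -> #|S| = \sum_(i < k) #|[set x in S | col x == i]|.
Proof.
move=> lt_k; under eq_bigr => i _ do rewrite -sum1_card.
rewrite -sum1_card (exchange_big_dep (mem S)) /= => [|i x _]; last by rewrite inE => /andP [].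
apply: eq_bigr => x xS; rewrite (big_pred1 (Ordinal (lt_k x xS))) // => i.
by rewrite /= inE xS eq_sym.
Qed.

Lemma arboricity_bound n (G : rel 'I_n) a (U : 'I_n -> {set 'I_n}) :
    symmetric G -> irreflexive G -> forest_partition G a ->
    (forall v, U v \subset neighbors G v) -> (forall u v, (u \in U v) = (v \in U u)) ->
  \sum_v #|U v| <= 2 * a * #|[set v | 0 < #|U v|]|.
Proof.
move=> symG irrG [col [colG forG]] U_sub U_sym; set W := [set v | _].
have UG v u : u \in U v -> G v u by move/(subsetP (U_sub v)); rewrite inE.
have UW v u : u \in U v -> u \in W.
  by rewrite U_sym inE => v_u; apply/card_gt0P; exists v.
pose F (i : nat) := [rel v u | (u \in U v) && (col v u == i)].
have F_forest i : forest (F i) by apply: sub_forest (forG i) => v u /= /andP [/UG -> ->].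
have F_sym i : symmetric (F i).
  move=> v u /=; rewrite U_sym; case: (boolP (v \in U u)) => //= v_u.
  by have [-> _] := colG u v (UG _ _ v_u).
have F_irr i : irreflexive (F i) by move=> v /=; apply/negP => /andP [/UG]; rewrite irrG.
have degE v : #|U v| = \sum_(i < a) deg_in (F i) W v.
  rewrite (@card_by_colour _ (U v) (col v) a) => [|u /UG /colG [] //].
  apply: eq_bigr => i _; apply: eq_card => u; rewrite !inE /=.
  by case u_v: (u \in U v); rewrite ?andbF //=; have := UW _ _ u_v; rewrite inE => ->.
rewrite (bigID (mem W)) /= [X in _ + X]big1 ?addn0 => [|v]; last first.
  by rewrite inE -eqn0Ngt => /eqP.
rewrite (eq_bigr _ (fun v _ => degE v)) exchange_big /=.
apply: (@leq_trans (\sum_(i < a) 2 * #|W|)); last first.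
  by rewrite sum_nat_const card_ord mulnCA mulnA.
by apply: leq_sum => i _; apply: sum_deg_in_leq.
Qed.

(** * Distances and shortest-path labels *)

Section Distances.

Variables (n : nat) (G : rel 'I_n) (s : 'I_n).
Hypothesis symG : symmetric G.

Lemma walk_rcons k (x u v : 'I_n) : walkb G k x u -> G u v -> walkb G k.+1 x v.
Proof.
elim: k x => [|k IH] x.
  by move=> /eqP -> G_uv; apply/existsP; exists v; rewrite G_uv /=.
case/existsP => w /andP [G_xw walk_w] G_uv; apply/existsP; exists w.
by rewrite G_xw; apply: IH.
Qed.

Lemma walk_last k (x v : 'I_n) : walkb G k.+1 x v -> exists2 u, walkb G k x u & G u v.
Proof.
elim: k x => [|k IH] x.
  by case/existsP => w /andP [G_xw /eqP <-]; exists x => //=.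
case/existsP => w /andP [G_xw /IH [u walk_u G_uv]]; exists u => //.
by apply/existsP; exists w; rewrite G_xw.
Qed.

Variable delta : 'I_n -> nat.
Hypothesis deltaP : forall v, is_distb G s v (delta v).

Lemma delta_walk v : walkb G (delta v) s v.
Proof. by case/andP: (deltaP v). Qed.

Lemma delta_min k v : walkb G k s v -> delta v <= k.
Proof.
move=> walk_v; rewrite leqNgt; apply/negP => lt_k.
by case/andP: (deltaP v) => _ /forallP /(_ (Ordinal lt_k)); rewrite walk_v.
Qed.

Lemma is_dist_delta v k : is_distb G s v k -> k = delta v.
Proof.
case/andP => walk_v /forallP min_k; apply/eqP; rewrite eqn_leq delta_min // andbT leqNgt.
by apply/negP => lt_k; have := min_k (Ordinal lt_k); rewrite delta_walk.
Qed.

Lemma delta_source : delta s = 0.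
Proof. by apply/eqP; rewrite -leqn0 delta_min //=. Qed.

Lemma delta_eq0 v : (delta v == 0) = (v == s).
Proof.
apply/eqP/eqP => [delta0|->]; last exact: delta_source.
by have := delta_walk v; rewrite delta0 /= => /eqP ->.
Qed.

Lemma delta_edge u v : G u v -> delta v <= (delta u).+1.
Proof. by move=> G_uv; apply: delta_min; apply: walk_rcons G_uv; apply: delta_walk. Qed.

Lemma delta_pred v k : delta v = k.+1 -> exists2 u, G u v & delta u = k.
Proof.
move=> delta_v; have := delta_walk v; rewrite delta_v => /walk_last [u walk_u G_uv].
exists u => //.
by have := delta_min walk_u; have := delta_edge G_uv; rewrite delta_v; lia.
Qed.

Lemma delta_lt v : delta v < n.
Proof.
have surj k : k <= delta v -> exists u, delta u = k.
  move=> le_k; rewrite -(subKn le_k); elim: (delta v - k) => [|j [u delta_u]].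
    by exists v; rewrite subn0.
  case delta_j: (delta v - j) => [|i]; first by exists u; rewrite delta_u; lia.
  by rewrite delta_j in delta_u; have [u' _ delta_u'] := delta_pred delta_u; exists u'; lia.
have [f fE] := fin_all_exists (fun k : 'I_(delta v).+1 => surj k (ltn_ord k)).
have f_inj : injective f by move=> i j eq_f; apply: val_inj; rewrite /= -!fE eq_f.
by have := leq_card f f_inj; rewrite !card_ord.
Qed.

Definition preds (v : 'I_n) : {set 'I_n} :=
  [set u in neighbors G v | (delta u).+1 == delta v].

Definition bfs_parent (v : 'I_n) : option 'I_n :=
  if v == s then None else insub (lowest (preds v)).

Definition bfs_label (i : nat) (v : 'I_n) : option (nat * option 'I_n) :=
  if delta v <= i then Some (delta v, bfs_parent v) else None.

Lemma bfs_label0 v : bfs_label 0 v = if v == s then Some (0, None) else None.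
Proof.
rewrite /bfs_label leqn0 delta_eq0 /bfs_parent; case: eqP => [->|] //.
by rewrite delta_source.
Qed.

Lemma in_layer_bfs_label i v : in_layer i (bfs_label i v) = (delta v == i).
Proof. by rewrite /bfs_label; case: leqP => //= lt_i; rewrite gtn_eqF. Qed.

Lemma layer_in_bfs_label i v : i < delta v ->
  layer_in (neighbors G) i (bfs_label i) v = if delta v == i.+1 then preds v else set0.
Proof.
move=> lt_i; apply/setP => u; rewrite inE /frontier in_layer_bfs_label.
case: (eqVneq (delta v) i.+1) => [delta_v|ne]; first by rewrite [RHS]inE delta_v eqSS.
rewrite in_set0 inE; apply/negP => /andP [G_vu /eqP delta_u].
have : delta v <= (delta u).+1 by apply: delta_edge; rewrite symG.
by rewrite delta_u; lia.
Qed.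

Lemma preds_neq0 v : v != s -> preds v != set0.
Proof.
rewrite -delta_eq0; case delta_v: (delta v) => [//|k] _.
have [u G_uv delta_u] := delta_pred delta_v; apply/set0Pn; exists u.
by rewrite !inE symG G_uv delta_v delta_u /=.
Qed.

Lemma next_label_bfs i v : next_label (neighbors G) i (bfs_label i) v = bfs_label i.+1 v.
Proof.
rewrite /next_label {1 2}/bfs_label; case: leqP => [le_i|lt_i].
  by rewrite /bfs_label leqW.
rewrite layer_in_bfs_label // /bfs_label; case: (eqVneq (delta v) i.+1) => [delta_v|ne].
  have neq_s : v != s by rewrite -delta_eq0 delta_v.
  by rewrite (negbTE (preds_neq0 neq_s)) delta_v leqnn /bfs_parent (negbTE neq_s).
rewrite eqxx ifF //; lia.
Qed.

Lemma bfs_label_correct v : correct_output G s v (Some (delta v, bfs_parent v)).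
Proof.
rewrite /= deltaP /bfs_parent; case: (eqVneq v s) => //= neq_s.
have [u0 u0_pred] := set0Pn _ (preds_neq0 neq_s).
have [u u_pred [-> min_u]] := lowestP u0_pred.
rewrite valK; move: u_pred; rewrite !inE => /andP [G_vu /eqP delta_u].
rewrite symG G_vu -delta_u /= deltaP /=; apply/forallP => w; apply/implyP.
move=> /andP [G_wv /is_dist_delta delta_w].
by apply: min_u; rewrite !inE symG G_wv -delta_w delta_u eqxx.
Qed.

End Distances.

(** * Composition of the phases *)

(* Bounds all step lengths; seeds are drawn modulo [(max_length n)`!]. *)
Definition max_length (n : nat) : nat := n ^ 2 + 5.

Section Composition.

Variables (n : nat) (G : rel 'I_n) (s : 'I_n) (a : nat) (delta : 'I_n -> nat).
Hypotheses (symG : symmetric G) (irrG : irreflexive G).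
Hypothesis arbG : forest_partition G a.
Hypothesis deltaP : forall v, is_distb G s v (delta v).
Notation L := (logc n).
Notation nbrs := (neighbors G).
Notation label := (bfs_label G s delta).
Notation answer := (fun v => (delta v, bfs_parent G s delta v)).
Notation reaches :=
  (reaches (P := trie_protocol n) allowed_link (max_length n) (4 * L) answer).
Implicit Type U : 'I_n -> {set 'I_n}.

Lemma ord_gt0 : 0 < n.
Proof. exact: leq_ltn_trans (leq0n s) (ltn_ord s). Qed.

Lemma neighbors_sym u v : (u \in nbrs v) = (v \in nbrs u).
Proof. by rewrite !inE symG. Qed.

Lemma neighbors_irr v : v \notin nbrs v.
Proof. by rewrite inE irrG. Qed.

Lemma consistent_bfs_label i w : consistent_label answer w (label i w).
Proof. by rewrite /consistent_label /bfs_label; case: ifP; [right|left]. Qed.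

Record subgraph U : Prop := Subgraph {
  subgraph_sub : forall v, U v \subset nbrs v;
  subgraph_sym : forall u v, (u \in U v) = (v \in U u)
}.

Definition live U : nat := #|[set v | 0 < #|U v|]|.

Definition layer_degree (i : nat) : nat := \sum_(w | delta w == i) #|nbrs w|.

Definition sums U (i : nat) : nat * nat * nat :=
  grand_total (fun w => own_sums (nbrs w) #|U w| i (label i w)).

(* [U] is the set of edges still missing from the tries, [i] the BFS layer. *)
Definition at_phase U (i : nat) : config (trie_protocol n) -> Prop :=
  conf (fun w => phase_start (nbrs w) #|U w| i (label i w))
    (trie_count (fun v => nbrs v :\: U v)) no_msg.

Lemma sumsE U i : sums U i = (live U, \sum_w #|U w|, layer_degree i).
Proof.
rewrite /sums /grand_total big_add_sums /=; congr (_, _, _).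
  rewrite /live -sum1_card [RHS]big_mkcond; apply: eq_bigr => w _.
  by rewrite inE; case: (0 < _).
by rewrite /layer_degree [RHS]big_mkcond; apply: eq_bigr => w _; rewrite in_layer_bfs_label.
Qed.

Lemma sum_card_leq (A : 'I_n -> {set 'I_n}) : \sum_w #|A w| <= n * n.
Proof.
rewrite -[X in X * _]card_ord -sum_nat_const; apply: leq_sum => w _.
by rewrite -[X in _ <= X]card_ord max_card.
Qed.

Lemma layer_degree_leq i : layer_degree i <= n * n.
Proof.
apply: leq_trans (sum_card_leq nbrs).
by rewrite [X in _ <= X](bigID (fun w => delta w == i)) leq_addr.
Qed.

Lemma live_leq U : live U <= n.
Proof. by rewrite -[X in _ <= X]card_ord max_card. Qed.

Lemma sums_small U i : small_msg n (Sums (sums U i)).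
Proof.
rewrite sumsE /small_msg /= sum_card_leq layer_degree_leq andbT.
by have := live_leq U; nia.
Qed.

Lemma max_length_gt0 : 0 < max_length n.
Proof. by rewrite /max_length addn_gt0 orbT. Qed.

Lemma reduce_phase U i : reaches (2 * L) (2 * L) (at_phase U i)
  (conf (fun w => RState (nbrs w) #|U w| (root_keys n (sums U i) #|U w|) (sums U i) (2 * L)
                    i (label i w)) (trie_count (fun v => nbrs v :\: U v)) no_msg).
Proof.
apply: all_reduce; [exact: max_length_gt0 | exact: consistent_bfs_label | exact: sums_small].
Qed.

Lemma sum_subgraph_leq U : subgraph U -> \sum_v #|U v| <= 2 * a * live U.
Proof. by case=> U_sub U_sym; apply: arboricity_bound arbG U_sub U_sym. Qed.

Lemma sum_live_leq U : \sum_v #|U v| <= n * live U.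
Proof.
rewrite (bigID (fun v => 0 < #|U v|)) /= [X in _ + X]big1 ?addn0; last first.
  by move=> v; rewrite -eqn0Ngt => /eqP.
rewrite /live cardsE mulnC -sum_nat_const; apply: leq_sum => v _.
by rewrite -[X in _ <= X]card_ord max_card.
Qed.

Lemma threshold_leq U i : subgraph U -> 0 < live U ->
  threshold (sums U i) <= 4 * a + 2 /\ threshold (sums U i) <= 2 * n + 2.
Proof.
move=> sub_U live_gt0; rewrite /threshold sumsE /=.
have avg_a : (\sum_w #|U w|) %/ live U <= 2 * a.
  by rewrite -(mulnK (2 * a) live_gt0) leq_div2r // sum_subgraph_leq.
have avg_n : (\sum_w #|U w|) %/ live U <= n.
  by rewrite -[X in _ <= X](mulnK n live_gt0) leq_div2r // sum_live_leq.
by split; lia.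
Qed.

Lemma live_remaining U i : 0 < live U -> 2 * live (remaining U (sums U i)) < live U.
Proof.
move=> live_gt0; set t := sums U i; pose rich := [set v | threshold t < #|U v|].
have live_rich : live (remaining U t) <= #|rich|.
  apply: subset_leq_card; apply/subsetP => v; rewrite !inE => /card_gt0P [u].
  rewrite !inE => /andP [+ uU]; rewrite uU /= negb_or => /andP [+ _].
  rewrite /poor_node /poor negb_and => /orP [|]; last by rewrite -ltnNge.
  by rewrite -eqn0Ngt cards_eq0 => /eqP U0; rewrite U0 inE in uU.
have card_rich : #|rich| * (threshold t).+1 <= \sum_v #|U v|.
  rewrite -sum_nat_const; apply: (@leq_trans (\sum_(v in rich) #|U v|)).
    by apply: leq_sum => v; rewrite inE.
  by rewrite [X in _ <= X](bigID (mem rich)) /= leq_addr.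
have : \sum_v #|U v| < ((\sum_v #|U v|) %/ live U).+1 * live U by apply: ltn_ceil.
have thresholdE : threshold t = 2 * ((\sum_v #|U v|) %/ live U) + 2.
  by rewrite /threshold /t sumsE.
by rewrite thresholdE in card_rich; nia.
Qed.

Lemma subgraph_remaining U t : subgraph U -> subgraph (remaining U t).
Proof.
case=> U_sub U_sym; split=> [v|u v]; first exact: subset_trans (subsetDl _ _) (U_sub v).
by rewrite !inE (U_sym u v) orbC.
Qed.

Lemma insertion_phase U i : subgraph U -> 0 < live U ->
  reaches (5 * L + 2) (20 * (a + L)) (at_phase U i) (at_phase (remaining U (sums U i)) i).
Proof.
move=> sub_U live_gt0; have [U_sub U_sym] := sub_U; have L_gt0 := logc_gt0 n.
have [le_a le_n] := threshold_leq i sub_U live_gt0; set t := sums U i in le_a le_n *.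
have t_inserting : inserting t by rewrite /inserting /t sumsE.
have length_ok : insert_length n t <= max_length n.
  by rewrite /insert_length /max_length; have := leq_div (threshold t) L; nia.
have body := insertion_body (d := i) (leqnn (4 * L)) U_sub U_sym t_inserting (sums_small U i)
  (consistent_bfs_label i) length_ok.
have := reaches_trans (@reduce_phase U i) body.
have -> : 2 * L + (3 * L + 2) = 5 * L + 2 by lia.
apply: reaches_weaken => //; rewrite /insert_length.
by have := leq_divM (threshold t) L; nia.
Qed.

Lemma at_phase_eq U V i : U =1 V -> forall Y, at_phase U i Y -> at_phase V i Y.
Proof.
move=> eqUV Y; apply: conf_eq => // [w|y]; first by rewrite eqUV.
by apply: eq_trie_count => v; rewrite eqUV.
Qed.

Lemma all_inserted U i T : live U = 0 -> reaches 0 T (at_phase U i) (at_phase (fun=> set0) i).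
Proof.
move=> live0; apply: (reaches_weaken (leq0n T) (fun Y at_U => at_U)); last exact: reaches_refl.
apply: at_phase_eq => v; have /cards0_eq/setP/(_ v) := live0.
by rewrite !inE lt0n => /negbFE; rewrite cards_eq0 => /eqP.
Qed.

Lemma insertion_phases j U i : subgraph U -> live U < 2 ^ j ->
  exists2 k, k <= j * (5 * L + 2) &
    reaches k (j * (20 * (a + L))) (at_phase U i) (at_phase (fun=> set0) i).
Proof.
elim: j U => [|j IH] U sub_U lt_j.
  by exists 0 => //; apply: all_inserted; apply/eqP; rewrite -leqn0.
have [live0|live_gt0] := posnP (live U); first by exists 0 => //; apply: all_inserted.
have lt_rest : live (remaining U (sums U i)) < 2 ^ j.
  by have := live_remaining i live_gt0; move: lt_j; rewrite expnS; lia.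
have [k le_k rest] := IH _ (subgraph_remaining _ sub_U) lt_rest.
exists (5 * L + 2 + k); first by rewrite [j.+1 * _]mulSn leq_add2l.
by rewrite [j.+1 * _]mulSn; apply: reaches_trans (insertion_phase sub_U live_gt0) rest.
Qed.

Definition bfs_phase_length (i : nat) : nat :=
  2 * L + (2 * L + 3) * (layer_degree i %/ (n * L)).+1.

Lemma sum_layer_out i : \sum_w #|layer_out nbrs i (label i) w| = layer_degree i.
Proof.
rewrite /layer_degree [RHS]big_mkcond; apply: eq_bigr => w _.
rewrite -(in_layer_bfs_label G s); case front_w: (in_layer _ _).
  by apply: eq_card => u; rewrite !inE /frontier front_w andbT.
by rewrite eq_card0 // => u; rewrite !inE /frontier front_w andbF.
Qed.

Lemma bfs_phase i :
  reaches (4 * L + 3) (bfs_phase_length i)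
    (at_phase (fun=> set0) i) (at_phase (fun=> set0) i.+1).
Proof.
set none := fun=> set0; have n_gt0 := ord_gt0; set t := sums none i.
have live0 : live none = 0 by apply: eq_card0 => v; rewrite !inE cards0.
have t_bfs : inserting t = false by rewrite /inserting /t sumsE live0.
have degreeE : t.2 = \sum_w #|layer_out nbrs i (label i) w| by rewrite /t sumsE sum_layer_out.
have length_ok : bfs_length n t <= max_length n.
  rewrite /bfs_length /max_length /t sumsE; have := layer_degree_leq i.
  by have := leq_div (layer_degree i) (n * L); rewrite /=; nia.
have countE : trie_count (fun v => nbrs v :\: none v) =1 trie_count nbrs.
  by move=> y; apply: eq_trie_count => v; rewrite setD0.
have body := bfs_body (missing := fun w => #|none w|) (keys := fun w => root_keys n t #|none w|)
  n_gt0 (leqnn (4 * L)) neighbors_sym neighbors_irr t_bfs (sums_small none i)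
  (consistent_bfs_label i) degreeE length_ok.
have -> : bfs_phase_length i = 2 * L + (2 * L + 3) * bfs_length n t.
  by rewrite /bfs_length /t sumsE.
have -> : 4 * L + 3 = 2 * L + (2 * L + 3) by lia.
apply: reaches_trans (@reduce_phase none i) (reaches_weaken (leqnn _) _ _ body) => Y.
  by apply: conf_eq.
by apply: conf_eq => // w; rewrite (next_label_bfs symG deltaP).
Qed.

Lemma bfs_phases E :
  reaches (E * (4 * L + 3)) (\sum_(i < E) bfs_phase_length i)
    (at_phase (fun=> set0) 0) (at_phase (fun=> set0) E).
Proof. by apply: (reaches_chain (C := at_phase (fun=> set0))) => i _; apply: bfs_phase. Qed.

Lemma sum_layer_degree E : \sum_(i < E) layer_degree i <= 2 * a * n.
Proof.
apply: (@leq_trans (\sum_w #|nbrs w|)).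
  rewrite /layer_degree (exchange_big_dep xpredT) //=; apply: leq_sum => w _.
  rewrite sum_nat_const -[X in _ <= X]mul1n leq_mul2r; apply/orP; right.
  apply/card_le1_eqP => i j; rewrite !unfold_in => /eqP delta_i /eqP delta_j.
  by apply: val_inj; rewrite /= -delta_i -delta_j.
apply: leq_trans (arboricity_bound symG irrG arbG (fun v => subxx (nbrs v)) neighbors_sym) _.
by rewrite leq_mul2l live_leq orbT.
Qed.

Lemma sum_bfs_phase_length E : \sum_(i < E) bfs_phase_length i <= 7 * L * E + 10 * a.
Proof.
have n_gt0 := ord_gt0; have L_gt0 := logc_gt0 n; rewrite -(leq_pmul2r n_gt0) big_distrl /=.
apply: (@leq_trans (\sum_(i < E) (7 * L * n + 5 * layer_degree i))).
  apply: leq_sum => i _; have := leq_divM (layer_degree i) (n * L).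
  by rewrite /bfs_phase_length; move: (_ %/ _) => m; nia.
rewrite big_split /= sum_nat_const card_ord -big_distrr /= mulnDl; apply: leq_add; first by lia.
by apply: leq_trans (leq_mul (leqnn 5) (sum_layer_degree E)) _; lia.
Qed.

Lemma init_at_phase : at_phase nbrs 0 (@init_config n (trie_protocol n) G s).
Proof.
split=> [w|y] /=; first by rewrite (bfs_label0 deltaP).
by congr (_, _); apply/esym/eq_card0 => u; rewrite !inE andNb.
Qed.

Lemma logc_leq : L <= n.
Proof.
have := trunc_logP (ltnSn 1) ord_gt0; have := ltn_expl (trunc_log 2 n) (ltnSn 1).
by rewrite /logc; lia.
Qed.

Lemma bfs_run E : (forall v, delta v <= E) -> E <= n ->
  exists2 k, k <= 21 * n ^ 2 &
    run (P := trie_protocol n) allowed_link (max_length n) (4 * L) answer k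
      (30 * (a + E + L) * L) (@init_config n (trie_protocol n) G s) /\
    forall w, voutput (iter k (@vstep n (trie_protocol n))
                        (@init_config n (trie_protocol n) G s) (inl w)) = Some (answer w).
Proof.
move=> delta_leq le_E; have L_gt0 := logc_gt0 n; have le_L := logc_leq.
have live_lt : live nbrs < 2 ^ L := leq_ltn_trans (live_leq nbrs) (ltn_exp_logc n).
have sub_nbrs : subgraph nbrs by split=> // u v; apply: neighbors_sym.
have [k le_k insert] := insertion_phases 0 sub_nbrs live_lt.
exists (k + E * (4 * L + 3)); first by nia.
have le_T : L * (20 * (a + L)) + \sum_(i < E) bfs_phase_length i <= 30 * (a + E + L) * L.
  by have := sum_bfs_phase_length E; nia.
have all := reaches_weaken le_T (fun Y at_0 => at_0) (fun Y at_E => at_E)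
  (reaches_trans insert (@bfs_phases E)).
have [[realE _] run_all] := all _ init_at_phase; split=> // w.
by rewrite /= realE /= /bfs_label delta_leq.
Qed.

End Composition.

(** * Success with high probability *)

(* The sampling exponent: failing with probability [n ^ -(c + 22)] per round and
   pair of nodes absorbs the union bound over all steps, rounds and nodes. *)
Definition tail_exponent (c : nat) : nat := c + 22.

Lemma tail_exponent_gt0 c : 0 < tail_exponent c.
Proof. by rewrite /tail_exponent addn_gt0 orbT. Qed.

Definition pair_load (c : nat) : nat := 4 * #|colour| * (2 * tail_exponent c).

Definition node_load (c n : nat) : nat := (tail_exponent c + 32) * logc n.

Definition bfs_alg (c : nat) : NCCAlg := simulate trie_protocol max_length (pair_load c).

Definition capacity (c : nat) : nat :=
  4 * #|colour| * (tail_exponent c + 32) + (18 * pair_load c + 1).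

Lemma node_load_exp c n : n ^ tail_exponent c <= 2 ^ node_load c n.
Proof.
apply: (@leq_trans ((2 ^ logc n) ^ tail_exponent c)).
  by rewrite leq_exp2r ?tail_exponent_gt0 // ltnW ?ltn_exp_logc.
by rewrite -expnM leq_exp2l // mulnC leq_mul2r leq_addr orbT.
Qed.

Lemma card_vnode_leq n : #|{: vnode n (tnode n)}| <= 2 ^ (4 * logc n).
Proof.
have lt_n := ltn_exp_logc n; have lt_L : (logc n).+1 <= 2 ^ logc n by apply: ltn_expl.
rewrite card_sum !card_prod !card_ord.
have le_tnode : n * (logc n).+1 * n <= 2 ^ (3 * logc n).
  by rewrite 2!mulSn mul1n addnA !expnD !leq_mul // ltnW.
have le_n : n <= 2 ^ (3 * logc n).
  by apply: leq_trans (ltnW lt_n) _; rewrite leq_exp2l // leq_pmull.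
apply: (@leq_trans (2 ^ (3 * logc n).+1)); first by rewrite expnS mul2n -addnn leq_add.
by rewrite leq_exp2l //; have := logc_gt0 n; lia.
Qed.

Lemma card_msg_code_leq n : #|{: msg_code n}| <= 2 ^ (9 * logc n).
Proof.
have lt_sq : n * n < 2 ^ (2 * logc n).
  by rewrite mul2n -addnn expnD ltn_mul // ltn_exp_logc.
rewrite !card_prod !card_ord.
have -> : 9 * logc n = 3 * logc n + (2 * logc n + 2 * logc n + 2 * logc n) by lia.
by rewrite !expnD !leq_mul // -[8]/(2 ^ 3) leq_exp2l // leq_pmulr.
Qed.

Lemma pack_width_trie n c :
  pack_width (packet (trie_protocol n)) (pair_load c) <= capacity c * logc n.
Proof.
have card_packet : #|{: option (packet (trie_protocol n))}| <= 2 ^ (18 * logc n).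
  rewrite card_option 2!card_prod; apply: (@leq_ltn_trans (2 ^ (17 * logc n))); last first.
    by rewrite ltn_exp2l //; have := logc_gt0 n; lia.
  have -> : 17 * logc n = 4 * logc n + 4 * logc n + 9 * logc n by lia.
  by rewrite !expnD !leq_mul ?card_vnode_leq // card_msg_code_leq.
apply: leq_trans (pack_width_leq _ card_packet) _.
by rewrite /capacity; have := logc_gt0 n; nia.
Qed.

Lemma logc_sq_leq n : 0 < n -> logc n ^ 2 <= 4 * n.
Proof.
move=> n_gt0; have := trunc_logP (ltnSn 1) n_gt0; rewrite /logc.
move: (trunc_log 2 n) => t le_n; suff : t.+1 ^ 2 <= 4 * 2 ^ t by lia.
case: t {le_n} => [//|[//|t]]; elim: t => [//|t IH].
by rewrite expnS mulnCA; apply: leq_trans (leq_mul (leqnn 2) IH); nia.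
Qed.

Lemma max_length_geq n : n <= max_length n.
Proof. by rewrite /max_length; nia. Qed.

Lemma card_bfs_failure c n (G : rel 'I_n) (s : 'I_n) a D (adv : Adv (bfs_alg c) n) :
    symmetric G -> irreflexive G -> forest_partition G a -> is_diameter G D ->
    valid_adv (capacity c * logc n) adv ->
  #|[set r : Rnd (bfs_alg c) n | ~~ bfs_success G s (capacity c * logc n) adv r
       (30 * (a + D + logc n) * logc n)]| * n ^ tail_exponent c
    <= 21 * n ^ 2 * (16 * #|colour| * n ^ 2 * max_length n) * #|Rnd (bfs_alg c) n|.
Proof.
move=> symG irrG arbG [diamG _] valid; have n_gt0 := ord_gt0 s.
have [delta delta_D deltaP] := fin_all_exists2 (diamG s).
have le_n : \max_v delta v <= n by apply/bigmax_leqP => v _; apply: ltnW (delta_lt deltaP v).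
have le_D : \max_v delta v <= D by apply/bigmax_leqP.
have [k le_k [run_k final]] := bfs_run symG irrG arbG deltaP (fun v => leq_bigmax v) le_n.
have run_D : run (P := trie_protocol n) allowed_link (max_length n) (4 * logc n)
    (fun v => (delta v, bfs_parent G s delta v)) k (30 * (a + D + logc n) * logc n)
    (@init_config n (trie_protocol n) G s).
  have [len time steps] := run_k; exists len => //; apply: leq_trans time _.
  by rewrite leq_mul2r leq_mul2l leq_add2r leq_add2l le_D !orbT.
have load_geq : 8 * (4 * logc n) <= node_load c n.
  by rewrite mulnA leq_mul2r /node_load leq_addl orbT.
have tail_geq : 4 * (4 * logc n) ^ 2 <= tail_exponent c ^ 2 * n.
  have : 16 ^ 2 <= tail_exponent c ^ 2 by rewrite leq_exp2r // /tail_exponent; lia.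
  by have := logc_sq_leq n_gt0; rewrite expnMn; nia.
have cap_geq : 4 * #|colour| * node_load c n <= capacity c * logc n.
  by rewrite /node_load mulnA leq_mul2r leq_addr orbT.
have n_bound : 0 < n <= max_length n by rewrite n_gt0 max_length_geq.
have l_gt0 : 0 < 4 * logc n by rewrite muln_gt0.
apply: leq_trans (card_simulate_failure (P := trie_protocol) n_bound
  (@link_class_disjoint n) (@allowed_link_neq n) l_gt0 (tail_exponent_gt0 c) load_geq
  (node_load_exp c n) tail_geq cap_geq (pack_width_trie n c) final
  (bfs_label_correct symG deltaP) valid run_D) _.
by rewrite leq_mul2r leq_mul2r le_k !orbT.
Qed.

Lemma polynomial_absorbed n : 1 < n ->
  21 * n ^ 2 * (16 * #|colour| * n ^ 2 * max_length n) <= n ^ 22.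
Proof.
move=> n_gt1; have le_max : max_length n <= 6 * n ^ 2 by rewrite /max_length; nia.
apply: (@leq_trans (21 * n ^ 2 * (16 * #|colour| * n ^ 2 * (6 * n ^ 2)))).
  by rewrite !leq_mul.
have -> : 21 * n ^ 2 * (16 * #|colour| * n ^ 2 * (6 * n ^ 2)) = 21 * 512 * 6 * n ^ 6.
  have -> : n ^ 6 = n ^ 2 * n ^ 2 * n ^ 2 by rewrite -!expnD.
  by rewrite card_colour; lia.
rewrite -[22]/(16 + 6) expnD leq_mul2r; apply/orP; right.
apply: (@leq_trans (2 ^ 16)); last by rewrite leq_exp2r.
by rewrite mulnAC -[16]/(7 + 9) expnD leq_mul.
Qed.

Theorem theorem5p3 :
  forall c : nat, 0 < c ->
  exists (A : NCCAlg) (K C : nat),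
    (forall n, 0 < #|Rnd A n|) /\
    forall (n : nat) (G : rel 'I_n) (s : 'I_n) (a D : nat),
      symmetric G -> irreflexive G ->
      is_arboricity G a -> is_diameter G D ->
      forall adv : Adv A n, valid_adv (K * logc n) adv ->
        #|[set r : Rnd A n |
            ~~ bfs_success G s (K * logc n) adv r (C * (a + D + logc n) * logc n)]|
          * n ^ c <= #|Rnd A n|.
Proof.
move=> c _; exists (bfs_alg c), (capacity c), 30; split=> [n|].
  by rewrite card_ffun card_ord expn_gt0 fact_gt0.
move=> n G s a D symG irrG [arbG _] diamG adv valid.
have failures := card_bfs_failure s symG irrG arbG diamG valid.
have [n_gt1|n_le1] := ltnP 1 n.
  rewrite -(@leq_pmul2r (n ^ 22)) ?expn_gt0 ?(ltnW n_gt1) // -mulnA -expnD.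
  apply: leq_trans failures _; rewrite [X in _ <= X]mulnC leq_mul2r.
  by rewrite polynomial_absorbed ?orbT.
have -> : n ^ c = 1 by rewrite (_ : n = 1) ?exp1n //; have := ord_gt0 s; lia.
by rewrite muln1 max_card.
Qed.
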